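(* Let $\Gamma$ be a connected graph, $\eta\in\overline C_0(\Gamma;\mathbb C^* )$ generic, and write $|X|$ for the class of a complex variety $X$ in the Grothendieck ring of complex varieties, $\mathbb L=|\mathbb A^1|$. Write $\bigcirc$ for the graph with one vertex and one (loop) edge. Then: (1) $|\mathfrak B(\bigcirc)|=\mathbb L^2-\mathbb L+1$. (2) For every edge $e$ of $\Gamma$, $$|\mathfrak B(\Gamma)|=\begin{cases}|\mathfrak B(\Gamma/e)| & \text{if } e \text{ is a bridge},\\ |\mathfrak B(\Gamma\setminus e)|\cdot|\mathfrak B(\bigcirc)| & \text{if } e\text{ is a loop},\\ |\mathfrak B(\Gamma\setminus e)|\cdot\mathbb L+|\mathfrak B(\Gamma/e)| & \text{otherwise.}\end{cases}$$ (3) $$|\mathfrak B(\Gamma)|=\sum_{\Gamma'\in \mathrm{Span}(\Gamma)}(\mathbb L-1)^{2b_1(\Gamma')}\,\mathbb L^{\,b_1(\Gamma)-b_1(\Gamma')},$$ where $\mathrm{Span}(\Gamma)$ is the set of connected subgraphs of $\Gamma$ containing all vertices of $\Gamma$, and $b_1$ is the first Betti number. In particular, the Euler characteristic of $\mathfrak B(\Gamma)$ is the number of spanning trees of $\Gamma$.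
   Context: A graph $\Gamma$ is a finite oriented multigraph, loops allowed: finite sets $V(\Gamma)$, $E(\Gamma)$ and maps $h,t:E(\Gamma)\to V(\Gamma)$ (head, tail). For an abelian group $A$ (written additively, identity $0$, even when $A=\mathbb C^*$): $d_\Gamma:A^{E(\Gamma)}\to A^{V(\Gamma)}$, $(d_\Gamma a)_v=\sum_{h(e)=v}a_e-\sum_{t(e)=v}a_e$; $d_\Gamma^*:A^{V(\Gamma)}\to A^{E(\Gamma)}$, $(d_\Gamma^*g)_e=g_{h(e)}-g_{t(e)}$; $\overline C_0(\Gamma;A)\subset A^{V(\Gamma)}$ is the subgroup of elements with total sum $0$; $\overline C^0(\Gamma;A)=A^{V(\Gamma)}/\{\text{constants}\}$. An element $\eta\in\overline C_0(\Gamma;A)$ is *generic* if for every $a\in A^{E(\Gamma)}$ with $d_\Gamma a=\eta$, the subgraph consisting of all vertices and of the edges with $a_e\neq0$ is connected. $\mathfrak B=\{(x,y)\in\mathbb C^2:1+xy\ne0\}$, with $\mathbb C^*$-action $\tau\cdot(x,y)=(\tau x,\tau^{-1}y)$. For generic $\eta\in\overline C_0(\Gamma;\mathbb C^* )$, $$\mathfrak B(\Gamma)=\mathfrak B(\Gamma,\eta)=\{(x_e,y_e)_e\in\mathfrak B^{E(\Gamma)}: d_\Gamma((1+x_ey_e)_e)=\eta\}/\overline C^0(\Gamma;\mathbb C^* ),$$ where $g$ acts on the $e$-th factor through $(d^*_\Gamma g)_e\in\mathbb C^*$; this is a free quotient and a smooth affine variety. $\Gamma\setminus e$ is $\Gamma$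 with the edge $e$ deleted, and $\mathfrak B(\Gamma\setminus e)$ is formed with the same function $\eta$ on $V(\Gamma\setminus e)=V(\Gamma)$. For $e$ not a loop, $\Gamma/e$ is obtained by removing $e$ and merging $h(e)$ and $t(e)$ into one vertex, and $\mathfrak B(\Gamma/e)$ is formed with the parameter whose value at the merged vertex is the product $\eta_{h(e)}\eta_{t(e)}$ and which is unchanged elsewhere. These parameters are again generic whenever $\eta$ is. An edge is a bridge if its deletion disconnects $\Gamma$. The Grothendieck ring of varieties is generated by classes of varieties with relation $|X|=|X\setminus Y|+|Y|$ for $Y\subset X$ a closed subvariety, with product induced by the Cartesian product. *)

(* Defs.v *)
From HB Require Import structures.
From mathcomp Require Import all_boot all_order all_algebra.
From mathcomp Require Import all_classical reals topology normedtype.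
From mathcomp Require Import Rstruct Rstruct_topology.
From mathcomp Require Import complex freeg.
From mathcomp Require Import -(notations) mpoly.

Set Implicit Arguments.
Unset Strict Implicit.
Unset Printing Implicit Defensive.

Import Order.TTheory GRing.Theory Num.Theory numFieldNormedType.Exports.

Local Open Scope classical_set_scope.
Local Open Scope ring_scope.

Notation RR := Rdefinitions.R.
Notation CC := (complex Rdefinitions.R).

Record graph := Graph {
  vert : finType;
  edge : finType;
  hd : edge -> vert;
  tl : edge -> vert }.

Arguments hd {g}.
Arguments tl {g}.

Definition adjacent (G : graph) : rel (vert G) := fun u v =>
  [exists e : edge G,
     ((hd e == u) && (tl e == v)) || ((hd e == v) && (tl e == u))].

Definition gconnected (G : graph) : bool :=
  (0 < #|vert G|)%N && [forall u, forall v, connect (@adjacent G) u v].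

Definition is_loop (G : graph) (e : edge G) : bool := hd e == tl e.

Definition subgraph (G : graph) (S : {set edge G}) : graph :=
  @Graph (vert G) {e : edge G | e \in S}
    (fun e => hd (val e)) (fun e => tl (val e)).

Definition delete (G : graph) (e : edge G) : graph := subgraph [set~ e].

Definition bridge (G : graph) (e : edge G) : bool := ~~ gconnected (delete e).

Definition ends (G : graph) (e : edge G) : {set vert G} :=
  [set hd e; tl e]%SET.

(* The vertices of the contraction are the blocks of the partition of the
   vertex set whose only possibly non-trivial block is [ends e]. *)
Definition block (G : graph) (e : edge G) (v : vert G) : {set vert G} :=
  if v \in ends e then ends e else [set v]%SET.

Definition blocks (G : graph) (e : edge G) : {set {set vert G}} :=
  [set block e v | v : vert G]%SET.

Definition to_block (G : graph) (e : edge G) (v : vert G) :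
    {B : {set vert G} | B \in blocks e} :=
  exist _ (block e v) (imset_f (block e) (erefl (v \in vert G))).

Definition contract (G : graph) (e : edge G) : graph :=
  @Graph {B : {set vert G} | B \in blocks e} {f : edge G | f != e}
    (fun f => to_block e (hd (val f))) (fun f => to_block e (tl (val f))).

(* An edge together with a direction of travel; [true] goes from tail to
   head. *)
Definition dsrc (G : graph) (d : edge G * bool) : vert G :=
  if d.2 then tl d.1 else hd d.1.
Definition dtgt (G : graph) (d : edge G * bool) : vert G :=
  if d.2 then hd d.1 else tl d.1.

Definition acyclic (G : graph) : Prop :=
  forall s : seq (edge G * bool), s != [::] -> uniq [seq d.1 | d <- s] ->
    ~~ cycle (fun d d' => dtgt d == dsrc d') s.

Definition is_tree (G : graph) : Prop := gconnected G /\ acyclic G.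

Definition num_spanning_trees (G : graph) : nat :=
  #|[set S : {set edge G} | `[< is_tree (subgraph S) >]]%SET|.

Section Chains.
Variables (G : graph) (A : zmodType).

Definition bd (a : edge G -> A) (v : vert G) : A :=
  \sum_(e | hd e == v) a e - \sum_(e | tl e == v) a e.

Definition cobd (g : vert G -> A) (e : edge G) : A := g (hd e) - g (tl e).

Definition sum_zero (eta : vert G -> A) : Prop := \sum_v eta v = 0.

Definition generic (eta : vert G -> A) : Prop :=
  forall a : edge G -> A, bd a =1 eta ->
    gconnected (subgraph [set e | a e != 0]%SET).

End Chains.

Definition contract_param (G : graph) (A : zmodType) (eta : vert G -> A)
    (e : edge G) (B : vert (contract e)) : A :=
  \sum_(v in val B) eta v.

Arguments contract_param {G A} eta e B.

Definition betti1 (G : graph) : nat :=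
  \dim (lker (linfun (fun a : {ffun edge G -> rat^o} =>
    [ffun v => bd a v] : {ffun vert G -> rat^o}))).

Definition loop_graph : graph :=
  @Graph unit unit (fun=> tt) (fun=> tt).

(* The multiplicative group of the complex numbers, with its group law written
   additively: [x + y] is the product of complex numbers, [0] is [1]. *)
Definition Cstar := {z : CC | z != 0}.

HB.instance Definition _ := Choice.on Cstar.

Definition cstar_mul (x y : Cstar) : Cstar :=
  exist _ (val x * val y) (mulf_neq0 (valP x) (valP y)).
Definition cstar_inv (x : Cstar) : Cstar :=
  exist _ (val x)^-1 (invr_neq0 (valP x)).
Definition cstar_one : Cstar := exist _ 1 (oner_neq0 _).

Lemma cstar_mulA : associative cstar_mul.
Proof. by move=> x y z; apply: val_inj; rewrite /= mulrA. Qed.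
Lemma cstar_mulC : commutative cstar_mul.
Proof. by move=> x y; apply: val_inj; rewrite /= mulrC. Qed.
Lemma cstar_mul1 : left_id cstar_one cstar_mul.
Proof. by move=> x; apply: val_inj; rewrite /= mul1r. Qed.
Lemma cstar_mulV : left_inverse cstar_one cstar_inv cstar_mul.
Proof. by move=> x; apply: val_inj; rewrite /= mulVf ?(valP x). Qed.

HB.instance Definition _ :=
  GRing.isZmodule.Build Cstar cstar_mulA cstar_mulC cstar_mul1 cstar_mulV.

(* A copy of ['I_n] in [Set].  The points of varieties have to live in a smaller
   universe than the carriers of algebraic structures, so that the ring of
   varieties can be one of these; this is also why the real numbers are the
   concrete ones of the standard library. *)
Definition fin (n : nat) : Set := {i : nat | (i < n)%N}.

Definition to_fin (n : nat) (i : 'I_n) : fin n :=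
  exist (fun i => (i < n)%N) (val i) (ltn_ord i).

(* Complex varieties in the classical language of spaces with functions: a
   topological space (Zariski topology) together with, for each open set, its
   complex-valued regular functions.  [regular U f] only concerns the values
   of [f] on [U], and is only meaningful for [U] open. *)
Section Varieties.

Record fspace := FSpace {
  pt :> Type;
  zopen : (pt -> Prop) -> Prop;
  regular : (pt -> Prop) -> (pt -> CC) -> Prop }.

Arguments zopen {f}.
Arguments regular {f}.

(* The last clause is the sheaf condition, including compatibility with
   restriction. *)
Definition is_fspace (X : fspace) : Prop :=
  [/\ @zopen X setT,
      forall U V : set X, zopen U -> zopen V -> zopen (U `&` V),
      forall F : set (set X), F `<=` zopen -> zopen (\bigcup_(U in F) U)
    & forall (U : set X) (f : X -> CC), zopen U ->
        regular U f <->
        (forall x, U x -> exists V g,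
           [/\ zopen V, V x, regular V g
             & forall y, U y -> V y -> f y = g y])].

Definition morphism (X Y : fspace) (f : X -> Y) : Prop :=
  forall V : set Y, zopen V ->
    zopen (f @^-1` V) /\
    (forall g, regular V g -> regular (f @^-1` V) (g \o f)).

Definition isomorphic (X Y : fspace) : Prop :=
  exists (f : X -> Y) (g : Y -> X),
    [/\ morphism f, morphism g, cancel f g & cancel g f].

(* The space with functions of a subset of affine n-space (or of any set
   mapping to it): Zariski topology, and functions which are locally quotients
   of polynomials. *)
Definition embedded (T : Type) (n : nat) (iota : T -> 'I_n -> CC) : fspace :=
  @FSpace T
    (fun U => exists S : set (mpoly n CC),
       U = [set x | exists2 p, S p & meval (iota x) p != 0])
    (fun U f => forall x, U x -> exists p q : mpoly n CC,
       meval (iota x) q != 0 /\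
       forall y, U y -> meval (iota y) q != 0 ->
         f y = meval (iota y) p / meval (iota y) q).

Definition algebraic_set (n : nat) (S : set (mpoly n CC)) :=
  {z : fin n -> CC | forall p, S p -> meval (z \o @to_fin n) p = 0}.

Definition affine (X : fspace) : Prop :=
  exists (n : nat) (S : set (mpoly n CC)),
    isomorphic X (embedded (fun z : algebraic_set S => sval z \o @to_fin n)).

Definition subfspace (X : fspace) (S : set X) : fspace :=
  @FSpace {x : X | S x}
    (fun W => exists2 U : set X, zopen U & W = [set x | U (sval x)])
    (fun W f => forall x, W x -> exists U g,
       [/\ zopen U, U (sval x), regular U g
         & forall y, W y -> U (sval y) -> f y = g (sval y)]).

(* Sums of products of regular functions on the two factors. *)
Definition tensor (X Y : fspace) (U : set X) (V : set Y)
    (h : X * Y -> CC) : Prop :=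
  exists (n : nat) (f : 'I_n -> X -> CC) (g : 'I_n -> Y -> CC),
    [/\ forall k, regular U (f k), forall k, regular V (g k)
      & forall p, h p = \sum_(k < n) f k p.1 * g k p.2].

Definition product (X Y : fspace) : fspace :=
  @FSpace (X * Y)%type
    (fun W => forall p, W p -> exists (U : set X) (V : set Y) h,
       [/\ zopen U, zopen V, tensor U V h, U p.1 /\ V p.2 /\ h p != 0
         & forall q, U q.1 -> V q.2 -> h q != 0 -> W q])
    (fun W f => forall p, W p -> exists (U : set X) (V : set Y) a b,
       [/\ zopen U /\ zopen V, tensor U V a /\ tensor U V b,
           U p.1 /\ V p.2, b p != 0
         & forall q, W q -> U q.1 -> V q.2 -> b q != 0 -> f q = a q / b q]).

Definition zseparated (X : fspace) : Prop :=
  @zopen (product X X) [set p | p.1 <> p.2].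

Definition is_variety (X : fspace) : Prop :=
  [/\ is_fspace X,
      exists (n : nat) (U : 'I_n -> set X),
        [/\ forall k, zopen (U k), forall x, exists k, U k x
          & forall k, affine (subfspace (U k))]
    & zseparated X].

Record variety := Variety { vspace :> fspace; _ : is_variety vspace }.

Definition affine_line : fspace := embedded (fun (z : CC) (_ : 'I_1) => z).

(* The quotient by an equivalence relation, such as the orbit relation of a
   group action: quotient topology, and invariant regular functions. *)
Definition quotient_pt (X : Type) (r : X -> X -> Prop) : Type :=
  {A : X -> Prop | exists x, A = r x}.

Definition quotient_proj (X : Type) (r : X -> X -> Prop) (x : X) :
  quotient_pt r := exist _ (r x) (ex_intro _ x erefl).

Definition quotient (X : fspace) (r : X -> X -> Prop) : fspace :=
  @FSpace (quotient_pt r)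
    (fun W => zopen (quotient_proj r @^-1` W))
    (fun W f => regular (quotient_proj r @^-1` W) (f \o quotient_proj r)).

(* The ring of varieties, as the commutative ring presented by generators and
   relations: [k0_rel] is the congruence generated by the axioms of
   commutative rings and the relations between classes of varieties. *)
Inductive k0_expr :=
| K0gen of variety
| K0zero
| K0one
| K0add of k0_expr & k0_expr
| K0opp of k0_expr
| K0mul of k0_expr & k0_expr.

Inductive k0_rel : k0_expr -> k0_expr -> Prop :=
| k0_refl a : k0_rel a a
| k0_sym a b : k0_rel a b -> k0_rel b a
| k0_trans a b c : k0_rel a b -> k0_rel b c -> k0_rel a c
| k0_congD a a' b b' : k0_rel a a' -> k0_rel b b' ->
    k0_rel (K0add a b) (K0add a' b')
| k0_congN a a' : k0_rel a a' -> k0_rel (K0opp a) (K0opp a')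
| k0_congM a a' b b' : k0_rel a a' -> k0_rel b b' ->
    k0_rel (K0mul a b) (K0mul a' b')
| k0_addA a b c : k0_rel (K0add a (K0add b c)) (K0add (K0add a b) c)
| k0_addC a b : k0_rel (K0add a b) (K0add b a)
| k0_add0 a : k0_rel (K0add K0zero a) a
| k0_addN a : k0_rel (K0add (K0opp a) a) K0zero
| k0_mulA a b c : k0_rel (K0mul a (K0mul b c)) (K0mul (K0mul a b) c)
| k0_mulC a b : k0_rel (K0mul a b) (K0mul b a)
| k0_mul1 a : k0_rel (K0mul K0one a) a
| k0_mulDl a b c :
    k0_rel (K0mul (K0add a b) c) (K0add (K0mul a c) (K0mul b c))
| k0_iso (X Y : variety) : isomorphic X Y -> k0_rel (K0gen X) (K0gen Y)
| k0_scissor (X Z U : variety) (S : set X) : zopen (~` S) ->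
    isomorphic Z (subfspace S) -> isomorphic U (subfspace (~` S)) ->
    k0_rel (K0gen X) (K0add (K0gen U) (K0gen Z))
| k0_product (X Y P : variety) : isomorphic P (product X Y) ->
    k0_rel (K0gen P) (K0mul (K0gen X) (K0gen Y))
| k0_point (P : variety) : (exists x : P, forall y, y = x) ->
    k0_rel (K0gen P) K0one.

Definition K0 := {A : k0_expr -> Prop | exists a, A = k0_rel a}.

HB.instance Definition _ := gen_eqMixin K0.
HB.instance Definition _ := gen_choiceMixin K0.

Definition k0_class (a : k0_expr) : K0 :=
  exist _ (k0_rel a) (ex_intro _ a erefl).

Definition k0_repr (x : K0) : k0_expr := sval (cid (svalP x)).

Lemma k0_ext (x y : K0) : sval x = sval y -> x = y.
Proof. by apply: eq_sig_hprop => ? ? ?; exact: Prop_irrelevance. Qed.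

Lemma k0_classP a b : k0_class a = k0_class b <-> k0_rel a b.
Proof.
split=> [/(congr1 sval) /= ->|ab]; first exact: k0_refl.
apply: k0_ext; apply/funext => c; apply/propext; split=> h.
  by apply: k0_trans h; exact: k0_sym.
exact: k0_trans h.
Qed.

Lemma k0_reprK x : k0_class (k0_repr x) = x.
Proof. by apply: k0_ext; rewrite /k0_repr; case: cid => /= a <-. Qed.

Lemma k0_classK a : k0_rel (k0_repr (k0_class a)) a.
Proof. by apply/k0_classP; rewrite k0_reprK. Qed.

Definition k0_add (x y : K0) : K0 := k0_class (K0add (k0_repr x) (k0_repr y)).
Definition k0_opp (x : K0) : K0 := k0_class (K0opp (k0_repr x)).
Definition k0_mul (x y : K0) : K0 := k0_class (K0mul (k0_repr x) (k0_repr y)).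

Lemma k0_addE a b : k0_add (k0_class a) (k0_class b) = k0_class (K0add a b).
Proof. by apply/k0_classP; apply: k0_congD; exact: k0_classK. Qed.

Lemma k0_oppE a : k0_opp (k0_class a) = k0_class (K0opp a).
Proof. by apply/k0_classP; apply: k0_congN; exact: k0_classK. Qed.

Lemma k0_mulE a b : k0_mul (k0_class a) (k0_class b) = k0_class (K0mul a b).
Proof. by apply/k0_classP; apply: k0_congM; exact: k0_classK. Qed.

Lemma k0_addrA : associative k0_add.
Proof.
move=> x y z; rewrite -(k0_reprK x) -(k0_reprK y) -(k0_reprK z) !k0_addE.
by apply/k0_classP; exact: k0_addA.
Qed.

Lemma k0_addrC : commutative k0_add.
Proof.
move=> x y; rewrite -(k0_reprK x) -(k0_reprK y) !k0_addE.
by apply/k0_classP; exact: k0_addC.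
Qed.

Lemma k0_add0r : left_id (k0_class K0zero) k0_add.
Proof.
move=> x; rewrite -(k0_reprK x) k0_addE.
by apply/k0_classP; exact: k0_add0.
Qed.

Lemma k0_addNr : left_inverse (k0_class K0zero) k0_opp k0_add.
Proof.
move=> x; rewrite -(k0_reprK x) k0_oppE k0_addE.
by apply/k0_classP; exact: k0_addN.
Qed.

Lemma k0_mulrA : associative k0_mul.
Proof.
move=> x y z; rewrite -(k0_reprK x) -(k0_reprK y) -(k0_reprK z) !k0_mulE.
by apply/k0_classP; exact: k0_mulA.
Qed.

Lemma k0_mulrC : commutative k0_mul.
Proof.
move=> x y; rewrite -(k0_reprK x) -(k0_reprK y) !k0_mulE.
by apply/k0_classP; exact: k0_mulC.
Qed.

Lemma k0_mul1r : left_id (k0_class K0one) k0_mul.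
Proof.
move=> x; rewrite -(k0_reprK x) k0_mulE.
by apply/k0_classP; exact: k0_mul1.
Qed.

Lemma k0_mulrDl : left_distributive k0_mul k0_add.
Proof.
move=> x y z; rewrite -(k0_reprK x) -(k0_reprK y) -(k0_reprK z).
rewrite !(k0_addE, k0_mulE).
by apply/k0_classP; exact: k0_mulDl.
Qed.

HB.instance Definition _ :=
  GRing.isZmodule.Build K0 k0_addrA k0_addrC k0_add0r k0_addNr.
HB.instance Definition _ :=
  GRing.Zmodule_isComPzRing.Build K0 k0_mulrA k0_mulrC k0_mul1r k0_mulrDl.

(* The class of [X] in the ring of varieties when [X] is a variety, and the junk
   value [0] otherwise. *)
Definition motivic_class (X : fspace) : K0 :=
  if pselect (is_variety X) is left h then k0_class (K0gen (Variety h)) else 0.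

End Varieties.

Arguments zopen {f}.
Arguments regular {f}.

Section Space.
Variables (G : graph) (eta : vert G -> Cstar).

Definition Bfactor := {p : CC * CC | 1 + p.1 * p.2 != 0}.

Definition moment (p : Bfactor) : Cstar :=
  exist _ (1 + (val p).1 * (val p).2) (valP p).

(* Families indexed by the edges are encoded along the enumeration of the
   edges. *)
Definition coord (z : fin #|edge G| -> Bfactor) (e : edge G) : Bfactor :=
  z (to_fin (enum_rank e)).

Definition level_set :=
  {z : fin #|edge G| -> Bfactor |
     bd (fun e => moment (coord z e)) =1 eta}.

Definition level_space : fspace :=
  @embedded level_set #|{: edge G * bool}|
    (fun z k => let: (e, b) := enum_val k in
       let p := val (coord (sval z) e) in if b then p.1 else p.2).

(* Two points are in the same orbit: [tau] in the multiplicative group acts on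
   each factor by [(x, y) |-> (tau x, tau^-1 y)]. Constant functions [g] act
   trivially, so these are also the orbits of the quotient by constants. *)
Definition same_orbit (z w : level_set) : Prop :=
  exists g : vert G -> Cstar, forall e,
    val (coord (sval w) e) =
      (val (cobd g e) * (val (coord (sval z) e)).1,
       (val (cobd g e))^-1 * (val (coord (sval z) e)).2).

Definition Bvar : fspace := @quotient level_space same_orbit.

End Space.

Lemma embedded_is_fspace (T : Type) (n : nat) (iota : T -> 'I_n -> CC) :
  is_fspace (embedded iota).
Proof.
split.
- exists setT; rewrite eqEsubset; split=> // x _.
  by exists 1 => //; rewrite meval1 oner_neq0.
- move=> _ _ [S ->] [S' ->]; exists [set p | exists2 q, S q &
    exists2 r, S' r & p = q * r].
  rewrite eqEsubset; split=> x /=.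
    move=> [[p Sp px] [q Sq qx]]; exists (p * q).
      by exists p => //; exists q.
    by rewrite mevalM mulf_neq0.
  move=> [_ [p Sp [q Sq ->]]]; rewrite mevalM mulf_eq0 negb_or.
  by move=> /andP[px qx]; split; [exists p | exists q].
- move=> F Fo; exists [set p | exists2 U, F U &
    [set x | meval (iota x) p != 0] `<=` U].
  rewrite eqEsubset; split=> x /=.
    move=> [U FU Ux]; have [S UE] := Fo _ FU; rewrite UE in Ux.
    have [p Sp px] := Ux; exists p => //; exists U => // y /= py.
    by rewrite UE; exists p.
  by move=> [p [U FU pU] px]; exists U => //; exact: pU.
move=> U f Uo; split=> [Uf x Ux|H x Ux]; first by exists U, f; split.
have [V [g [[S VE] Vx Vg fg]]] := H x Ux.
have [p [q [qx gpq]]] := Vg x Vx.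
move: (Vx); rewrite VE => -[s Ss sx].
exists (p * s), (q * s); rewrite mevalM; split; first exact: mulf_neq0.
move=> y Uy; rewrite !mevalM mulf_eq0 negb_or => /andP[qy sy].
have Vy : V y by rewrite VE; exists s.
by rewrite (fg _ Uy Vy) (gpq _ Vy qy) -mulf_div divff // mulr1.
Qed.

Lemma embedded_morphism (T T' : Type) (n : nat) (iota : T -> 'I_n -> CC)
    (iota' : T' -> 'I_n -> CC) (f : T -> T') :
  (forall x, iota' (f x) = iota x) ->
  @morphism (embedded iota) (embedded iota') f.
Proof.
move=> fE _ [S ->]; split.
  by exists S; rewrite eqEsubset; split=> x /=; rewrite fE.
move=> g Vg x /= Vx; have [p [q [qx gpq]]] := Vg _ Vx.
exists p, q; rewrite -fE; split=> // y Uy; rewrite -fE; exact: gpq.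
Qed.

Lemma isomorphic_setT (X : fspace) :
  is_fspace X -> isomorphic (subfspace [set: X]) X.
Proof.
move=> [XT XI XU Xs].
exists (fun x => sval x), (fun x => exist _ x I); split=> //.
- move=> V Vo; split; first by exists V.
  by move=> g Vg x Vx; exists V, g; split.
- move=> _ [U Uo ->]; split=> // g Wg; apply/(Xs _ _ Uo) => x Ux.
  have [V [h [Vo Vx Vh gh]]] := Wg (exist _ x I) Ux.
  exists V, h; split=> // y Uy Vy; exact: (gh (exist _ y I)).
- by case=> x [].
Qed.

Lemma isomorphic_trans (X Y Z : fspace) :
  isomorphic X Y -> isomorphic Y Z -> isomorphic X Z.
Proof.
move=> [f [f' [mf mf' ff' f'f]]] [g [g' [mg mg' gg' g'g]]].
exists (g \o f), (f' \o g'); split.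
- move=> V Vo; have [Vo' Vr] := mg _ Vo; have [Vo'' Vr'] := mf _ Vo'.
  by split=> // h hr; exact: Vr' (Vr _ hr).
- move=> V Vo; have [Vo' Vr] := mf' _ Vo; have [Vo'' Vr'] := mg' _ Vo'.
  by split=> // h hr; exact: Vr' (Vr _ hr).
- by move=> x; rewrite /= gg' ff'.
- by move=> x; rewrite /= f'f g'g.
Qed.

Lemma affine_line_is_variety : is_variety affine_line.
Proof.
have lineF := embedded_is_fspace (fun (z : CC) (_ : 'I_1) => z).
split=> //.
  exists 1%N, (fun=> setT); split.
  - by move=> _; case: lineF.
  - by move=> x; exists ord0.
  move=> _; exists 1%N, set0.
  apply: isomorphic_trans (isomorphic_setT lineF) _.
  have z0 (z : CC) p : set0 p -> meval ((fun=> z) \o @to_fin 1) p = 0.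
    by [].
  exists (fun z => exist _ (fun=> z) (z0 z)), (fun s => sval s (to_fin ord0)).
  split=> //.
  - by apply: embedded_morphism => x; apply/funext.
  - by apply: embedded_morphism => x; apply/funext => i; rewrite /= (ord1 i).
  - case=> s hs; apply: eq_sig_hprop => [? ? ?|]; first exact: Prop_irrelevance.
    apply/funext => -[i i1] /=; congr (s _).
    apply: val_inj => /=; by case: i i1.
move=> [x y] /= xy; exists setT, setT, (fun p => p.1 - p.2).
have lT : @zopen affine_line setT by case: lineF.
split=> //.
- exists 2%N, (fun k z => if k == ord0 then z else -1),
    (fun k z => if k == ord0 then 1 else z); split.
  + move=> k; case: (k == ord0) => /= z _.
      exists (mpolyX CC (mnm1 ord0)), 1.
      rewrite meval1 oner_neq0; split=> // w _ _.
      by rewrite mevalXU meval1 divr1.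
    exists (-1), 1; rewrite meval1 oner_neq0; split=> // w _ _.
    by rewrite mevalN !meval1 divr1.
  + move=> k; case: (k == ord0) => /= z _.
      exists 1, 1; rewrite meval1 oner_neq0; split=> // w _ _.
      by rewrite meval1 divr1.
    exists (mpolyX CC (mnm1 ord0)), 1.
    rewrite meval1 oner_neq0; split=> // w _ _.
    by rewrite mevalXU meval1 divr1.
  + by move=> p; rewrite big_ord_recl big_ord1 /= mulr1 mulN1r.
- by split=> //; split=> //; rewrite subr_eq0; apply/eqP.
- by move=> q _ _ /=; rewrite subr_eq0 => /eqP.
Qed.

Definition LL : K0 := motivic_class affine_line.

Definition Bloop : fspace := @Bvar loop_graph (fun=> 0).

(* The analytic topology: the coarsest one for which the Zariski open sets are
   open and the regular functions on them are continuous. *)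
Section Analytic.
Variable X : fspace.

Definition analytic : Type := X.

HB.instance Definition _ := gen_eqMixin analytic.
HB.instance Definition _ := gen_choiceMixin analytic.
HB.instance Definition _ := isSubBaseTopological.Build analytic
  [set W : set analytic | exists (U : set X) (f : X -> CC) (O : set CC),
     [/\ zopen U, regular U f, open (O : set CC^o)
       & W = [set x | U x /\ O (f x)]]] id.

End Analytic.

Definition simplex (n : nat) : set 'rV[RR]_n.+1 :=
  [set x | (forall i, 0 <= x 0 i) /\ \sum_i x 0 i = 1].
Arguments simplex n : clear implicits.

Definition face_fun (n : nat) (i : 'I_n.+2) (x : 'rV[RR]_n.+1) :
    'rV[RR]_n.+2 :=
  \row_j (if unlift i j is Some k then x 0 k else 0).

Lemma face_subproof (n : nat) (i : 'I_n.+2) (x : 'rV[RR]_n.+1) :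
  simplex n x -> simplex n.+1 (face_fun i x).
Proof.
move=> [x0 x1]; split=> [j|].
  by rewrite mxE; case: unlift => [k|//]; exact: x0.
rewrite (bigD1_ord i) //= mxE unlift_none add0r -[RHS]x1.
by apply: eq_bigr => k _; rewrite mxE liftK.
Qed.

Definition face (n : nat) (i : 'I_n.+2) (x : simplex n) : simplex n.+1 :=
  exist _ (face_fun i (val x)) (mem_set (face_subproof i (set_valP x))).

Lemma face_continuous (n : nat) (i : 'I_n.+2) : continuous (@face n i).
Proof.
apply: (@continuous_comp_initial (simplex n.+1) _ _ set_val) => x.
move=> U [P /= Pnbhs PU].
have Q k : nbhs x [set y : simplex n | P 0 k (face_fun i (val y) 0 k)].
  have := Pnbhs 0 k; rewrite /= mxE.
  under [X in _ -> nbhs _ X]eq_set do rewrite mxE.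
  case: unlift => [l|] Pl; last first.
    by apply: (@filterE _ (nbhs x)) => y; exact: nbhs_singleton Pl.
  have /(_ x) c : continuous (set_val : simplex n -> _) :=
    @initial_continuous _ _ _.
  exact: c (@coord_continuous RR 1 n.+1 0 l (val x) _ Pl).
suff: nbhs x [set y : simplex n | U (face_fun i (val y))] by [].
apply: (@filterS _ (nbhs x) _ _ _ _ (@filter_forall _ _ _ (nbhs x) _ Q)).
move=> y Qy; apply: PU => j k.
by rewrite ord1; exact: Qy.
Qed.

Section Singular.
Variable T : topologicalType.

Record singular (n : nat) := Singular {
  sing_fun :> simplex n -> T;
  sing_continuous : continuous sing_fun }.

HB.instance Definition _ n := gen_eqMixin (singular n).
HB.instance Definition _ n := gen_choiceMixin (singular n).

Definition sing_face (n : nat) (i : 'I_n.+2) (s : singular n.+1) :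
    singular n :=
  @Singular n (s \o face i)
    (fun x => continuous_comp (@face_continuous n i x)
                              (@sing_continuous _ s (face i x))).

Definition chain (n : nat) := {freeg (singular n) / rat}.

Definition sing_bd (n : nat) : chain n.+1 -> chain n :=
  fglift (fun s : singular n.+1 =>
    \sum_(i < n.+2) (-1) ^+ i *: (<< sing_face i s >> : chain n)).

Definition sing_cycle (n : nat) : chain n -> Prop :=
  if n is m.+1 then fun c : chain m.+1 => sing_bd c = 0 else fun=> True.

Definition sing_boundary (n : nat) (c : chain n) : Prop :=
  exists b : chain n.+1, sing_bd b = c.

(* [d] cycles whose classes form a basis of the homology in degree [n]. *)
Definition homology_dim (n d : nat) : Prop :=
  exists e : 'I_d -> chain n,
    [/\ forall k, sing_cycle (e k),
        forall c, sing_cycle c -> exists a : 'I_d -> rat,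
          sing_boundary (c - \sum_k a k *: e k)
      & forall a : 'I_d -> rat,
          sing_boundary (\sum_k a k *: e k) -> forall k, a k = 0].

Definition euler_characteristic (chi : int) : Prop :=
  exists (N : nat) (b : nat -> nat),
    [/\ forall n, homology_dim n (b n), forall n, (N <= n)%N -> b n = 0%N
      & chi = \sum_(n < N) (-1) ^+ n * (b n)%:Z].

End Singular.

(* Main.v *)
Require Import Defs.
From HB Require Import structures.
From mathcomp Require Import all_boot all_order all_algebra.
From mathcomp Require Import all_classical all_reals topology normedtype.
From mathcomp Require Import sequences.
From mathcomp Require Import Rstruct Rstruct_topology.
From mathcomp Require Import complex freeg.
From mathcomp Require Import -(notations) mpoly.
From mathcomp Require Import ring lra zify.

Set Implicit Arguments.
Unset Strict Implicit.
Unset Printing Implicit Defensive.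

Import Order.TTheory GRing.Theory Num.Theory numFieldNormedType.Exports.

Local Open Scope classical_set_scope.
Local Open Scope ring_scope.

(** Everything rests on charts indexed by spanning trees.  Let [X] be the variety
    of the graph and let [(x_e, y_e)] be a point of it.  The values [1 + x_e y_e]
    solve [bd a = eta], so by genericity the edges where they differ from [1]
    connect the graph ([mom_connected]); on those edges [y_e <> 0].  Hence every
    point lies in the open set [y <> 0 on T] of some spanning tree [T].  On this set
    the gauge group, of invertible functions on the vertices modulo constants, can be
    used up to make [y = 1] on [T], and the moment equations then determine [x] on [T], because a flow on a tree is determined by
    its divergence.  What is left is one free factor [{1 + x y <> 0}] for each edge
    outside [T] ([chart]).  The same description holds for the locally closed
    [piece C D], where [y <> 0] on [C] and [y = 0] on [D], as soon as [C] contains a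
    spanning tree disjoint from [D].

    The charts are affine, and the functions [x_e y_e] together with the
    coordinates of the charts separate points, so [X] and its pieces are varieties
    ([Bvar_variety], [piece_variety]).

    Cutting [X] along the vanishing of the [y_e], one edge at a time, decomposes
    its class over the sets [S] of edges where [y <> 0].  The stratum of [S] is
    empty if [S] is disconnected.  Otherwise it is a product of one factor
    [{y <> 0, 1 + x y <> 0}] of class [(LL - 1)^2] for each edge of [S] outside a
    spanning tree and of one line for each edge outside [S].  This is the sum over
    connected spanning subgraphs ([mc_Bvar_sum]), since the first Betti number of a
    connected graph is [#|E| + 1 - #|V|].  The behaviour under deletion and
    contraction of an edge [e] holds for the terms of that sum: sets of edges
    avoiding [e] are those of the deletion, sets containing [e] are, if [e] is
    not a loop, those of the contraction ([state_sum_delete], [state_sum_contract]).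

    For the Euler characteristic, [X] with its analytic topology is the union of
    the open charts [U_T], [T] a spanning tree, with [U_S] meeting [U_S'] in the
    chart of [S :|: S'].  A chart [U_S] is homeomorphic to a product of a point for
    each edge of [T], of the Euler characteristic zero set
    [{y <> 0, 1 + x y <> 0}] for each other edge of [S], and of
    [{1 + x y <> 0}], of Euler characteristic one, elsewhere.  So it counts [1] if
    [S] is a tree and [0] otherwise, and Mayer-Vietoris counts the spanning trees
    ([Bvar_euler]).  Singular homology is developed for this purpose as far as
    homotopy invariance and the Mayer-Vietoris sequence, for subsets of a space:
    chains are taken with support in the subset, which avoids subspace
    topologies. *)

(** * Dimensions of subquotients of rational vector spaces *)

Section Subquotients.

Definition join_fam (T : Type) p q (e : 'I_p -> T) (f : 'I_q -> T)
    (k : 'I_(p + q)) : T :=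
  match fintype.split k with inl i => e i | inr j => f j end.

Lemma join_faml (T : Type) p q (e : 'I_p -> T) (f : 'I_q -> T) i :
  join_fam e f (lshift q i) = e i.
Proof. by rewrite /join_fam (unsplitK (inl i)). Qed.

Lemma join_famr (T : Type) p q (e : 'I_p -> T) (f : 'I_q -> T) j :
  join_fam e f (rshift p j) = f j.
Proof. by rewrite /join_fam (unsplitK (inr j)). Qed.

Lemma join_famP (T : Type) p q (e : 'I_p -> T) (f : 'I_q -> T) (P : T -> Prop) :
  (forall i, P (e i)) -> (forall j, P (f j)) -> forall k, P (join_fam e f k).
Proof. by move=> Pe Pf k; rewrite /join_fam; case: (fintype.split k). Qed.

Lemma ord_addP p q (P : 'I_(p + q) -> Prop) :
  (forall i, P (lshift q i)) -> (forall j, P (rshift p j)) -> forall k, P k.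
Proof. by move=> Pl Pr k; rewrite -(splitK k); case: (fintype.split k). Qed.

Definition subspace_pred (V : lmodType rat) (Z : V -> Prop) : Prop :=
  Z 0 /\ forall (a : rat) x y, Z x -> Z y -> Z (a *: x + y).

(** Homology of a chain complex is [Z / B], with [Z] the cycles and [B] the
    boundaries. Counting its dimension by a basis of representatives, without
    forming the quotient, is the form in which the Euler characteristic is
    stated. *)
Definition qdim (V : lmodType rat) (Z B : V -> Prop) (d : nat) : Prop :=
  exists e : 'I_d -> V,
    [/\ forall k, Z (e k),
        forall c, Z c -> exists a : 'I_d -> rat, B (c - \sum_k a k *: e k)
      & forall a : 'I_d -> rat, B (\sum_k a k *: e k) -> forall k, a k = 0].

Lemma subspace_predN (V : lmodType rat) (Z : V -> Prop) x :
  subspace_pred Z -> Z x -> Z (- x).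
Proof. by move=> [Z0 ZD] Zx; rewrite -scaleN1r -[X in Z X]addr0; exact: ZD. Qed.

Lemma subspace_predZ (V : lmodType rat) (Z : V -> Prop) a x :
  subspace_pred Z -> Z x -> Z (a *: x).
Proof. by move=> [Z0 ZD] Zx; rewrite -[X in Z X]addr0; exact: ZD. Qed.

Lemma subspace_predD (V : lmodType rat) (Z : V -> Prop) x y :
  subspace_pred Z -> Z x -> Z y -> Z (x + y).
Proof. by move=> [Z0 ZD] Zx Zy; rewrite -[x]scale1r; exact: ZD. Qed.

Lemma subspace_predB (V : lmodType rat) (Z : V -> Prop) x y :
  subspace_pred Z -> Z x -> Z y -> Z (x - y).
Proof.
by move=> sZ Zx Zy; apply: subspace_predD => //; exact: subspace_predN.
Qed.

Lemma subspace_pred_sum (V : lmodType rat) (Z : V -> Prop) (I : Type)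
    (r : seq I) (P : pred I) (F : I -> V) :
  subspace_pred Z -> (forall i, P i -> Z (F i)) -> Z (\sum_(i <- r | P i) F i).
Proof.
move=> sZ ZF; elim/big_ind: _ => //; first by case: sZ.
by move=> x y Zx Zy; exact: subspace_predD.
Qed.

Lemma subspace_pred_comb (V : lmodType rat) (Z : V -> Prop) d
    (a : 'I_d -> rat) (e : 'I_d -> V) :
  subspace_pred Z -> (forall i, Z (e i)) -> Z (\sum_k a k *: e k).
Proof.
by move=> sZ Ze; apply: subspace_pred_sum => // i _; exact: subspace_predZ.
Qed.

Lemma qdim_eq0 (V : lmodType rat) (Z B : V -> Prop) :
  (forall x, Z x -> B x) -> qdim Z B 0.
Proof.
move=> ZB; exists (fun _ => 0); split; first by case.
  by move=> c Zc; exists (fun _ => 0); rewrite big_ord0 subr0; exact: ZB.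
by move=> a _ [].
Qed.

(** A basis of [W / Z] and a basis of [Z / B], put side by side, give a basis of
    [W / B]. *)
Lemma qdim_add (V : lmodType rat) (W Z B : V -> Prop) p q :
  subspace_pred W -> subspace_pred Z -> subspace_pred B ->
  (forall x, Z x -> W x) -> (forall x, B x -> Z x) ->
  qdim W Z p -> qdim Z B q -> qdim W B (p + q).
Proof.
move=> sW sZ sB ZW BZ [e [eW eg ef]] [f [fZ fg ff]].
exists (join_fam e f); split.
- by apply: join_famP => i; [exact: eW | exact/ZW/fZ].
- move=> c /eg[a /fg[b Bab]]; exists (join_fam a b).
  rewrite big_split_ord /= opprD addrA; congr (B (_ - _ - _)): Bab.
    by apply: eq_bigr => i _; rewrite !join_faml.
  by apply: eq_bigr => i _; rewrite !join_famr.
- move=> a; rewrite big_split_ord /=.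
  under eq_bigr do rewrite join_faml.
  under [X in _ + X]eq_bigr do rewrite join_famr.
  move=> Ba.
  have a0 i : a (lshift q i) = 0.
    apply: (ef (fun i => a (lshift q i))).
    rewrite -[X in Z X](addrK (\sum_i a (rshift p i) *: f i)).
    by apply: subspace_predB => //; [exact: BZ | exact: subspace_pred_comb].
  apply: ord_addP => // j; apply: (ff (fun i => a (rshift p i))).
  move: Ba; rewrite big1 ?add0r // => i _; by rewrite a0 scale0r.
Qed.

(** The hypotheses say that [f] induces an isomorphism [Z / B -> Z' / B'], so it
    carries a basis to a basis. *)
Lemma qdim_map (V V' : lmodType rat) (Z B : V -> Prop) (Z' B' : V' -> Prop)
    (f : {linear V -> V'}) d :
  subspace_pred Z -> subspace_pred B -> subspace_pred B' ->
  (forall x, Z x -> Z' (f x)) ->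
  (forall x, Z x -> B x -> B' (f x)) ->
  (forall x, Z x -> B' (f x) -> B x) ->
  (forall y, Z' y -> exists2 x, Z x & B' (y - f x)) ->
  qdim Z B d -> qdim Z' B' d.
Proof.
move=> sZ sB sB' fZ fB finj fsur [e [eZ eg ef]].
exists (fun k => f (e k)); split.
- by move=> k; exact/fZ/eZ.
- move=> y /fsur[x Zx Byx]; have [a Ba] := eg _ Zx; exists a.
  have -> : y - \sum_k a k *: f (e k) =
    (y - f x) + f (x - \sum_k a k *: e k).
    rewrite [f (_ - _)]linearB addrA subrK [f (\sum_k _)]linear_sum; congr (_ - _).
    by apply: eq_bigr => k _; rewrite linearZ.
  apply: subspace_predD => //; apply: fB => //.
  by apply: subspace_predB => //; exact: subspace_pred_comb.
- move=> a Ba; apply: ef; apply: finj; first exact: subspace_pred_comb.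
  rewrite linear_sum /=; congr B': Ba; apply: eq_bigr => k _.
  by rewrite linearZ.
Qed.

(** Conversely, preimages modulo [B'] of a basis of [Z' / B'] form a basis of [Z
    / B]. *)
Lemma qdim_comap (V V' : lmodType rat) (Z B : V -> Prop) (Z' B' : V' -> Prop)
    (f : {linear V -> V'}) d :
  subspace_pred Z -> subspace_pred B -> subspace_pred B' ->
  (forall x, Z x -> Z' (f x)) ->
  (forall x, Z x -> B x -> B' (f x)) ->
  (forall x, Z x -> B' (f x) -> B x) ->
  (forall y, Z' y -> exists2 x, Z x & B' (y - f x)) ->
  qdim Z' B' d -> qdim Z B d.
Proof.
move=> sZ sB sB' fZ fB finj fsur [e [eZ eg ef]].
have /choice[g gP] : forall k, exists x, Z x /\ B' (e k - f x).
  by move=> k; have [x Zx Bx] := fsur _ (eZ k); exists x.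
have gZ k : Z (g k) by case: (gP k).
have gB k : B' (e k - f (g k)) by case: (gP k).
have gc (a : 'I_d -> rat) : B' (\sum_k a k *: e k - f (\sum_k a k *: g k)).
  rewrite linear_sum -sumrB; apply: subspace_pred_sum => // i _.
  by rewrite linearZ /= -scalerBr; exact: subspace_predZ.
exists g; split=> //.
- move=> c Zc; have [a Ba] := eg _ (fZ _ Zc); exists a; apply: finj.
    by apply: subspace_predB => //; exact: subspace_pred_comb.
  rewrite linearB /= -[X in X - _](subrK (\sum_k a k *: e k)) -addrA.
  exact: subspace_predD.
- move=> a Ba; apply: ef.
  rewrite -[X in B' X](subrK (f (\sum_k a k *: g k))).
  apply: subspace_predD => //; apply: fB => //; exact: subspace_pred_comb.
Qed.

Lemma qdim_prod (V V' : lmodType rat) (Z B : V -> Prop) (Z' B' : V' -> Prop)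
    p q :
  subspace_pred B -> subspace_pred B' -> subspace_pred Z -> subspace_pred Z' ->
  qdim Z B p -> qdim Z' B' q ->
  @qdim (V * V')%type (fun x => Z x.1 /\ Z' x.2) (fun x => B x.1 /\ B' x.2)
    (p + q).
Proof.
move=> [B0 BD] [B'0 B'D] [Z0 ZD] [Z'0 Z'D] [e [eZ eg ef]] [f [fZ fg ff]].
have fstE n (F : 'I_n -> V * V') : (\sum_i F i).1 = \sum_i (F i).1.
  by elim/big_ind2: _ => // x1 x2 y1 y2 <- <-.
have sndE n (F : 'I_n -> V * V') : (\sum_i F i).2 = \sum_i (F i).2.
  by elim/big_ind2: _ => // x1 x2 y1 y2 <- <-.
pose ef' := join_fam (fun i => (e i, 0 : V')) (fun j => (0 : V, f j)).
have sumE (a : 'I_(p + q) -> rat) : \sum_k a k *: ef' k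
    = (\sum_i a (lshift q i) *: e i, \sum_i a (rshift p i) *: f i).
  rewrite big_split_ord /ef' /=.
  under eq_bigr do rewrite join_faml.
  under [X in _ + X]eq_bigr do rewrite join_famr.
  apply/eqP; rewrite xpair_eqE; apply/andP; split; apply/eqP.
    rewrite /= !fstE /= [X in _ + X]big1 ?addr0 // => i _.
    by rewrite /= scaler0.
  rewrite /= !sndE /= [X in X + _]big1 ?add0r // => i _.
  by rewrite /= scaler0.
exists ef'; split.
- by apply: (@join_famP _ _ _ _ _ (fun x => Z x.1 /\ Z' x.2)) => i /=; split.
- move=> [c c'] /= [/eg[a Ba] /fg[b Bb]]; exists (join_fam a b).
  rewrite sumE /=; split.
    by congr (B (_ - _)): Ba; apply: eq_bigr => i _; rewrite join_faml.
  by congr (B' (_ - _)): Bb; apply: eq_bigr => i _; rewrite join_famr.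
- move=> a; rewrite sumE /= => -[Ba Bb]; apply: ord_addP => i.
    exact: (ef _ Ba).
  exact: (ff _ Bb).
Qed.

(** Intermediate spaces of a finite-dimensional [W / B] are finite-dimensional:
    in coordinates, [Z / B] is the row space of a matrix of maximal rank among
    those whose rows lie in [Z]. *)
Lemma qdim_split (V : lmodType rat) (W Z B : V -> Prop) d :
  subspace_pred W -> subspace_pred Z -> subspace_pred B ->
  (forall x, Z x -> W x) -> (forall x, B x -> Z x) ->
  qdim W B d -> exists p q, [/\ qdim W Z p, qdim Z B q & (p + q = d)%N].
Proof.
move=> sW sZ sB ZW BZ [e [eW eg ef]].
pose K (u : 'rV[rat]_d) := Z (\sum_k u 0 k *: e k).
have sK : subspace_pred K.
  split=> [|a u v Ku Kv].
    by rewrite /K big1 => [|k _]; [case: sZ | rewrite mxE scale0r].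
  rewrite /K; have -> : \sum_k (a *: u + v) 0 k *: e k =
      a *: (\sum_k u 0 k *: e k) + \sum_k v 0 k *: e k.
    rewrite scaler_sumr -big_split; apply: eq_bigr => k _ /=.
    by rewrite !mxE scalerDl scalerA.
  by case: sZ => _; apply.
pose P r := `[< exists A : 'M[rat]_d, (forall i, K (row i A)) /\ \rank A = r >].
have P0 : exists r, P r.
  exists 0%N; apply/asboolP; exists 0; split; last by rewrite mxrank0.
  by move=> i; rewrite row0; case: sK.
have Pd r : P r -> (r <= d)%N.
  by move=> /asboolP[A [_ <-]]; exact: rank_leq_row.
have [r /asboolP[A [AK Ar]] rmax] := ex_maxnP P0 Pd.
have subK m (C : 'M_(m, d)) u : (forall i, K (row i C)) -> (u <= C)%MS -> K u.
  move=> CK /submxP[D ->]; rewrite mulmx_sum_row.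
  by apply: subspace_pred_sum => // i _; exact: subspace_predZ.
have KA u : K u -> (u <= A)%MS.
  move=> Ku; apply: contraT => uA.
  have : (\rank (A + u)%MS <= r)%N.
    apply: rmax; apply/asboolP; exists (A + u)%MS; split=> // i.
    apply: (@subK _ (col_mx A u)) => [j|].
      move: j; apply: ord_addP => j; first by rewrite rowKu.
      by rewrite rowKd ord1 row_id.
    by rewrite -addsmxE row_sub.
  rewrite -Ar => rAu; move: uA; apply: contraNT => _.
  have /= := (mxrank_leqif_sup (addsmxSl A u)).2.
  by rewrite eqn_leq rAu mxrankS ?addsmxSl // addsmx_sub => /esym/andP[].
pose q := \rank A; pose p := \rank (A^C)%MS.
pose F m (C : 'M[rat]_(m, d)) (i : 'I_m) := \sum_k C i k *: e k.
have Fsum m (C : 'M[rat]_(m, d)) (a : 'I_m -> rat) :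
    \sum_i a i *: F m C i = \sum_k ((\row_i a i) *m C) 0 k *: e k.
  under eq_bigr do rewrite /F scaler_sumr.
  rewrite exchange_big /=; apply: eq_bigr => k _.
  rewrite mxE scaler_suml; apply: eq_bigr => i _.
  by rewrite mxE scalerA.
have row0P m (a : 'I_m -> rat) : \row_i a i = 0 -> forall i, a i = 0.
  by move=> /rowP H i; have := H i; rewrite !mxE.
exists p, q; split; last by rewrite addnC /p /q mxrank_compl subnKC // rank_leq_row.
- exists (F _ (row_base (A^C)%MS)); split.
  + by move=> i; apply: subspace_pred_comb.
  + move=> c /eg[a Ba].
    have : (\row_i a i <= A + A^C)%MS by rewrite submx_full // addsmx_compl_full.
    move=> /sub_addsmxP[[u v] /= uv].
    have /submxP[w wE] : (v *m A^C <= row_base (A^C)%MS)%MS.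
      by rewrite eq_row_base submxMl.
    exists (fun i => w 0 i); rewrite Fsum.
    have -> : \row_i w 0 i = w by apply/rowP => i; rewrite mxE.
    rewrite -wE.
    have -> : v *m (A^C)%MS = \row_i a i - u *m A by rewrite uv addrAC subrr add0r.
    have -> : \sum_k (\row_i a i - u *m A) 0 k *: e k =
        \sum_k a k *: e k - \sum_k (u *m A) 0 k *: e k.
      by rewrite -sumrB; apply: eq_bigr => k _; rewrite !mxE scalerBl.
    rewrite opprB addrCA addrC; apply: subspace_predD => //; first exact: BZ.
    by apply: (subK _ A) => //; exact: submxMl.
  + move=> a; rewrite Fsum => /KA sA; apply: row0P.
    have sAC : (\row_i a i *m row_base (A^C)%MS <= A^C)%MS.
      by rewrite (submx_trans (submxMl _ _)) // eq_row_base.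
    have : (\row_i a i *m row_base (A^C)%MS <= A :&: A^C)%MS.
      by rewrite sub_capmx sA.
    rewrite capmx_compl submx0 => /eqP H.
    apply: (row_free_inj (row_base_free (A^C)%MS)).
    by rewrite H mul0mx.
- exists (F _ (row_base A)); split.
  + move=> i; have : K (row i (row_base A)).
      by apply: (subK _ A) => //; rewrite (submx_trans (row_sub _ _)) // eq_row_base.
    by rewrite /K; congr Z; apply: eq_bigr => k _; rewrite mxE.
  + move=> c Zc; have [a Ba] := eg _ (ZW _ Zc).
    have /KA : K (\row_i a i).
      rewrite /K; under eq_bigr do rewrite mxE.
      rewrite -[X in Z X](subrK c) -[X in Z (X + _)]opprB.
      by apply: subspace_predD => //; apply: subspace_predN => //; exact: BZ.
    rewrite -(eq_row_base A) => /submxP[w wE].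
    exists (fun i => w 0 i); rewrite Fsum.
    have -> : \row_i w 0 i = w by apply/rowP => i; rewrite mxE.
    by rewrite -wE; under eq_bigr do rewrite mxE.
  + move=> a; rewrite Fsum => /ef H; apply: row0P.
    apply: (row_free_inj (row_base_free A)); rewrite mul0mx.
    by apply/rowP => k; rewrite H mxE.
Qed.

End Subquotients.

(** * Formal simplicial chains *)

Section FreeLinear.
Variables (K : choiceType) (M : lmodType rat).

Lemma fglift0 (f : K -> M) : fglift f 0 = 0.
Proof. by rewrite -[0](subrr 0) lift_is_additive subrr. Qed.

Lemma fgliftD (f : K -> M) : {morph fglift f : x y / x + y}.
Proof.
have aN y : fglift f (- y) = - fglift f y.
  by rewrite -sub0r lift_is_additive fglift0 sub0r.
by move=> x y; rewrite -{1}[y]opprK lift_is_additive aN opprK.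
Qed.

Lemma fglift_sum (f : K -> M) (D : {freeg K / rat}) :
  fglift f D = \sum_(x <- dom D) coeff x D *: f x.
Proof.
rewrite -{1}(freeg_sumE D) (big_morph _ (fgliftD f) (fglift0 f)).
by apply: eq_bigr => x _; rewrite liftU.
Qed.

Lemma fglift_linear (f : K -> M) : linear (fglift f).
Proof.
move=> a x y; rewrite fgliftD; congr (_ + _).
have [->|a0'] := eqVneq a 0; first by rewrite !scale0r fglift0.
rewrite !fglift_sum scaler_sumr.
have dE : perm_eq (dom (a *: x)) (dom x).
  by apply: uniq_perm; rewrite ?uniq_dom //; exact: domZ.
rewrite (perm_big _ dE) /=; apply: eq_bigr => z _.
by rewrite coeffZ scalerA.
Qed.

HB.instance Definition _ (f : K -> M) :=
  GRing.isLinear.Build rat {freeg K / rat} M *:%R (@fglift rat M K f)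
    (fglift_linear f).

Lemma fgliftU (f : K -> M) x : fglift f << x >> = f x.
Proof. by rewrite liftU scale1r. Qed.

Lemma freeg_lin_ext (F G : {linear {freeg K / rat} -> M}) c :
  (forall x, x \in dom c -> F << x >> = G << x >>) -> F c = G c.
Proof.
move=> FG; rewrite -(freeg_sumE c) !linear_sum.
apply: eq_big_seq => x xc.
have -> : << coeff x c *g x >> = coeff x c *: << x >> :> {freeg K / rat}.
  apply/eqP/freeg_eqP => y.
  by rewrite coeffZ !coeffU mul1r.
by rewrite !linearZ FG.
Qed.

Lemma eq_fglift_dom (f g : K -> M) c :
  (forall x, x \in dom c -> f x = g x) -> fglift f c = fglift g c.
Proof. by move=> fg; apply: freeg_lin_ext => x /fg; rewrite /= !fgliftU. Qed.

End FreeLinear.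

Definition supp (K : choiceType) (P : K -> Prop) (c : {freeg K / rat}) :=
  forall x, x \in dom c -> P x.

Lemma supp_subspace (K : choiceType) (P : K -> Prop) : subspace_pred (supp P).
Proof.
split=> [x|a c d cP dP x]; first by rewrite dom0.
by move=> /domD_subset; rewrite mem_cat => /orP[/domZ_subset/cP|/dP].
Qed.

Section SuppLinear.
Variables (K : choiceType) (P : K -> Prop).
Implicit Types c d : {freeg K / rat}.

Lemma supp0 : supp P (0 : {freeg K / rat}).
Proof. by case: (supp_subspace P). Qed.

Lemma suppZ a c : supp P c -> supp P (a *: c).
Proof. exact: (subspace_predZ _ (supp_subspace P)). Qed.

Lemma suppD c d : supp P c -> supp P d -> supp P (c + d).
Proof. exact: (subspace_predD (supp_subspace P)). Qed.

Lemma suppN c : supp P c -> supp P (- c).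
Proof. exact: (subspace_predN (supp_subspace P)). Qed.

Lemma suppB c d : supp P c -> supp P d -> supp P (c - d).
Proof. exact: (subspace_predB (supp_subspace P)). Qed.

Lemma supp_sum (I : Type) (r : seq I) (Q : pred I) (F : I -> {freeg K / rat}) :
  (forall i, Q i -> supp P (F i)) -> supp P (\sum_(i <- r | Q i) F i).
Proof.
move=> QF; exact (@subspace_pred_sum _ (supp P) _ _ _ _ (supp_subspace P) QF).
Qed.

End SuppLinear.

Lemma suppU (K : choiceType) (P : K -> Prop) x : P x -> supp P << x >>.
Proof. by move=> Px y; rewrite domU1 inE => /eqP->. Qed.

Lemma supp_impl (K : choiceType) (P Q : K -> Prop) c :
  (forall x, P x -> Q x) -> supp P c -> supp Q c.
Proof. by move=> PQ cP x /cP/PQ. Qed.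

Lemma supp_fglift (K K' : choiceType) (P : K -> Prop)
    (Q : {freeg K' / rat} -> Prop) (f : K -> {freeg K' / rat}) c :
  subspace_pred Q -> (forall x, P x -> Q (f x)) -> supp P c -> Q (fglift f c).
Proof.
move=> sQ fQ cP; rewrite fglift_sum big_seq.
by apply: subspace_pred_sum => // x /cP/fQ; exact: subspace_predZ.
Qed.

(** A linear combination of sequences of points stands for a linear
    combination of simplices given by their vertices.  Keeping all lengths in
    one space makes the boundary a structural recursion, and makes coning off
    the inverse of the boundary up to homotopy in every length. *)
Notation fchain P := {freeg (seq P) / rat}.

Section FormalChains.
Variable P : choiceType.
Implicit Types (s t : seq P) (b : P).

Definition fcons b : fchain P -> fchain P :=
  fglift (fun s => << b :: s >>).

HB.instance Definition _ b := GRing.Linear.on (fcons b).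

Fixpoint fbd1 s : fchain P :=
  if s is x :: s' then << s' >> - fcons x (fbd1 s') else 0.

Definition fbd : fchain P -> fchain P := fglift fbd1.

HB.instance Definition _ := GRing.Linear.on fbd.

Lemma fbdB : {morph fbd : x y / x - y}. Proof. exact: linearB. Qed.

Lemma fbdU s : fbd << s >> = fbd1 s. Proof. exact: fgliftU. Qed.

Lemma fconsU b s : fcons b << s >> = << b :: s >>. Proof. exact: fgliftU. Qed.

(** Coning with apex [b] is a contraction of the formal complex; all the
    identities below come from this one. *)
Lemma fbd_cons b c : fbd (fcons b c) = c - fcons b (fbd c).
Proof.
apply: (@freeg_lin_ext _ _ (fbd \o fcons b) (idfun \- (fcons b \o fbd))).
by move=> s _ /=; rewrite fconsU !fbdU.
Qed.

Lemma fbd_fbd c : fbd (fbd c) = 0.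
Proof.
apply: (@freeg_lin_ext _ _ (fbd \o fbd) \0) => s _ /=; rewrite fbdU.
elim: s => [|x s IH] /=; first by rewrite linear0.
by rewrite linearB /= fbdU fbd_cons IH linear0 subr0 subrr.
Qed.

Definition fsize n := supp (fun s => size s = n).

Lemma fsize_cons n b c : fsize n c -> fsize n.+1 (fcons b c).
Proof.
apply: supp_fglift; first exact: supp_subspace.
by move=> s sn; apply: suppU; rewrite /= sn.
Qed.

Lemma fsize_fbd1 n s : size s = n.+1 -> fsize n (fbd1 s).
Proof.
elim: s n => [//|x s IH] n /= [sn].
apply: (subspace_predB (supp_subspace _)).
  by apply: suppU.
case: n sn => [/size0nil->|n sn] /=; last exact/fsize_cons/IH.
by rewrite linear0; case: (supp_subspace (fun s : seq P => size s = 0%N)).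
Qed.

Lemma fbd1_sub s : supp (fun t => {subset t <= s}) (fbd1 s).
Proof.
elim: s => [|x s IH] /=; first by case: (supp_subspace (fun t => {subset t <= [::]})).
apply: (subspace_predB (supp_subspace _)).
  by apply: suppU => y ys; rewrite inE ys orbT.
apply: supp_fglift IH; first exact: supp_subspace.
move=> t ts; apply: suppU => y; rewrite !inE => /orP[->//|/ts->].
by rewrite orbT.
Qed.

Definition omit i s := take i s ++ drop i.+1 s.

Lemma fbd1_omit s :
  fbd1 s = \sum_(i < size s) (-1) ^+ i *: << omit i s >>.
Proof.
elim: s => [|x s IH] /=; first by rewrite big_ord0.
rewrite big_ord_recl /= expr0 scale1r /omit /= drop0; congr (_ + _).
rewrite IH linear_sum -sumrN; apply: eq_bigr => i _ /=.
by rewrite linearZ /= fconsU exprS -scalerA scaleN1r.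
Qed.

(** Iterated barycentric-type subdivision: each simplex becomes the cone, from
    the chosen interior point [b s], over its subdivided boundary. *)
Variable b : seq P -> P.

Fixpoint fsd n s : fchain P :=
  if n is m.+1 then fcons (b s) (fglift (fsd m) (fbd1 s)) else << s >>.

Lemma fsize_fsd n s : size s = n -> fsize n (fsd n s).
Proof.
elim: n s => [|n IH] s sn /=; first by apply: suppU.
apply/fsize_cons/(supp_fglift _ IH); first exact: supp_subspace.
exact: fsize_fbd1.
Qed.

Lemma fsd_chain n s :
  size s = n.+1 -> fbd (fsd n.+1 s) = fglift (fsd n) (fbd1 s).
Proof.
elim: n s => [|n IH] s sn.
  case: s sn => [//|x [|//] _] /=.
  by rewrite linear0 subr0 !fgliftU fconsU fbdU /= linear0 subr0.
change (fsd n.+2 s) with (fcons (b s) (fglift (fsd n.+1) (fbd1 s))).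
rewrite fbd_cons.
suff -> : fbd (fglift (fsd n.+1) (fbd1 s)) = 0 by rewrite linear0 subr0.
have -> : 0 = fglift (fsd n) (fbd (fbd1 s)).
  by rewrite -fbdU fbd_fbd linear0.
apply: (@freeg_lin_ext _ _ (fbd \o fglift (fsd n.+1)) (fglift (fsd n) \o fbd)).
move=> t ts; rewrite [LHS]/= [RHS]/= fgliftU fbdU.
exact: IH (fsize_fbd1 sn ts).
Qed.

End FormalChains.

(** The chain homotopy between two augmented chain maps into a cone. *)
Section FormalHomotopy.
Variables (P Q : choiceType) (phi psi : seq P -> fchain Q) (b : seq P -> Q).

Fixpoint fht n s : fchain Q :=
  if n is m.+1 then fcons (b s) (phi s - psi s - fglift (fht m) (fbd1 s))
  else 0.

Hypothesis phi_size : forall n s, size s = n -> fsize n (phi s).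
Hypothesis psi_size : forall n s, size s = n -> fsize n (psi s).
Hypothesis phi_chain : forall s, fbd (phi s) = fglift phi (fbd1 s).
Hypothesis psi_chain : forall s, fbd (psi s) = fglift psi (fbd1 s).
Hypothesis phi_nil : phi [::] = psi [::].

Lemma fsize_fht n s : size s = n -> fsize n.+1 (fht n s).
Proof.
elim: n s => [|n IH] s sn /=; first by case: (supp_subspace (fun s : seq Q => size s = 1%N)).
have sS := supp_subspace (fun s : seq Q => size s = n.+1).
apply/fsize_cons; apply: (subspace_predB sS).
  by apply: (subspace_predB sS); [exact: phi_size | exact: psi_size].
by apply/(supp_fglift sS IH); exact: fsize_fbd1.
Qed.

(** The recursion cones off the defect, so that [fbd_cons] reduces the claim to
    the defect being a cycle, which is the claim one dimension lower. *)
Lemma fht_chain n s : size s = n.+1 ->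
  fbd (fht n.+1 s) = phi s - psi s - fglift (fht n) (fbd1 s).
Proof.
elim: n s => [|n IH] s sn.
  case: s sn => [//|x [|//] _] /=; rewrite fbd_cons.
  rewrite linear0 subr0 fgliftU subr0 fbdB phi_chain psi_chain /=.
  by rewrite linear0 subr0 !fgliftU phi_nil subrr linear0 subr0.
rewrite [fht _ _]/= fbd_cons -[RHS]subr0; congr (_ - _).
rewrite -[RHS](linear0 (fcons (b s))); congr (fcons _ _).
rewrite !fbdB phi_chain psi_chain.
have -> : fbd (fglift (fht n.+1) (fbd1 s)) =
    fglift phi (fbd1 s) - fglift psi (fbd1 s) - fglift (fht n) (fbd (fbd1 s)).
  pose G : {linear fchain P -> fchain Q} :=
    (fglift phi \- fglift psi) \- (fglift (fht n) \o @fbd P).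
  have GE c : fglift phi c - fglift psi c - fglift (fht n) (fbd c) = G c by [].
  rewrite GE; apply: (@freeg_lin_ext _ _ (@fbd Q \o fglift (fht n.+1)) G) => t ts.
  rewrite -GE !fgliftU fbdU [LHS]/= fgliftU; apply: IH.
  exact: fsize_fbd1 ts.
by rewrite -[fbd1 s]fbdU fbd_fbd linear0 subr0 subrr.
Qed.

End FormalHomotopy.

Section FormalMaps.

Definition all_in (P : eqType) (D : P -> Prop) (s : seq P) : Prop :=
  forall x, x \in s -> D x.

Lemma fsupp_cons (P : choiceType) (D : P -> Prop) b c : D b ->
  supp (all_in D) c ->
  supp (all_in D) (fcons b c).
Proof.
move=> Db; apply: supp_fglift; first exact: supp_subspace.
by move=> s sD; apply: suppU => x; rewrite inE => /orP[/eqP->|/sD].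
Qed.

Lemma fsupp_fbd1 (P : choiceType) (D : P -> Prop) s :
  all_in D s ->
  supp (all_in D) (fbd1 s).
Proof.
move=> sD; apply: (supp_impl _ (@fbd1_sub P s)) => t ts x xt.
exact/sD/ts.
Qed.

Lemma fsupp_fsd (P : choiceType) (D : P -> Prop) (b : seq P -> P) n s :
  (forall t, (0 < size t)%N -> all_in D t -> D (b t)) ->
  size s = n -> all_in D s ->
  supp (all_in D) (fsd b n s).
Proof.
move=> bD; elim: n s => [|n IH] s sn sD /=; first by apply: suppU.
apply: fsupp_cons; first by apply: bD; rewrite ?sn.
apply: (@supp_fglift _ _ (fun t => size t = n /\ all_in D t)).
- exact: supp_subspace.
- by move=> t [tn tD]; exact: IH.
- by move=> t ts; split; [exact: (fsize_fbd1 sn ts)|exact: fsupp_fbd1 ts].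
Qed.

Lemma fsupp_fht (P Q : choiceType) (phi psi : seq P -> fchain Q)
    (b : seq P -> Q) (D : P -> Prop) (D' : Q -> Prop) n s :
  let sD' := supp (all_in D') in
  (forall t, all_in D t -> sD' (phi t)) ->
  (forall t, all_in D t -> sD' (psi t)) ->
  (forall t, (0 < size t)%N -> all_in D t -> D' (b t)) ->
  size s = n -> all_in D s -> sD' (fht phi psi b n s).
Proof.
move=> /= phiD psiD bD; elim: n s => [|n IH] s sn sD /=.
  by case: (supp_subspace (all_in D')).
have sS := supp_subspace (all_in D').
apply: fsupp_cons; first by apply: bD; rewrite ?sn.
apply: (subspace_predB sS).
  by apply: (subspace_predB sS); [exact: phiD|exact: psiD].
apply: (@supp_fglift _ _ (fun t => size t = n /\ all_in D t)) => //.
- by move=> t [tn tD]; exact: IH.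
- by move=> t ts; split; [exact: (fsize_fbd1 sn ts)|exact: fsupp_fbd1 ts].
Qed.

Definition fcmap (P Q : choiceType) (L : P -> Q) : fchain P -> fchain Q :=
  fglift (fun s => << map L s >>).

HB.instance Definition _ (P Q : choiceType) (L : P -> Q) :=
  GRing.Linear.on (fcmap L).

Lemma fcmapU (P Q : choiceType) (L : P -> Q) s : fcmap L << s >> = << map L s >>.
Proof. exact: fgliftU. Qed.

Lemma fcmap_cons (P Q : choiceType) (L : P -> Q) b c :
  fcmap L (fcons b c) = fcons (L b) (fcmap L c).
Proof.
apply: (@freeg_lin_ext _ _ (fcmap L \o fcons b) (fcons (L b) \o fcmap L)) => s _.
by rewrite /= fconsU !fcmapU fconsU.
Qed.

Lemma fcmap_fbd1 (P Q : choiceType) (L : P -> Q) s :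
  fcmap L (fbd1 s) = fbd1 (map L s).
Proof.
elim: s => [|x s IH] /=; first by rewrite linear0.
by rewrite linearB /= fcmap_cons IH fcmapU.
Qed.

Lemma fcmap_lift (P Q R : choiceType) (L : P -> Q) (f : seq Q -> fchain R) c :
  fglift f (fcmap L c) = fglift (fun s => f (map L s)) c.
Proof.
apply: (@freeg_lin_ext _ _ (fglift f \o fcmap L)) => s _.
by rewrite /= fcmapU !fgliftU.
Qed.

Lemma fcmap_fsd (P Q : choiceType) (L : P -> Q) b b' n s :
  (forall t, b' (map L t) = L (b t)) ->
  fcmap L (fsd b n s) = fsd b' n (map L s).
Proof.
move=> bL; elim: n s => [|n IH] s /=; first by rewrite fcmapU.
rewrite fcmap_cons bL -fcmap_fbd1 fcmap_lift; congr (fcons _ _).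
apply: (@freeg_lin_ext _ _ (fcmap L \o fglift (fsd b n))) => t _.
by rewrite /= !fgliftU IH.
Qed.

Lemma fcmap_fht (P Q P' Q' : choiceType) (L : P -> P') (M : Q -> Q')
    phi psi b phi' psi' b' n s :
  (forall t, phi' (map L t) = fcmap M (phi t)) ->
  (forall t, psi' (map L t) = fcmap M (psi t)) ->
  (forall t, (0 < size t)%N -> b' (map L t) = M (b t)) ->
  size s = n ->
  fcmap M (fht phi psi b n s) = fht phi' psi' b' n (map L s).
Proof.
move=> phiL psiL bL; elim: n s => [|n IH] s sn /=; first by rewrite linear0.
rewrite fcmap_cons bL ?sn // -fcmap_fbd1 fcmap_lift; congr (fcons _ _).
rewrite !linearB /= phiL psiL; congr (_ - _).
apply: (@freeg_lin_ext _ _ (fcmap M \o fglift (fht phi psi b n))) => t ts.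
by rewrite /= !fgliftU IH //; exact: fsize_fbd1 ts.
Qed.

End FormalMaps.

(** * Shrinking of simplices under barycentric subdivision *)

Section Mesh.
Variable P : normedModType RR.
Implicit Types (s t : seq P) (D : P -> Prop).

Definition convex_pred D : Prop :=
  forall (t : RR) x y, 0 <= t <= 1 -> D x -> D y -> D (t *: x + (1 - t) *: y).

Definition barycenter s : P := (size s)%:R^-1 *: \sum_(x <- s) x.

Lemma convex_barycenter D s :
  convex_pred D -> (0 < size s)%N -> all_in D s -> D (barycenter s).
Proof.
move=> cD; elim: s => [//|x s IH] _ sD.
have Dx : D x by apply: sD; rewrite mem_head.
have [->|s0] := eqVneq s [::].
  by rewrite /barycenter big_seq1 invr1 scale1r.
have {}s0 : (0 < size s)%N by case: (s) s0.
have Ds : D (barycenter s) by apply: IH => // y ys; apply: sD; rewrite inE ys orbT.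
have n0 : (size s)%:R != 0 :> RR by rewrite pnatr_eq0 -lt0n.
have n1 : (size s).+1%:R != 0 :> RR by rewrite pnatr_eq0.
have -> : barycenter (x :: s) =
    (size s).+1%:R^-1 *: x + (1 - (size s).+1%:R^-1) *: barycenter s.
  rewrite /barycenter big_cons /= scalerDr scalerA; congr (_ + _ *: _).
  by move: n1; rewrite -natr1 => n1; field; rewrite n0 n1.
apply: cD => //; rewrite invr_ge0 ler0n /= invf_le1 ?ltr0Sn //.
by rewrite ler1n.
Qed.

Definition mesh_le (d : RR) s := forall x y, x \in s -> y \in s -> `|x - y| <= d.

Lemma convex_ball c r : convex_pred (fun y : P => `|c - y| <= r).
Proof.
move=> t x y /andP[t0 t1] cx cy.
have -> : c - (t *: x + (1 - t) *: y) = t *: (c - x) + (1 - t) *: (c - y).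
  by rewrite !scalerBr addrACA -scalerDl -opprD [t + _]addrC subrK scale1r.
apply: le_trans (ler_normD _ _) _; rewrite !normrZ ger0_norm // ger0_norm ?subr_ge0 //.
have -> : r = t * r + (1 - t) * r by ring.
by apply: lerD; apply: ler_wpM2l; rewrite ?subr_ge0.
Qed.

Lemma barycenter_dist s d x : mesh_le d s -> x \in s ->
  `|barycenter s - x| <= (size s).-1%:R / (size s)%:R * d.
Proof.
move=> sd xs; have n0 : (0 < size s)%N by case: (s) xs.
have n1 : (size s)%:R != 0 :> RR by rewrite pnatr_eq0 -lt0n.
have -> : barycenter s - x = (size s)%:R^-1 *: \sum_(y <- s) (y - x).
  rewrite sumrB scalerBr; congr (_ - _).
  rewrite big_const_seq count_predT iter_addr addr0 -scaler_nat scalerA.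
  by rewrite mulVf // scale1r.
rewrite normrZ ger0_norm ?invr_ge0 ?ler0n // -mulrA [leRHS]mulrCA.
apply: ler_wpM2l; first by rewrite invr_ge0 ler0n.
rewrite -(size_rem xs) (big_rem x xs) /= subrr add0r.
apply: le_trans (ler_norm_sum _ _ _) _.
have -> : (size (rem x s))%:R * d = \sum_(y <- rem x s) d.
  by rewrite big_const_seq count_predT iter_addr addr0 mulr_natl.
rewrite !big_seq; apply: ler_sum => y /mem_rem ys; exact: sd.
Qed.

Lemma leq_shrink m N : (m <= N)%N ->
  m%:R / m.+1%:R <= N%:R / N.+1%:R :> RR.
Proof.
move=> mN; rewrite ler_pdivrMr ?ltr0Sn // mulrAC ler_pdivlMr ?ltr0Sn //.
by rewrite -!natrM ler_nat !mulnS; lia.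
Qed.

(** A simplex of the subdivision is a barycenter together with a simplex in the
    subdivision of a face; the distance from the former to any point of the
    face is at most [N / N.+1] times the diameter. *)
Lemma fsd_mesh N n s d : 0 <= d -> size s = n -> (n <= N.+1)%N -> mesh_le d s ->
  supp (mesh_le (N%:R / N.+1%:R * d)) (fsd barycenter n s).
Proof.
move=> d0; elim: n s => [|n IH] s sn nN sd /=.
  by apply: suppU; rewrite (size0nil sn).
have q0 : 0 <= N%:R / N.+1%:R * d :> RR by rewrite !mulr_ge0 ?invr_ge0 ?ler0n.
pose C x := `|barycenter s - x| <= N%:R / N.+1%:R * d.
have Cs : all_in C s.
  move=> x xs; apply: le_trans (barycenter_dist sd xs) _.
  by rewrite sn /= ler_wpM2r // leq_shrink.
have cC : convex_pred C by exact: convex_ball.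
apply: (@supp_fglift _ _ (fun t => mesh_le (N%:R / N.+1%:R * d) t /\ all_in C t)).
- exact: supp_subspace.
- move=> t [td tC]; apply: suppU => x y; rewrite !inE.
  move=> /orP[/eqP->|xt] /orP[/eqP->|yt].
  + by rewrite subrr normr0.
  + exact: tC.
  + by rewrite distrC; exact: tC.
  + exact: td.
- have sS := supp_subspace
    (fun t => mesh_le (N%:R / N.+1%:R * d) t /\ all_in C t).
  apply: (@supp_fglift _ _ (fun t => size t = n /\ {subset t <= s})) => //.
    move=> t [tn ts] u ut; split.
      apply: (IH t tn _ _ u ut); first exact: ltnW.
      by move=> x y xt yt; apply: sd; exact: ts.
    apply: (fsupp_fsd _ tn _ ut) => [v v0|x /ts/Cs //].
    exact: convex_barycenter.
  by move=> t ts; split; [exact: (fsize_fbd1 sn ts) | exact: (fbd1_sub ts)].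
Qed.

End Mesh.

(** * Continuity on a subset *)

(** Continuity of the restriction to a subset, for a function defined
    everywhere: subsets of a space can then be studied without endowing them
    with a topology. *)
Definition cts_on (T T' : topologicalType) (A : set T) (f : T -> T') : Prop :=
  forall x, A x -> f @ within A (nbhs x) --> f x.

Section ContinuityOn.

Lemma cts_onP (T T' : topologicalType) (A : set T) (f : T -> T') :
  cts_on A f <-> forall O, open O ->
    exists2 O', open O' & forall x, A x -> (O' x <-> O (f x)).
Proof.
split=> [fA O oO|H x Ax U].
  pose W x := exists V, [/\ open V, V x & forall y, V y -> A y -> O (f y)].
  exists W.
    rewrite openE => x [V [oV Vx VO]]; apply: filterS (open_nbhs_nbhs (conj oV Vx)).
    by move=> y Vy; exists V.
  move=> x Ax; split=> [[V [_ Vx VO]]|Ofx]; first exact: VO.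
  have /fA : A x by []. move=> /(_ O (open_nbhs_nbhs (conj oO Ofx))).
  rewrite /= /within nbhs_simpl /= nbhsE /= => -[V [oV Vx] VO].
  by exists V; split=> // y Vy Ay; exact: VO.
rewrite nbhsE /= => -[O [oO Ofx] OU]; have [O' oO' O'E] := H _ oO.
rewrite nbhs_simpl /= /within /= nbhsE; exists O'; first last.
  by move=> y /O'E O'y Ay; exact/OU/O'y.
by split=> //; exact/O'E.
Qed.

Lemma cts_on_continuous (T T' : topologicalType) (A : set T) (f : T -> T') :
  continuous f -> cts_on A f.
Proof. by move=> fc x _; apply: cvg_trans (fc x); exact: cvg_app (cvg_within _). Qed.

Lemma cts_on_subset (T T' : topologicalType) (A B : set T) (f : T -> T') :
  B `<=` A -> cts_on A f -> cts_on B f.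
Proof.
move=> BA /cts_onP fA; apply/cts_onP => O /fA[O' oO' H].
by exists O' => // x /BA/H.
Qed.

Lemma cts_on_eq (T T' : topologicalType) (A : set T) (f g : T -> T') :
  (forall x, A x -> f x = g x) -> cts_on A f -> cts_on A g.
Proof.
move=> fg /cts_onP fA; apply/cts_onP => O /fA[O' oO' H].
by exists O' => // x Ax; rewrite -fg //; exact: H.
Qed.

Lemma cts_on_comp (T1 T2 T3 : topologicalType) (A : set T1) (B : set T2)
    (f : T1 -> T2) (g : T2 -> T3) :
  cts_on A f -> cts_on B g -> (forall x, A x -> B (f x)) -> cts_on A (g \o f).
Proof.
move=> /cts_onP fA /cts_onP gB AB; apply/cts_onP => O /gB[O' /fA[O'' oO'' H'] H].
by exists O'' => // x Ax; split=> [/(H' _ Ax)/(H _ (AB _ Ax))|]//= /(H _ (AB _ Ax))/(H' _ Ax).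
Qed.

Lemma cts_on_setT (T T' : topologicalType) (f : T -> T') :
  cts_on setT f <-> continuous f.
Proof.
split=> [fT x|]; last exact: cts_on_continuous.
by have := fT x I; rewrite withinET.
Qed.

Lemma cts_on_comp_cont (T1 T2 T3 : topologicalType) (B : set T2)
    (f : T1 -> T2) (g : T2 -> T3) :
  continuous f -> cts_on B g -> (forall x, B (f x)) -> continuous (g \o f).
Proof.
move=> /cts_on_setT fc gB fB; apply/cts_on_setT.
by apply: cts_on_comp gB _ => // x _; exact: fB.
Qed.

Lemma cts_on_pair (T T1 T2 : topologicalType) (A : set T) (f : T -> T1)
    (g : T -> T2) :
  cts_on A f -> cts_on A g -> cts_on A (fun x => (f x, g x)).
Proof. by move=> fA gA x Ax; apply: cvg_pair; [exact: fA|exact: gA]. Qed.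

Lemma cts_on_fst (T1 T2 : topologicalType) (A : set (T1 * T2)) : cts_on A fst.
Proof. by apply: cts_on_continuous => x; exact: cvg_fst. Qed.

Lemma cts_on_snd (T1 T2 : topologicalType) (A : set (T1 * T2)) : cts_on A snd.
Proof. by apply: cts_on_continuous => x; exact: cvg_snd. Qed.

Lemma cts_on_cst (T T' : topologicalType) (A : set T) (y : T') :
  cts_on A (fun=> y).
Proof. by apply: cts_on_continuous; exact: cst_continuous. Qed.

End ContinuityOn.

(** * Singular simplices as total maps on affine space *)

Section Simplex.

Lemma simplex_vertex n (i : 'I_n.+1) : simplex n (delta_mx 0 i).
Proof.
split=> [j|]; first by rewrite mxE; case: andP.
rewrite (bigD1 i) //= mxE !eqxx big1 ?addr0 // => j ji.
by rewrite mxE (negPf ji) andbF.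
Qed.

Definition simplex_pt n x (xn : simplex n x) : simplex n :=
  exist _ x (mem_set xn).

(** Affine combinations of vertices are computed in the whole row space, so a
    singular simplex is extended to it by an arbitrary value; only continuity on
    the simplex is retained. *)
Definition ext (T : Type) n (s : simplex n -> T) (x : 'rV[RR]_n.+1) : T :=
  if pselect (simplex n x) is left h then s (simplex_pt h)
  else s (simplex_pt (simplex_vertex ord0)).

Lemma extE (T : Type) n (s : simplex n -> T) (x : simplex n) :
  ext s (val x) = s x.
Proof.
rewrite /ext; case: pselect => [h|]; last by case; exact: set_valP.
by congr s; apply: val_inj.
Qed.

Lemma ext_cts n (T : topologicalType) (s : simplex n -> T) :
  continuous s -> cts_on (simplex n) (ext s).
Proof.
move=> /continuousP sc; apply/cts_onP => O /sc[O' oO' O'E]; exists O' => //.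
move=> x xn; have := extE s (simplex_pt xn); rewrite /= => ->.
by move: (congr1 (fun A => A (simplex_pt xn)) O'E) => /= ->.
Qed.

Lemma simplex_val_continuous n :
  continuous (fun x : simplex n => val x : 'rV[RR]_n.+1).
Proof. exact: initial_continuous. Qed.

Lemma simplex_closed n : closed (simplex n).
Proof.
have -> : simplex n =
    (\bigcap_(i in [set: 'I_n.+1]) [set x : 'rV[RR]_n.+1 | 0 <= x 0 i]) `&`
    [set x | \sum_i x 0 i = 1].
  apply/seteqP; split=> x [x0 x1]; split=> //; first by move=> i _; exact: x0.
  by move=> i; exact: (x0 i I).
apply: closedI.
  apply: closed_bigI => i _.
  apply: (@preimage_closed _ _ (fun x : 'rV[RR]_n.+1 => x 0 i) [set t | 0 <= t]).
    by move=> x _; exact: coord_continuous.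
  exact: closed_ge.
apply: (@preimage_closed _ RR^o (fun x : 'rV[RR]_n.+1 => \sum_i x 0 i) [set 1]).
  move=> x _; apply: continuous_big => [|i _]; last exact: coord_continuous.
  by move=> z; apply: cvgD; [exact: cvg_fst|exact: cvg_snd].
exact: closed_eq.
Qed.

Lemma simplex_compact n : compact (simplex n).
Proof.
apply: bounded_closed_compact (@simplex_closed n).
exists 1; split=> // M M1 x [x0 x1].
rewrite /Num.norm /= mx_normrE; apply/bigmax_leP; split=> [|[i j] _] /=.
  by rewrite (le_trans _ (ltW M1)).
rewrite ord1 ger0_norm //; apply: le_trans (ltW M1).
by rewrite -x1 (bigD1 j) //= lerDl sumr_ge0.
Qed.

Lemma simplex_convex n : convex_pred (simplex n).
Proof.
move=> t x y /andP[t0 t1] [x0 x1] [y0 y1]; split=> [i|].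
  by rewrite !mxE addr_ge0 // mulr_ge0 // subr_ge0.
under eq_bigr do rewrite !mxE.
by rewrite big_split /= -!mulr_sumr x1 y1 !mulr1 addrC subrK.
Qed.

(** A Lebesgue number of a two-set open cover of the image of a simplex, by
    compactness of the simplex. *)
Lemma simplex_lebesgue n (T : topologicalType) (s : simplex n -> T)
    (U V : set T) :
  continuous s -> open U -> open V -> (forall x, U (s x) \/ V (s x)) ->
  exists2 e : RR, 0 < e & forall x : 'rV_n.+1, simplex n x ->
    (forall y, simplex n y -> `|x - y| < e -> U (ext s y)) \/
    (forall y, simplex n y -> `|x - y| < e -> V (ext s y)).
Proof.
move=> sc oU oV UV.
pose Q (e : RR) (x : 'rV[RR]_n.+1) :=
  (forall y, simplex n y -> `|x - y| < e -> U (ext s y)) \/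
  (forall y, simplex n y -> `|x - y| < e -> V (ext s y)).
have key x W : open W -> simplex n x -> W (ext s x) ->
    exists2 r : RR, 0 < r & forall y, simplex n y -> `|x - y| < r -> W (ext s y).
  move=> oW xn Wx; have /cts_onP/(_ W oW)[O oO OE] := ext_cts sc.
  have Ox : nbhs x O by apply: open_nbhs_nbhs; split=> //; exact/OE.
  have /nbhs_ballP[r /= r0 rO] := Ox; exists r => // y yn xy.
  by apply/OE => //; apply: rO; rewrite -ball_normE.
have /compact_near_coveringP cov := @simplex_compact n.
have /cov : forall x, simplex n x -> \forall x' \near x & e \near 0^'+, Q e x'.
  move=> x xn.
  have [r r0 rQ] : exists2 r : RR, 0 < r &
      (forall y, simplex n y -> `|x - y| < r -> U (ext s y)) \/
      (forall y, simplex n y -> `|x - y| < r -> V (ext s y)).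
    have := UV (simplex_pt xn); rewrite -extE /= => -[] /key[] // r r0 rW.
      by exists r => //; left.
    by exists r => //; right.
  have r20 : 0 < r / 2 by rewrite divr_gt0.
  exists (ball x (r / 2), [set e : RR | e < r / 2]).
    split; first exact: nbhsx_ballx.
    exact: nbhs_right_lt.
  move=> [x' e] /= [xx' er]; rewrite -ball_normE /= in xx'.
  have xy y : `|x' - y| < e -> `|x - y| < r.
    move=> x'y; rewrite -(subrK x' x) -addrA.
    apply: le_lt_trans (ler_normD _ _) _; rewrite [r]splitr.
    by apply: ltrD => //; exact: lt_trans er.
  by case: rQ => rQ; [left|right] => y yn x'y; apply: rQ => //; exact: xy.
move=> eQ; near (0^'+ : set_system RR) => e.
exists e; first by near: e; exact: nbhs_right_gt.
by near: e; exact: eQ.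
Unshelve. all: by end_near.
Qed.

End Simplex.

(** * Affine simplices *)
Section Realization.

(** Junk value [0] when [f] is not continuous, so that the chain operators below
    are total. *)
Definition mks (T : topologicalType) n (f : simplex n -> T) : chain T n :=
  if pselect (continuous f) is left h then << Singular h >> else 0.

Lemma mksE (T : topologicalType) n (f : simplex n -> T) (h : continuous f) :
  mks f = << Singular h >>.
Proof.
rewrite /mks; case: pselect => // h'.
by rewrite (Prop_irrelevance h h').
Qed.

Lemma mks_sing (T : topologicalType) n (s : singular T n) :
  << s >> = mks s :> chain T n.
Proof. by case: s => f h; rewrite (mksE h). Qed.

Lemma eq_mks (T : topologicalType) n (f g : simplex n -> T) :
  f =1 g -> mks f = mks g.
Proof. by move=> /funext->. Qed.

HB.instance Definition _ (T : topologicalType) n :=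
  GRing.Linear.on (@sing_bd T n).

Lemma sing_bdU (T : topologicalType) n (s : singular T n.+1) :
  sing_bd (<< s >> : chain T n.+1) =
  \sum_(i < n.+2) (-1) ^+ i *: (<< sing_face i s >> : chain T n).
Proof. exact: fgliftU. Qed.

Lemma sing_bd_mks (T : topologicalType) n (f : simplex n.+1 -> T) :
  continuous f ->
  sing_bd (mks f) = \sum_(i < n.+2) (-1) ^+ i *: mks (f \o face i).
Proof.
move=> h; rewrite (mksE h) sing_bdU; apply: eq_bigr => i _.
by rewrite (mks_sing (sing_face i _)).
Qed.

Definition carried (T : topologicalType) (A : set T) n : chain T n -> Prop :=
  supp (fun s : singular T n => forall x, A (s x)).

Lemma carried_subspace (T : topologicalType) (A : set T) n :
  subspace_pred (@carried T A n).
Proof. exact: supp_subspace. Qed.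

Lemma carried_mks (T : topologicalType) (A : set T) n (f : simplex n -> T) :
  (forall x, A (f x)) -> carried A (mks f).
Proof.
rewrite /mks => fA; case: pselect => [h|_].
  by apply: suppU.
by case: (carried_subspace A n).
Qed.

Lemma carried_sub (T : topologicalType) (A B : set T) n (c : chain T n) :
  A `<=` B -> carried A c -> carried B c.
Proof. by move=> AB; apply: supp_impl => s sA x; exact/AB/sA. Qed.

Lemma carried_bd (T : topologicalType) (A : set T) n (c : chain T n.+1) :
  carried A c -> carried A (sing_bd c).
Proof.
apply: (@supp_fglift _ _ _ (@carried T A n)) => [|s sA].
  exact: carried_subspace.
apply: supp_sum => i _.
apply: suppZ.
by apply: suppU => x; exact: sA.
Qed.

Definition aff (P : lmodType RR) n (v : seq P) (x : 'rV[RR]_n.+1) : P :=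
  \sum_i x 0 i *: nth 0 v i.

Lemma aff_continuous (P : normedModType RR) n (v : seq P) :
  continuous (@aff P n v).
Proof.
apply: continuous_big => [|i _].
  by move=> z; apply: cvgD; [exact: cvg_fst|exact: cvg_snd].
have ci : continuous (fun x : 'rV[RR]_n.+1 => x 0 i : RR^o).
  exact: coord_continuous.
move=> x; apply: (@continuous_comp _ _ _ _ (fun k : RR^o => k *: nth 0 v i) _ (ci x)).
exact: scalel_continuous.
Qed.

Lemma aff_in (P : lmodType RR) n (v : seq P) (D : P -> Prop)
    (x : 'rV[RR]_n.+1) :
  (forall (t : RR) x y, 0 <= t <= 1 -> D x -> D y -> D (t *: x + (1 - t) *: y)) ->
  size v = n.+1 -> all_in D v -> simplex n x -> D (aff v x).
Proof.
move=> cD vn vD; elim: n v x vn vD => [|n IH] v x vn vD [x0 x1].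
  rewrite /aff big_ord1; move: x1; rewrite big_ord1 => ->; rewrite scale1r.
  by apply: vD; rewrite mem_nth // vn.
rewrite /aff big_ord_recl; pose a : RR := x 0 ord0; rewrite -/a.
have a0 : 0 <= a by exact: x0.
have v0D : D (nth 0 v (ord0 : 'I_n.+2)) by apply: vD; rewrite mem_nth // vn.
have sE : \sum_(i < n.+1) x 0 (fintype.lift ord0 i) = 1 - a.
  by move: x1; rewrite big_ord_recl => <-; rewrite addrAC subrr add0r.
have s0 : 0 <= 1 - a by rewrite -sE sumr_ge0.
have [a1|a1] := eqVneq a 1.
  rewrite big1 ?addr0 ?a1 ?scale1r // => i _.
  have /eqP : \sum_(i < n.+1) x 0 (fintype.lift ord0 i) = 0 by rewrite sE a1 subrr.
  rewrite psumr_eq0 // => /allP/(_ i); rewrite mem_index_enum /= => /(_ isT).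
  by move=> /eqP->; rewrite scale0r.
have a1' : 1 - a != 0 by rewrite subr_eq0 eq_sym.
pose y : 'rV[RR]_n.+1 := \row_i ((1 - a)^-1 * x 0 (fintype.lift ord0 i)).
have -> : \sum_(i < n.+1) x 0 (fintype.lift ord0 i) *: nth 0 v (fintype.lift ord0 i) =
    (1 - a) *: aff (behead v) y.
  rewrite /aff scaler_sumr; apply: eq_bigr => i _.
  by rewrite mxE scalerA mulrA mulfV // mul1r nth_behead.
apply: cD => //; first by rewrite a0 /= -subr_ge0.
apply: IH => [||].
- by rewrite size_behead vn.
- by move=> z zv; apply: vD; exact: mem_behead.
split=> [i|]; first by rewrite mxE mulr_ge0 // invr_ge0.
by under eq_bigr do rewrite mxE; rewrite -mulr_sumr sE mulVf.
Qed.

Lemma aff_face (P : lmodType RR) n (v : seq P) (i : 'I_n.+2)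
    (x : 'rV[RR]_n.+1) :
  size v = n.+2 -> aff v (face_fun i x) = aff (omit i v) x.
Proof.
move=> vn; rewrite /aff (bigD1_ord i) //= mxE unlift_none scale0r add0r.
apply: eq_bigr => k _; rewrite mxE liftK; congr (_ *: _).
rewrite /omit nth_cat size_takel ?vn ?(ltnW (ltn_ord i)) //.
rewrite /= /bump; case: (ltnP k i) => ki.
  by rewrite nth_take.
by rewrite nth_drop add1n addSn subnKC.
Qed.

Lemma aff_map (P Q : lmodType RR) (L : {linear P -> Q}) n (v : seq P)
    (x : 'rV[RR]_n.+1) : aff (map L v) x = L (aff v x).
Proof.
rewrite /aff linear_sum; apply: eq_bigr => i _; rewrite linearZ /=.
congr (_ *: _); have [iv|iv] := ltnP i (size v).
  by rewrite (nth_map 0).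
by rewrite !nth_default ?size_map ?linear0.
Qed.

Definition vertices n : seq 'rV[RR]_n.+1 := [seq delta_mx 0 i | i : 'I_n.+1].

Lemma size_vertices n : size (vertices n) = n.+1.
Proof. by rewrite size_map size_enum_ord. Qed.

Lemma nth_vertices n (i : 'I_n.+1) : nth 0 (vertices n) i = delta_mx 0 i.
Proof.
by rewrite (nth_map i) ?size_enum_ord // nth_ord_enum.
Qed.

Lemma aff_vertices n (x : 'rV[RR]_n.+1) : aff (vertices n) x = x.
Proof.
rewrite /aff [RHS]row_sum_delta; apply: eq_bigr => i _.
by rewrite nth_vertices.
Qed.

Lemma vertices_in n : all_in (simplex n) (vertices n).
Proof. by move=> x /mapP[i _ ->]; exact: simplex_vertex. Qed.

Lemma face_fun_linear n (i : 'I_n.+2) : linear (@face_fun n i).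
Proof.
move=> a x y; apply/rowP => j; rewrite !mxE.
by case: unlift => [k|]; rewrite ?mxE // mulr0 addr0.
Qed.

HB.instance Definition _ n (i : 'I_n.+2) :=
  GRing.isLinear.Build RR 'rV[RR]_n.+1 'rV[RR]_n.+2 *:%R (@face_fun n i)
    (face_fun_linear i).

Lemma omit_vertices n (i : 'I_n.+2) :
  omit i (vertices n.+1) = map (face_fun i) (vertices n).
Proof.
have iv : (i <= size (vertices n.+1))%N by rewrite size_vertices ltnW.
have sE : size (omit i (vertices n.+1)) = n.+1.
  rewrite /omit size_cat size_takel // size_drop size_vertices.
  by have := ltn_ord i; lia.
apply: (@eq_from_nth _ 0) => [|k]; first by rewrite sE size_map size_vertices.
rewrite sE /omit => kn.
rewrite (nth_map 0) ?size_vertices // (nth_vertices (Ordinal kn)).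
have -> : nth 0 (take i (vertices n.+1) ++ drop i.+1 (vertices n.+1)) k =
    nth 0 (vertices n.+1) (fintype.lift i (Ordinal kn)).
  rewrite nth_cat size_takel // /= /bump.
  case: (ltnP k i) => ki; first by rewrite nth_take.
  by rewrite nth_drop add1n addSn subnKC.
rewrite nth_vertices; apply/rowP => j; rewrite !mxE /=.
case: unliftP => [l ->|->]; last by rewrite (negPf (neq_lift _ _)).
by rewrite mxE /= (inj_eq lift_inj).
Qed.

(** A formal chain of points of [P] becomes a singular chain through the affine
    simplices spanned by its sequences and the map [Phi]; the formal identities
    are transported in this way. *)
Definition realize (T : topologicalType) (P : normedModType RR) (Phi : P -> T)
    n : fchain P -> chain T n :=
  fglift (fun v => mks (fun x : simplex n => Phi (aff v (val x)))).

HB.instance Definition _ (T : topologicalType) (P : normedModType RR)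
    (Phi : P -> T) n := GRing.Linear.on (@realize T P Phi n).

Lemma realizeU (T : topologicalType) (P : normedModType RR) (Phi : P -> T) n v :
  realize Phi n << v >> = mks (fun x : simplex n => Phi (aff v (val x))).
Proof. exact: fgliftU. Qed.

Definition in_dom (P : choiceType) (D : P -> Prop) n : fchain P -> Prop :=
  supp (fun v => size v = n.+1 /\ all_in D v).

Lemma realize_cts (T : topologicalType) (P : normedModType RR) (Phi : P -> T)
    (D : set P) n (v : seq P) :
  convex_pred D -> cts_on D Phi -> size v = n.+1 -> all_in D v ->
  continuous (fun x : simplex n => Phi (aff v (val x))).
Proof.
move=> cD PhiD vn vD.
apply: (@cts_on_comp_cont _ _ _ D (fun x : simplex n => aff v (val x))) => //.
  move=> x; apply: (@continuous_comp _ _ _ (fun x : simplex n => val x)).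
    exact: simplex_val_continuous.
  exact: aff_continuous.
by move=> x; apply: aff_in => //; exact: set_valP.
Qed.

Lemma realize_bd (T : topologicalType) (P : normedModType RR) (Phi : P -> T)
    (D : set P) n c :
  convex_pred D -> cts_on D Phi -> in_dom D n.+1 c ->
  sing_bd (realize Phi n.+1 c) = realize Phi n (fbd c).
Proof.
move=> cD PhiD cdom.
apply: (@freeg_lin_ext _ _ (@sing_bd T n \o realize Phi n.+1)
  (realize Phi n \o @fbd P)) => v /cdom[vn vD] /=.
rewrite realizeU sing_bd_mks; last exact: realize_cts PhiD vn vD.
rewrite fbdU fbd1_omit vn linear_sum; apply: eq_bigr => i _.
rewrite linearZ /= realizeU; congr (_ *: _).
by apply: eq_mks => x /=; rewrite aff_face.
Qed.

Lemma realize_ext (T : topologicalType) (P : normedModType RR)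
    (Phi Psi : P -> T) (D : set P) n c :
  convex_pred D -> (forall x, D x -> Phi x = Psi x) -> in_dom D n c ->
  realize Phi n c = realize Psi n c.
Proof.
move=> cD PhiPsi cdom; apply: freeg_lin_ext => v /cdom[vn vD] /=.
rewrite !realizeU; apply: eq_mks => x; apply: PhiPsi.
by apply: aff_in => //; exact: set_valP.
Qed.

Lemma realize_map (T : topologicalType) (P Q : normedModType RR)
    (Phi : Q -> T) (L : {linear P -> Q}) n c :
  realize Phi n (fcmap L c) = realize (Phi \o L) n c.
Proof.
apply: (@freeg_lin_ext _ _ (realize Phi n \o fcmap L)) => v _ /=.
by rewrite fcmapU !realizeU; apply: eq_mks => x; rewrite aff_map.
Qed.

Lemma carried_realize (T : topologicalType) (P : normedModType RR)
    (Phi : P -> T) (D : set P) (A : set T) n c :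
  convex_pred D -> (forall x, D x -> A (Phi x)) -> in_dom D n c ->
  carried A (realize Phi n c).
Proof.
move=> cD PhiA; apply: (@supp_fglift _ _ _ (@carried T A n)).
  exact: carried_subspace.
move=> v [vn vD]; apply: carried_mks => x; apply: PhiA.
by apply: aff_in => //; exact: set_valP.
Qed.

End Realization.

(** * Natural operators on singular chains *)

Section NaturalOperators.

(** Affine space times a time coordinate: it serves both for homotopies, which
    are maps on a prism, and for subdivision, which stays at time [0]. *)
Notation Pn n := ('rV[RR]_n.+1 * RR^o)%type.

Definition prism n : set (Pn n) := fun p => simplex n p.1 /\ 0 <= p.2 <= 1.

Lemma prism_convex n : convex_pred (@prism n).
Proof.
move=> t x y t01 [x1 x2] [y1 y2]; split; first exact: simplex_convex.
move: t01 x2 y2 => /andP[t0 t1] /andP[x0 x1'] /andP[y0 y1'] /=.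
apply/andP; split.
  by rewrite addr_ge0 // mulr_ge0 // subr_ge0.
rewrite [leRHS](_ : _ = t * 1 + (1 - t) * 1); last by ring.
by apply: lerD; apply: ler_wpM2l; rewrite ?subr_ge0.
Qed.

Definition facep n (i : 'I_n.+2) (p : Pn n) : Pn n.+1 := (face_fun i p.1, p.2).

Lemma facep_linear n (i : 'I_n.+2) : linear (@facep n i).
Proof. by move=> a x y; rewrite /facep /= linearP. Qed.

HB.instance Definition _ n (i : 'I_n.+2) :=
  GRing.isLinear.Build RR (Pn n) (Pn n.+1) *:%R (@facep n i) (facep_linear i).

Definition verts n (t : RR^o) : seq (Pn n) := [seq (p, t) | p <- vertices n].

Lemma size_verts n t : size (verts n t) = n.+1.
Proof. by rewrite size_map size_vertices. Qed.

Lemma verts_in n t : 0 <= t <= 1 -> all_in (@prism n) (verts n t).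
Proof. by move=> t01 x /mapP[p /vertices_in pn ->]. Qed.

Lemma omit_verts n (i : 'I_n.+2) t :
  omit i (verts n.+1 t) = map (facep i) (verts n t).
Proof.
rewrite /omit /verts -map_take -map_drop -map_cat -/(omit i _) omit_vertices.
by rewrite -!map_comp.
Qed.

Lemma aff_verts n t (y : simplex n) : aff (verts n t) (val y) = (val y, t).
Proof.
have [y0 y1] := set_valP y.
have E' (i : 'I_n.+1) : nth 0 (verts n t) i = (nth 0 (vertices n) i, t).
  by rewrite (nth_map 0) ?size_vertices.
rewrite [LHS]surjective_pairing; congr (_, _).
  rewrite -[RHS]aff_vertices /aff.
  rewrite (big_morph (fun p : Pn n => p.1) (id1 := 0) (op1 := +%R)) //.
  by apply: eq_bigr => i _; rewrite E'.
rewrite /aff (big_morph (fun p : Pn n => p.2) (id1 := 0) (op1 := +%R)) //.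
under eq_bigr do rewrite E' /=.
by rewrite -scaler_suml y1 scale1r.
Qed.

Variables (T T' : topologicalType) (H : T * RR^o -> T').

Definition track n (s : simplex n -> T) (p : Pn n) : T' := H (ext s p.1, p.2).

(** The operator on singular chains defined by a formal chain [c] of the
    standard prism: it is natural in the simplex, and its commutation with the
    boundary is read off from the formal boundary of [c]. *)
Definition op n m (c : fchain (Pn n)) : chain T n -> chain T' m :=
  fglift (fun s : singular T n => realize (track s) m c).

HB.instance Definition _ n m c := GRing.Linear.on (@op n m c).

Lemma opU n m c (s : singular T n) :
  op m c << s >> = realize (track s) m c.
Proof. exact: fgliftU. Qed.

Lemma opB n m c d x : op m (c - d) x = @op n m c x - op m d x.
Proof.
apply: (@freeg_lin_ext _ _ (@op n m (c - d)) (@op n m c \- @op n m d)) => s _ /=.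
by rewrite !opU linearB.
Qed.

Lemma op0 n m x : @op n m 0 x = 0.
Proof. by rewrite -[0](subrr 0) opB subrr. Qed.

Variables (A : set T) (A' : set T').
Hypothesis HA : cts_on [set p : T * RR^o | A p.1 /\ 0 <= (p.2 : RR) <= 1] H.
Hypothesis HA' : forall x (t : RR), A x -> 0 <= t <= 1 -> A' (H (x, t)).

Lemma ext_in n (s : singular T n) y :
  (forall x, A (s x)) -> simplex n y -> A (ext s y).
Proof. by move=> sA yn; have := sA (simplex_pt yn); rewrite -extE. Qed.

Lemma track_cts n (s : singular T n) :
  (forall x, A (s x)) -> cts_on (@prism n) (track s).
Proof.
move=> sA; apply: (cts_on_comp _ HA) => [|p [p1 p2]]; last first.
  by split=> //; exact: ext_in.
apply: cts_on_pair; last exact: cts_on_snd.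
apply: (@cts_on_comp _ _ _ _ (simplex n) fst (ext s)); first exact: cts_on_fst.
  by apply: ext_cts; exact: sing_continuous.
by move=> p [].
Qed.

Lemma op_bd n m c x : carried A x -> in_dom (@prism n) m.+1 c ->
  sing_bd (op m.+1 c x) = op m (fbd c) x.
Proof.
move=> xA cD.
apply: (@freeg_lin_ext _ _ (@sing_bd T' m \o op m.+1 c) (op m (fbd c))).
move=> s /xA sA /=; rewrite !opU (@realize_bd _ _ _ (@prism n)) //.
  exact: prism_convex.
exact: track_cts.
Qed.

Lemma op_face n m c x : in_dom (@prism n) m c ->
  op m c (sing_bd x) =
  op m (\sum_(i < n.+2) (-1) ^+ i *: fcmap (facep i) c) x.
Proof.
move=> cD.
apply: (@freeg_lin_ext _ _ (op m c \o @sing_bd T n)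
  (op m (\sum_(i < n.+2) (-1) ^+ i *: fcmap (facep i) c))) => s _ /=.
rewrite opU sing_bdU !linear_sum; apply: eq_bigr => i _.
rewrite !linearZ /=; congr (_ *: _); rewrite opU realize_map.
apply: (realize_ext (D := @prism n) (@prism_convex n) _ cD) => p [p1 p2].
rewrite /track /=; congr (H (_, _)).
have -> : p.1 = val (simplex_pt p1) by [].
by rewrite extE /= -(extE s).
Qed.

Lemma carried_op n m c x : carried A x -> in_dom (@prism n) m c ->
  carried A' (op m c x).
Proof.
move=> xA cD; apply: (@supp_fglift _ _ _ (@carried _ A' m) _ _ _ _ xA).
  exact: carried_subspace.
move=> s sA; apply: (carried_realize (D := @prism n) (@prism_convex n) _ cD).
by move=> p [p1 p2]; apply: HA' => //; exact: ext_in.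
Qed.

(** The naturality of [C] with respect to the faces turns the alternating sum
    over the faces into the formal boundary. *)
Lemma face_sum n t (C : forall k, seq (Pn k) -> fchain (Pn k)) :
  (forall i : 'I_n.+2, fcmap (facep i) (C n (verts n t)) =
     C n.+1 (map (facep i) (verts n t))) ->
  \sum_(i < n.+2) (-1) ^+ i *: fcmap (facep i) (C n (verts n t)) =
  fglift (C n.+1) (fbd1 (verts n.+1 t)).
Proof.
move=> CL; rewrite fbd1_omit size_verts linear_sum; apply: eq_bigr => i _.
by rewrite linearZ /= fgliftU omit_verts CL.
Qed.

Section Homotopy.
Variables (phi psi : forall k, seq (Pn k) -> fchain (Pn k)).
Variable b : forall k, seq (Pn k) -> Pn k.
Hypothesis phi_size : forall k n s, size s = n -> fsize n (@phi k s).
Hypothesis psi_size : forall k n s, size s = n -> fsize n (@psi k s).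
Hypothesis phi_chain : forall k s, fbd (@phi k s) = fglift (@phi k) (fbd1 s).
Hypothesis psi_chain : forall k s, fbd (@psi k s) = fglift (@psi k) (fbd1 s).
Hypothesis phi_nil : forall k, @phi k [::] = psi [::].
Hypothesis phiL : forall k (i : 'I_k.+2) s,
  phi (map (facep i) s) = fcmap (facep i) (phi s).
Hypothesis psiL : forall k (i : 'I_k.+2) s,
  psi (map (facep i) s) = fcmap (facep i) (psi s).
Hypothesis bL : forall k (i : 'I_k.+2) s, (0 < size s)%N ->
  b (map (facep i) s) = facep i (b s).
Hypothesis phi_in : forall k s, all_in (@prism k) s ->
  supp (all_in (@prism k)) (phi s).
Hypothesis psi_in : forall k s, all_in (@prism k) s ->
  supp (all_in (@prism k)) (psi s).
Hypothesis b_in : forall k s, (0 < size s)%N -> all_in (@prism k) s ->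
  prism (b s).

Let ht k := fht (@phi k) (@psi k) (@b k).

Lemma ht_dom n : in_dom (@prism n) n.+1 (ht n.+1 (verts n 0)).
Proof.
have v0 : all_in (@prism n) (verts n 0) by apply: verts_in; rewrite lexx ler01.
move=> s sh; split.
  by apply: (fsize_fht (@phi_size n) (@psi_size n) _ sh); exact: size_verts.
exact: (fsupp_fht (@phi_in n) (@psi_in n) (@b_in n) (size_verts n 0) v0 sh).
Qed.

Lemma op_homotopy0 x : carried A x ->
  sing_bd (op 1 (ht 1 (verts 0 0)) x) =
  op 0 (phi (verts 0 0)) x - op 0 (psi (verts 0 0)) x.
Proof.
move=> xA; rewrite (op_bd xA (@ht_dom 0)) fht_chain ?size_verts //.
have z : fglift (@ht 0 0) (fbd1 (verts 0 0)) = 0.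
  by rewrite fglift_sum big1 // => s _; rewrite scaler0.
by rewrite !opB z op0 subr0.
Qed.

(** Any two natural chain maps of prisms that agree on the empty sequence are
    homotopic, by coning inside the convex prism. This serves twice: for
    homotopy invariance and for subdivision. *)
Lemma op_homotopy n x : carried A x ->
  sing_bd (op n.+2 (ht n.+2 (verts n.+1 0)) x) =
  op n.+1 (phi (verts n.+1 0)) x - op n.+1 (psi (verts n.+1 0)) x -
  op n.+1 (ht n.+1 (verts n 0)) (sing_bd x).
Proof.
move=> xA; rewrite (op_bd xA (@ht_dom n.+1)) fht_chain ?size_verts //.
rewrite !opB; congr (_ - _); rewrite (op_face _ (@ht_dom n)).
have nat i : fcmap (facep i) (ht n.+1 (verts n 0)) =
    ht n.+1 [seq facep i i0 | i0 <- verts n 0].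
  apply: fcmap_fht; [exact: phiL|exact: psiL|move=> t; exact: bL|].
  exact: size_verts.
by congr (op _ _ _); apply/esym/(@face_sum n 0 (fun k => @ht k n.+1) nat).
Qed.

End Homotopy.
End NaturalOperators.

(** * Homology with supports in a subset *)

Section Homology.

Notation Pn n := ('rV[RR]_n.+1 * RR^o)%type.

Definition cyc (T : topologicalType) (A : set T) n (c : chain T n) : Prop :=
  carried A c /\ sing_cycle c.

Definition bnd (T : topologicalType) (A : set T) n (c : chain T n) : Prop :=
  exists2 b : chain T n.+1, carried A b & sing_bd b = c.

(** Homology of a subset, computed by the singular chains of the ambient space
    that are carried by it. *)
Definition hdim (T : topologicalType) (A : set T) n d : Prop :=
  @qdim (chain T n) (@cyc T A n) (@bnd T A n) d.

Lemma homology_dimP (T : topologicalType) n d :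
  homology_dim T n d <-> hdim [set: T] n d.
Proof.
have cT k (c : chain T k) : carried setT c by move=> s _ x.
split=> -[e [eZ eg ef]]; exists e; split.
- by move=> k; split.
- by move=> c [_ /eg[a [b bE]]]; exists a, b.
- by move=> a [b _ bE]; apply: ef; exists b.
- by move=> k; case: (eZ k).
- by move=> c cZ; have [|a [b _ bE]] := eg c; [split|exists a, b].
- by move=> a [b bE]; apply: ef; exists b.
Qed.

Lemma cyc_subspace (T : topologicalType) (A : set T) n :
  @subspace_pred (chain T n) (@cyc T A n).
Proof.
split=> [|a x y [xA xZ] [yA yZ]].
  split; first exact: supp0.
  by case: n => //= n; rewrite linear0.
split; first by apply: suppD => //; exact: suppZ.
case: n x y xA xZ yA yZ => //= n x y _ xZ _ yZ.
by rewrite linearP /= xZ yZ scaler0 addr0.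
Qed.

Lemma bnd_subspace (T : topologicalType) (A : set T) n :
  @subspace_pred (chain T n) (@bnd T A n).
Proof.
split; first by exists 0; [exact: supp0 | rewrite linear0].
move=> a _ _ [x xA <-] [y yA <-]; exists (a *: x + y); last by rewrite linearP.
by apply: suppD => //; exact: suppZ.
Qed.

Lemma sing_bd_bd (T : topologicalType) n (c : chain T n.+2) :
  sing_bd (sing_bd c) = 0.
Proof.
have cT : carried setT c by move=> s _ x.
have HT : cts_on [set p : T * RR^o | setT p.1 /\ 0 <= (p.2 : RR) <= 1] fst.
  exact: cts_on_fst.
have vD m : all_in (@prism m) (verts m 0) by apply: verts_in; rewrite lexx ler01.
have dom m s : s \in dom (<< verts m 0 >> : fchain (Pn m)) -> size s = m.+1 /\ all_in (@prism m) s.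
  by rewrite domU1 inE => /eqP->; split; [exact: size_verts|exact: vD].
have opE m (x : chain T m) : op fst m << verts m 0 >> x = x.
  rewrite -[RHS]/(idfun x).
  apply: (@freeg_lin_ext _ _ (op fst m << verts m 0 >>) idfun) => s _ /=.
  rewrite opU realizeU [RHS]mks_sing; apply: eq_mks => y.
  by rewrite aff_verts /track /= extE.
rewrite -[in LHS](opE _ c) (op_bd HT cT); last exact: (@dom n.+2).
rewrite (op_bd HT cT).
  by rewrite fbd_fbd op0.
move=> s; rewrite fbdU => sb; split.
  exact: (fsize_fbd1 (size_verts n.+2 0) sb).
exact: (fsupp_fbd1 (vD n.+2) sb).
Qed.

Lemma bnd_cyc (T : topologicalType) (A : set T) n (c : chain T n) :
  bnd A c -> cyc A c.
Proof.
move=> [b bA bE]; split; first by rewrite -bE; exact: carried_bd.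
by case: n c b bA bE => //= n c b _ <-; exact: sing_bd_bd.
Qed.

(** * Homotopy invariance *)

Definition push (T T' : topologicalType) (f : T -> T') n :
    chain T n -> chain T' n :=
  fglift (fun s : singular T n => mks (f \o s)).

HB.instance Definition _ (T T' : topologicalType) (f : T -> T') n :=
  GRing.Linear.on (@push T T' f n).

Lemma pushU (T T' : topologicalType) (f : T -> T') n (s : singular T n) :
  push f << s >> = mks (f \o s).
Proof. exact: fgliftU. Qed.

Lemma cts_sing (T T' : topologicalType) (f : T -> T') (A : set T) n
    (s : singular T n) :
  cts_on A f -> (forall x, A (s x)) -> continuous (f \o s).
Proof.
by move=> fA sA; apply: cts_on_comp_cont fA sA; exact: sing_continuous.
Qed.

Lemma carried_push (T T' : topologicalType) (f : T -> T') (A : set T)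
    (A' : set T') n (x : chain T n) :
  (forall x, A x -> A' (f x)) -> carried A x -> carried A' (push f x).
Proof.
move=> fA; apply: (@supp_fglift _ _ _ (@carried _ A' n)).
  exact: carried_subspace.
by move=> s sA; apply: carried_mks => y; exact: fA.
Qed.

Lemma push_bd (T T' : topologicalType) (f : T -> T') (A : set T) n
    (x : chain T n.+1) :
  cts_on A f -> carried A x -> sing_bd (push f x) = push f (sing_bd x).
Proof.
move=> fA xA; apply: (@freeg_lin_ext _ _ (@sing_bd T' n \o @push T T' f n.+1)
  (@push T T' f n \o @sing_bd T n)) => s /xA sA /=.
rewrite pushU sing_bd_mks; last exact: cts_sing sA.
rewrite sing_bdU linear_sum; apply: eq_bigr => i _.
by rewrite linearZ /= pushU.
Qed.

Lemma push_comp (T T' T'' : topologicalType) (f : T -> T') (g : T' -> T'')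
    (A : set T) n (x : chain T n) :
  cts_on A f -> carried A x -> push g (push f x) = push (g \o f) x.
Proof.
move=> fA xA; apply: (@freeg_lin_ext _ _ (@push _ _ g n \o @push _ _ f n)
  (@push _ _ (g \o f) n)) => s /xA sA /=.
by rewrite !pushU (mksE (cts_sing fA sA)) pushU.
Qed.

Lemma push_id (T : topologicalType) (f : T -> T) (A : set T) n (x : chain T n) :
  (forall x, A x -> f x = x) -> carried A x -> push f x = x.
Proof.
move=> fA xA; apply: (@freeg_lin_ext _ _ (@push _ _ f n) idfun) => s /xA sA /=.
by rewrite pushU [RHS]mks_sing; apply: eq_mks => y /=; rewrite fA.
Qed.

Lemma push_cyc (T T' : topologicalType) (f : T -> T') (A : set T)
    (A' : set T') n (x : chain T n) :
  cts_on A f -> (forall x, A x -> A' (f x)) -> cyc A x -> cyc A' (push f x).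
Proof.
move=> fA fAA' [xA xZ]; split; first exact: carried_push xA.
case: n x xA xZ => //= n x xA xZ.
by rewrite (push_bd fA) // xZ linear0.
Qed.

Lemma push_bnd (T T' : topologicalType) (f : T -> T') (A : set T)
    (A' : set T') n (x : chain T n) :
  cts_on A f -> (forall x, A x -> A' (f x)) -> bnd A x -> bnd A' (push f x).
Proof.
move=> fA fAA' [b bA <-]; exists (push f b); first exact: carried_push bA.
exact: push_bd fA bA.
Qed.

Lemma op_verts (T T' : topologicalType) (H : T * RR^o -> T') (f : T -> T')
    (A : set T) (t : RR) n (x : chain T n) :
  (forall x, A x -> H (x, t) = f x) -> carried A x ->
  op H n << verts n t >> x = push f x.
Proof.
move=> Hf xA.
apply: (@freeg_lin_ext _ _ (op H n << verts n t >>) (@push _ _ f n)) => s /xA sA /=.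
rewrite opU realizeU pushU; apply: eq_mks => y.
by rewrite aff_verts /track /= extE Hf.
Qed.

(** The two ends of the prism over a simplex differ by the boundary of the prism
    and by the prism over the boundary. *)
Lemma homotopy_bnd (T T' : topologicalType) (H : T * RR^o -> T')
    (f g : T -> T') (A : set T) (A' : set T') n (x : chain T n) :
  cts_on [set p : T * RR^o | A p.1 /\ 0 <= (p.2 : RR) <= 1] H ->
  (forall x (t : RR), A x -> 0 <= t <= 1 -> A' (H (x, t))) ->
  (forall x, A x -> H (x, 0) = f x) -> (forall x, A x -> H (x, 1) = g x) ->
  cyc A x -> bnd A' (push g x - push f x).
Proof.
move=> HA HA' H0 H1 [xA xZ].
pose up k (p : Pn k) : Pn k := (p.1, 1).
pose phi k (s : seq (Pn k)) : fchain (Pn k) := << map (@up k) s >>.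
pose psi k (s : seq (Pn k)) : fchain (Pn k) := << s >>.
pose b k (s : seq (Pn k)) : Pn k := head 0 s.
have phi_size k m s : size s = m -> fsize m (phi k s).
  by move=> sm; apply: suppU; rewrite size_map.
have psi_size k m s : size s = m -> fsize m (psi k s).
  by move=> sm; apply: suppU.
have phi_chain k s : fbd (phi k s) = fglift (phi k) (fbd1 s).
  by rewrite fbdU -fcmap_fbd1.
have psi_chain k s : fbd (psi k s) = fglift (psi k) (fbd1 s).
  rewrite fbdU -[LHS]/(idfun _).
  apply: (@freeg_lin_ext _ _ idfun (fglift (psi k))) => t _ /=.
  by rewrite fgliftU.
have phi_nil k : phi k [::] = psi k [::] by [].
have phiL k (i : 'I_k.+2) s :
    phi _ (map (facep i) s) = fcmap (facep i) (phi _ s).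
  by rewrite /phi fcmapU -!map_comp.
have psiL k (i : 'I_k.+2) s :
    psi _ (map (facep i) s) = fcmap (facep i) (psi _ s).
  by rewrite /psi fcmapU.
have bL k (i : 'I_k.+2) s : (0 < size s)%N ->
    b _ (map (facep i) s) = facep i (b _ s) by case: s.
have phi_in k s : all_in (@prism k) s -> supp (all_in (@prism k)) (phi k s).
  move=> sD; apply: suppU => _ /mapP[p /sD [p1 p2] ->]; split=> //=.
  by rewrite ler01 lexx.
have psi_in k s : all_in (@prism k) s -> supp (all_in (@prism k)) (psi k s).
  by move=> sD; apply: suppU.
have b_in k s : (0 < size s)%N -> all_in (@prism k) s -> prism (b k s).
  by case: s => // p s _; apply; exact: mem_head.
have upE k : map (@up k) (verts k 0) = verts k 1 by rewrite -map_comp.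
have phiE : op H n (phi n (verts n 0)) x = push g x.
  by rewrite /phi upE (op_verts H1).
have psiE : op H n (psi n (verts n 0)) x = push f x by rewrite (op_verts H0).
exists (op H n.+1 (fht (phi n) (psi n) (b n) n.+1 (verts n 0)) x).
  apply: (carried_op HA' xA).
  exact: (ht_dom phi_size psi_size phi_in psi_in b_in).
rewrite -phiE -psiE; case: n x xA xZ phiE psiE => [|n] x xA xZ _ _.
  exact: (op_homotopy0 HA phi_size psi_size phi_chain psi_chain phi_nil
    phi_in psi_in b_in xA).
rewrite (op_homotopy HA phi_size psi_size phi_chain psi_chain phi_nil
    phiL psiL bL phi_in psi_in b_in xA).
by rewrite xZ linear0 subr0.
Qed.

Lemma hdim_equiv (T T' : topologicalType) (A : set T) (A' : set T')
    (f : T -> T') (g : T' -> T) (H : T * RR^o -> T) (H' : T' * RR^o -> T') n d :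
  cts_on A f -> cts_on A' g ->
  (forall x, A x -> A' (f x)) -> (forall x, A' x -> A (g x)) ->
  cts_on [set p : T * RR^o | A p.1 /\ 0 <= (p.2 : RR) <= 1] H ->
  (forall x (t : RR), A x -> 0 <= t <= 1 -> A (H (x, t))) ->
  (forall x, A x -> H (x, 0) = g (f x)) -> (forall x, A x -> H (x, 1) = x) ->
  cts_on [set p : T' * RR^o | A' p.1 /\ 0 <= (p.2 : RR) <= 1] H' ->
  (forall x (t : RR), A' x -> 0 <= t <= 1 -> A' (H' (x, t))) ->
  (forall x, A' x -> H' (x, 0) = f (g x)) -> (forall x, A' x -> H' (x, 1) = x) ->
  hdim A n d -> hdim A' n d.
Proof.
move=> fA gA' fAA' gAA' HA HAA H0 H1 HA' HAA' H0' H1'.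
apply: (@qdim_map _ _ _ _ _ _ (@push T T' f n)).
- exact: cyc_subspace.
- exact: bnd_subspace.
- exact: bnd_subspace.
- by move=> x; exact: push_cyc.
- by move=> x _; exact: push_bnd.
- move=> x xZ /(push_bnd gA' gAA').
  rewrite (push_comp _ fA); last by case: xZ.
  move=> bx; have := homotopy_bnd (f := g \o f) (g := idfun) HA HAA H0 H1 xZ.
  rewrite (@push_id _ idfun A) //; last by case: xZ.
  by move=> bx'; have := subspace_predD (bnd_subspace A n) bx' bx; rewrite subrK.
- move=> y yZ; exists (push g y); first exact: push_cyc yZ.
  rewrite /= (push_comp _ gA'); last by case: yZ.
  have := homotopy_bnd (f := f \o g) (g := idfun) HA' HAA' H0' H1' yZ.
  by rewrite (@push_id _ idfun A') //; case: yZ.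
Qed.

End Homology.

(** * Small chains *)

Section Small.

Notation Pn n := ('rV[RR]_n.+1 * RR^o)%type.
Variables (T : topologicalType) (A B : set T).

(** With respect to the cover by [A] and [B]. *)
Definition small n : chain T n -> Prop :=
  supp (fun s : singular T n => (forall x, A (s x)) \/ (forall x, B (s x))).

Lemma carried_smalll n (x : chain T n) : carried A x -> small x.
Proof. by apply: supp_impl => s; left. Qed.

Lemma carried_smallr n (x : chain T n) : carried B x -> small x.
Proof. by apply: supp_impl => s; right. Qed.

Lemma small_op n m c (x : chain T n) : small x -> in_dom (@prism n) m c ->
  small (op fst m c x).
Proof.
move=> xs cD; apply: (@supp_fglift _ _ _ (@small m) _ _ _ _ xs).
  exact: supp_subspace.
move=> s [sA|sB].
  apply: carried_smalll; rewrite -opU.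
  by apply: (@carried_op _ _ fst A A) cD => //; apply: suppU.
apply: carried_smallr; rewrite -opU.
by apply: (@carried_op _ _ fst B B) cD => //; apply: suppU.
Qed.

End Small.

Section Subdivision.

Notation Pn n := ('rV[RR]_n.+1 * RR^o)%type.
Variable T : topologicalType.

Let phi k (s : seq (Pn k)) : fchain (Pn k) :=
  fsd (@barycenter (Pn k)) (size s) s.
Let psi k (s : seq (Pn k)) : fchain (Pn k) := << s >>.
Let b k := @barycenter (Pn k).

Lemma barycenter_facep k (i : 'I_k.+2) (s : seq (Pn k)) :
  barycenter (map (facep i) s) = facep i (barycenter s).
Proof.
rewrite /barycenter size_map [RHS]linearZ; congr (_ *: _).
by rewrite big_map linear_sum.
Qed.

Let phi_size k n s : size s = n -> fsize n (@phi k s).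
Proof. by move=> <-; exact: fsize_fsd. Qed.

Let psi_size k n s : size s = n -> fsize n (@psi k s).
Proof. by move=> sn; apply: suppU. Qed.

Let phi_chain k s : fbd (@phi k s) = fglift (@phi k) (fbd1 s).
Proof.
rewrite /phi; case: s => [|p s]; first by rewrite /= fbdU /= linear0.
rewrite [size _]/= fsd_chain //; apply: eq_fglift_dom => t ts.
by rewrite (@fsize_fbd1 _ (size s) (p :: s) _ _ ts).
Qed.

Let psi_chain k s : fbd (@psi k s) = fglift (@psi k) (fbd1 s).
Proof.
rewrite fbdU -[LHS]/(idfun _).
by apply: (@freeg_lin_ext _ _ idfun (fglift (@psi k))) => t _ /=; rewrite fgliftU.
Qed.

Let phi_nil k : @phi k [::] = @psi k [::]. Proof. by []. Qed.

Let phiL k (i : 'I_k.+2) s :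
  @phi _ (map (facep i) s) = fcmap (facep i) (phi s).
Proof.
rewrite /phi size_map; apply/esym/fcmap_fsd => t; exact: barycenter_facep.
Qed.

Let psiL k (i : 'I_k.+2) s :
  @psi _ (map (facep i) s) = fcmap (facep i) (psi s).
Proof. by rewrite /psi fcmapU. Qed.

Let bL k (i : 'I_k.+2) s : (0 < size s)%N ->
  @b _ (map (facep i) s) = facep i (b s).
Proof. by move=> _; exact: barycenter_facep. Qed.

Let b_in k s : (0 < size s)%N -> all_in (@prism k) s -> prism (@b k s).
Proof. by move=> s0 sD; apply: convex_barycenter => //; exact: prism_convex. Qed.

Let phi_in k s : all_in (@prism k) s -> supp (all_in (@prism k)) (@phi k s).
Proof. by move=> sD; apply: fsupp_fsd => //; exact: b_in. Qed.

Let psi_in k s : all_in (@prism k) s -> supp (all_in (@prism k)) (@psi k s).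
Proof. by move=> sD; apply: suppU. Qed.

Let v_in n : all_in (@prism n) (verts n 0).
Proof. by apply: verts_in; rewrite lexx ler01. Qed.

Let fst_cts (A : set T) :
  cts_on [set p : T * RR^o | A p.1 /\ 0 <= (p.2 : RR) <= 1] fst.
Proof. exact: cts_on_fst. Qed.

Definition sd_chain n : fchain (Pn n) :=
  fsd (@barycenter (Pn n)) n.+1 (verts n 0).

Definition subdiv n : chain T n -> chain T n := op fst n (sd_chain n).

HB.instance Definition _ n := GRing.Linear.on (@subdiv n).

Lemma sd_dom n : in_dom (@prism n) n (sd_chain n).
Proof.
move=> s sd; split; first exact: (fsize_fsd (size_verts n 0) sd).
have := @phi_in n (verts n 0) (@v_in n).
by rewrite /phi size_verts => /(_ _ sd).
Qed.

Lemma subdiv_bd n (x : chain T n.+1) : sing_bd (subdiv x) = subdiv (sing_bd x).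
Proof.
have xT : carried setT x by move=> s _ y.
rewrite /subdiv (op_bd (@fst_cts setT) xT); last exact: sd_dom.
rewrite op_face; last exact: sd_dom.
rewrite [in LHS]/sd_chain fsd_chain ?size_verts //.
have nat (i : 'I_n.+2) : fcmap (facep i) (fsd (@b n) n.+1 (verts n 0)) =
    fsd (@b n.+1) n.+1 (map (facep i) (verts n 0)).
  by apply: fcmap_fsd => t; exact: barycenter_facep.
by congr (op _ _ _); apply/esym/(@face_sum n 0 (fun k => fsd (@b k) n.+1) nat).
Qed.

Lemma subdiv_cycle n (x : chain T n) : sing_cycle x -> sing_cycle (subdiv x).
Proof. by case: n x => //= n x x0; rewrite subdiv_bd x0 linear0. Qed.

Lemma small_subdiv (A B : set T) n (x : chain T n) :
  small A B x -> small A B (subdiv x).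
Proof. by move=> xs; apply: small_op => //; exact: sd_dom. Qed.

(** The homotopy between subdivision and the identity is a natural operator, so
    it keeps every simplex inside its own image and preserves smallness. *)
Lemma subdiv_homotopic (A B : set T) n (x : chain T n) :
  small A B x -> sing_cycle x ->
  exists2 c : chain T n.+1, small A B c & sing_bd c = subdiv x - x.
Proof.
move=> xs xZ; have xT : carried setT x by move=> s _ y.
exists (op fst n.+1 (fht (@phi n) (@psi n) (@b n) n.+1 (verts n 0)) x).
  apply: (small_op xs).
  exact: (ht_dom phi_size psi_size phi_in psi_in b_in).
have phiE : op fst n (phi (verts n 0)) x = subdiv x.
  by rewrite /phi size_verts.
have psiE : op fst n (psi (verts n 0)) x = x.
  by rewrite (op_verts (f := idfun) (A := setT)) // (@push_id _ _ setT).
rewrite -[X in _ = _ - X]psiE -phiE.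
case: n x xs xZ xT phiE psiE => [|n] x xs xZ xT _ psiE.
  exact: (op_homotopy0 (@fst_cts setT) phi_size psi_size phi_chain psi_chain
    phi_nil phi_in psi_in b_in xT).
rewrite (op_homotopy (@fst_cts setT) phi_size psi_size phi_chain psi_chain phi_nil
    phiL psiL bL phi_in psi_in b_in xT).
by rewrite xZ linear0 subr0.
Qed.

Lemma subdiv_iter_homotopic (A B : set T) k n (x : chain T n) :
  small A B x -> sing_cycle x ->
  exists2 c : chain T n.+1, small A B c & sing_bd c = iter k (@subdiv n) x - x.
Proof.
move=> xs xZ.
have [] : [/\ small A B (iter k (@subdiv n) x), sing_cycle (iter k (@subdiv n) x) &
    exists2 c : chain T n.+1, small A B c & sing_bd c = iter k (@subdiv n) x - x].
  elim: k => [|k [ys yZ [c cs cE]]] /=.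
    by split=> //; exists 0; [exact: supp0|rewrite linear0 subrr].
  split; [exact: small_subdiv|exact: subdiv_cycle|].
  have [d ds dE] := subdiv_homotopic ys yZ.
  exists (d + c); first exact: suppD.
  by rewrite linearD /= dE cE addrA subrK.
by move=> _ _ [c cs cE]; exists c.
Qed.

Definition affp (P : lmodType RR) n (v : seq P) (p : Pn n) : P := aff v p.1.

Lemma affp_linear (P : lmodType RR) n (v : seq P) : linear (@affp P n v).
Proof.
move=> a p q; rewrite /affp /aff scaler_sumr -big_split; apply: eq_bigr => i _.
by rewrite !mxE scalerDl scalerA.
Qed.

HB.instance Definition _ (P : lmodType RR) n (v : seq P) :=
  GRing.isLinear.Build RR (Pn n) P *:%R (@affp P n v) (affp_linear v).

(** Subdivision of an affine simplex is the affine realization of its formal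
    subdivision, so that iterated subdivisions can be measured by their formal
    mesh. *)
Lemma subdiv_realize m n (Phi : Pn m -> T) (c : fchain (Pn m)) :
  cts_on (@prism m) Phi -> in_dom (@prism m) n c ->
  subdiv (realize Phi n c) =
  realize Phi n (fglift (fsd (@barycenter (Pn m)) n.+1) c).
Proof.
move=> Phic cD.
apply: (@freeg_lin_ext _ _ (@subdiv n \o @realize _ _ Phi n)
  (@realize _ _ Phi n \o fglift (fsd (@barycenter (Pn m)) n.+1))).
move=> v /cD[vn vD]; rewrite -[LHS]/(subdiv (realize Phi n << v >>)).
rewrite -[RHS]/(realize Phi n (fglift (fsd (@barycenter (Pn m)) n.+1) << v >>)).
rewrite fgliftU realizeU.
have h := realize_cts (@prism_convex m) Phic vn vD.
rewrite (mksE h) /subdiv opU.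
have Lv : map (affp v) (verts n 0) = v.
  apply: (@eq_from_nth _ 0) => [|i]; rewrite size_map size_verts ?vn // => ni.
  rewrite (nth_map 0) ?size_verts // /verts (nth_map 0) ?size_vertices //.
  rewrite (nth_vertices (Ordinal ni)) /affp /aff (bigD1 (Ordinal ni)) //=.
  rewrite mxE !eqxx scale1r big1 ?addr0 // => j ji.
  by rewrite mxE (negPf ji) andbF scale0r.
have -> : fsd (@barycenter (Pn m)) n.+1 v = fcmap (affp v) (sd_chain n).
  rewrite /sd_chain (fcmap_fsd (b' := @barycenter (Pn m))) /= ?Lv // => t.
  rewrite /barycenter size_map [RHS]linearZ; congr (_ *: _).
  by rewrite big_map linear_sum.
rewrite realize_map; apply: (realize_ext (@prism_convex n) _ (@sd_dom n)).
move=> p [p1 p2]; rewrite /track /=.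
have -> : p.1 = val (simplex_pt p1) by [].
by rewrite extE.
Qed.

End Subdivision.

Section EventuallySmall.

Notation Pn n := ('rV[RR]_n.+1 * RR^o)%type.

Lemma mesh_exists (P : normedModType RR) (s : seq P) :
  exists2 d : RR, 0 <= d & mesh_le d s.
Proof.
exists (\sum_(x <- s) `|x| + \sum_(x <- s) `|x|); first by rewrite addr_ge0 ?sumr_ge0.
move=> x y xs ys; apply: le_trans (ler_normB _ _) _.
by apply: lerD; [rewrite (big_rem x xs)|rewrite (big_rem y ys)];
  rewrite /= lerDl sumr_ge0.
Qed.

Lemma shrink_lt n (d e : RR) : 0 < e ->
  exists k, (n%:R / n.+1%:R) ^+ k * d < e.
Proof.
move=> e0.
have q1 : `|n%:R / n.+1%:R : RR| < 1.
  rewrite ger0_norm ?divr_ge0 // ltr_pdivrMr ?ltr0Sn // mul1r ltr_nat.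
  exact: ltnSn.
have : (fun k => (n%:R / n.+1%:R) ^+ k * d : RR^o) @ \oo --> (0 * d : RR^o).
  by apply: cvgMl; exact: cvg_expr.
rewrite mul0r => /cvgrPdist_lt /(_ e e0) [k _ /(_ k)] /= => /(_ (leqnn k)).
by rewrite sub0r normrN => /(le_lt_trans (ler_norm _)); exists k.
Qed.

Variables (T : topologicalType) (W U V : set T).
Hypotheses (oU : open U) (oV : open V) (WUV : W `<=` U `|` V).

(** The mesh shrinks by a fixed factor at each step, until it is below a
    Lebesgue number of the cover. *)
Lemma simplex_eventually_small n (s : singular T n) : (forall x, W (s x)) ->
  exists k, small (W `&` U) (W `&` V) (iter k (@subdiv T n) << s >>).
Proof.
move=> sW.
pose Phi : Pn n -> T := track fst s.
have fc : cts_on [set p : T * RR^o | [set: T] p.1 /\ 0 <= (p.2 : RR) <= 1] fst.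
  exact: cts_on_fst.
have Phic : cts_on (@prism n) Phi by apply: (track_cts fc).
have v0 : all_in (@prism n) (verts n 0) by apply: verts_in; rewrite lexx ler01.
have vD : in_dom (@prism n) n << verts n 0 >>.
  by apply: suppU; split=> //; exact: size_verts.
have sE : << s >> = realize Phi n << verts n 0 >> :> chain T n.
  rewrite realizeU mks_sing; apply: eq_mks => y.
  by rewrite aff_verts /Phi /track /= extE.
pose S := fglift (fsd (@barycenter (Pn n)) n.+1).
have [d0 d0_ge0 d0v] := mesh_exists (verts n 0).
pose q : RR := n%:R / n.+1%:R.
have q0 : 0 <= q by rewrite divr_ge0.
have key k : [/\ in_dom (@prism n) n (iter k S << verts n 0 >>),
    supp (mesh_le (q ^+ k * d0)) (iter k S << verts n 0 >>) &
    iter k (@subdiv T n) << s >> = realize Phi n (iter k S << verts n 0 >>)].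
  elim: k => [|k [kD km kE]] /=.
    by split=> //; apply: suppU; rewrite expr0 mul1r.
  split.
  - apply: (@supp_fglift _ _ _ (in_dom (@prism n) n) _ _ _ _ kD).
      exact: supp_subspace.
    move=> t [tn tD] u ut; split; first exact: (fsize_fsd tn ut).
    apply: (fsupp_fsd _ tn tD ut) => w w0 wD.
    by apply: convex_barycenter => //; exact: prism_convex.
  - apply: (@supp_fglift _ _ (fun t => size t = n.+1 /\ mesh_le (q ^+ k * d0) t)
      (supp (mesh_le (q ^+ k.+1 * d0)))); first exact: supp_subspace.
    + move=> t [tn tm]; rewrite exprS -mulrA; apply: fsd_mesh => //.
      by rewrite mulr_ge0 // exprn_ge0.
    + by move=> t tk; split; [case: (kD _ tk)|exact: km].
  - by rewrite kE (subdiv_realize Phic kD).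
have [e e0 eP] := simplex_lebesgue (@sing_continuous _ _ s) oU oV
  (fun x => WUV (sW x)).
have [k ke] := shrink_lt n d0 e0.
exists k; have [kD km ->] := key k.
apply: (@supp_fglift _ _ (fun v => [/\ size v = n.+1, all_in (@prism n) v &
    mesh_le (q ^+ k * d0) v]) (@small _ _ _ n)); first exact: supp_subspace.
  move=> v [vn vDv vm].
  pose p0 := nth 0 v 0.
  have p0v : p0 \in v by rewrite mem_nth // vn.
  have [p1 _] := vDv _ p0v.
  pose C (p : Pn n) := `|p0 - p| <= q ^+ k * d0.
  have vC : all_in C v by move=> p pv; exact: vm.
  have near (x : simplex n) : [/\ simplex n (aff v (val x)).1,
      `|p0.1 - (aff v (val x)).1| < e & W (Phi (aff v (val x)))].
    have xn := set_valP x.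
    have [y1 y2] : prism (aff v (val x)).
      by apply: (aff_in _ vn vDv xn); exact: prism_convex.
    split=> //; last exact: ext_in sW y1.
    have : C (aff v (val x)) by apply: (aff_in _ vn vC xn); exact: convex_ball.
    move=> /le_lt_trans /(_ ke); apply: le_lt_trans.
    by rewrite [leRHS]prod_normE le_max lexx.
  have [pU|pV] := eP _ p1.
    apply: carried_smalll; apply: carried_mks => x.
    by have [xn xe xW] := near x; split=> //; exact: pU.
  apply: carried_smallr; apply: carried_mks => x.
  by have [xn xe xW] := near x; split=> //; exact: pV.
by move=> v vk; have [] := kD _ vk; split=> //; exact: km.
Qed.

Lemma iter_subdiv_lift k n (x : chain T n) :
  iter k (@subdiv T n) x =
  fglift (fun s : singular T n => iter k (@subdiv T n) << s >>) x.
Proof.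
elim: k => [|k IH] /=.
  rewrite -[LHS]/(idfun x).
  by apply: (@freeg_lin_ext _ _ idfun) => s _; rewrite /= fgliftU.
rewrite IH; apply: (@freeg_lin_ext _ _ (@subdiv T n \o fglift _)) => s _ /=.
by rewrite !fgliftU.
Qed.

Lemma eventually_small n (x : chain T n) : carried W x ->
  exists k, small (W `&` U) (W `&` V) (iter k (@subdiv T n) x).
Proof.
move=> xW.
have smallS k (y : chain T n) : small (W `&` U) (W `&` V) y ->
    small (W `&` U) (W `&` V) (iter k (@subdiv T n) y).
  by elim: k => //= k IH /IH; exact: small_subdiv.
have [k kP] : exists k, forall s, s \in dom x ->
    small (W `&` U) (W `&` V) (iter k (@subdiv T n) << s >>).
  have : forall s, s \in dom x -> forall y, W (s y) by [].
  elim: (dom x) => [|s l IH] lW; first by exists 0%N.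
  have [s' s'l|k kP] := IH.
    by apply: lW; rewrite inE s'l orbT.
  have [k' k'P] := simplex_eventually_small (lW s (mem_head _ _)).
  exists (k + k')%N => s'; rewrite inE => /orP[/eqP->|/kP s'k].
    by rewrite iterD; exact: smallS.
  by rewrite addnC iterD; exact: smallS.
exists k; rewrite iter_subdiv_lift.
apply: (@supp_fglift _ _ (fun s => s \in dom x) (@small _ _ _ n)) => //.
exact: supp_subspace.
Qed.

End EventuallySmall.

(** * Mayer-Vietoris and the Euler characteristic of a subset *)

Section DimensionUnique.

Lemma qdim_le (V : lmodType rat) (Z B : V -> Prop) d d' :
  subspace_pred B -> qdim Z B d -> qdim Z B d' -> (d <= d')%N.
Proof.
move=> sB [e [eZ _ ef]] [e' [_ eg' _]].
have /choice[a aP] : forall k, exists a : 'I_d' -> rat,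
    B (e k - \sum_j a j *: e' j) by move=> k; exact: eg'.
pose M : 'M[rat]_(d, d') := \matrix_(k, j) a k j.
suff /eqP <- : row_free M by exact: rank_leq_col.
apply/row_freeP; apply: contrapT => nfree.
have : kermx M != 0.
  apply: contra_notN nfree => /eqP k0; apply/row_freeP.
  by rewrite -kermx_eq0 k0.
move=> /rowV0Pn[u /sub_kermxP uM /eqP]; apply.
apply/rowP => k; rewrite [RHS]mxE.
apply: (ef (fun k => u 0 k)).
have -> : \sum_k u 0 k *: e k = \sum_k u 0 k *: (e k - \sum_j a k j *: e' j).
  have -> : \sum_k u 0 k *: (e k - \sum_j a k j *: e' j) =
      \sum_k u 0 k *: e k - \sum_k u 0 k *: \sum_j a k j *: e' j.
    by rewrite -sumrB; apply: eq_bigr => i _; rewrite scalerBr.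
  rewrite [X in _ - X](_ : _ = \sum_j (u *m M) 0 j *: e' j).
    by rewrite uM [X in _ - X]big1 ?subr0 // => j _; rewrite mxE scale0r.
  under eq_bigr do rewrite scaler_sumr.
  rewrite exchange_big /=; apply: eq_bigr => j _.
  rewrite mxE scaler_suml; apply: eq_bigr => i _.
  by rewrite mxE scalerA.
apply: subspace_pred_sum => // i _; apply: subspace_predZ => //; exact: aP.
Qed.

Lemma qdim_unique (V : lmodType rat) (Z B : V -> Prop) d d' :
  subspace_pred B -> qdim Z B d -> qdim Z B d' -> d = d'.
Proof.
move=> sB dd dd'; apply/eqP; rewrite eqn_leq.
by rewrite (qdim_le sB dd dd') (qdim_le sB dd' dd).
Qed.

Definition antidiag (V : zmodType) (x : V) : V * V := (x, - x).

Lemma antidiag_linear (R : ringType) (V : lmodType R) : linear (@antidiag V).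
Proof. by move=> a x y; rewrite /antidiag opprD -scalerN. Qed.

HB.instance Definition _ (R : ringType) (V : lmodType R) :=
  GRing.isLinear.Build R V (V * V)%type *:%R (@antidiag V)
    (@antidiag_linear R V).

Definition addpair (V : zmodType) (x : V * V) : V := x.1 + x.2.

Lemma addpair_linear (R : ringType) (V : lmodType R) : linear (@addpair V).
Proof. by move=> a x y; rewrite /addpair /= scalerDr addrACA. Qed.

HB.instance Definition _ (R : ringType) (V : lmodType R) :=
  GRing.isLinear.Build R (V * V)%type V *:%R (@addpair V)
    (@addpair_linear R V).

End DimensionUnique.

Section MayerVietoris.
Variables (T : topologicalType) (W U V : set T).
Hypotheses (oU : open U) (oV : open V) (WUV : W `<=` U `|` V).
Let A := W `&` U.
Let B := W `&` V.
Let C := A `&` B.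

Definition part n : chain T n -> chain T n :=
  fglift (fun s : singular T n =>
    if pselect (forall x, A (s x)) then << s >> else 0).

HB.instance Definition _ n := GRing.Linear.on (@part n).

Lemma partU n (s : singular T n) :
  part << s >> = if pselect (forall x, A (s x)) then << s >> else 0.
Proof. exact: fgliftU. Qed.

Lemma carried_part n (x : chain T n) : carried A (part x).
Proof.
have xT : supp (fun=> True) x by [].
apply: (@supp_fglift _ _ _ (@carried _ A n) _ _ _ _ xT).
  exact: carried_subspace.
move=> s _; case: pselect => [sA|nA]; [by apply: suppU|exact: supp0].
Qed.

Lemma part_id n (x : chain T n) : carried A x -> part x = x.
Proof.
move=> xA; rewrite -[RHS]/(idfun x).
apply: (@freeg_lin_ext _ _ (@part n) idfun) => s /xA sA.
by rewrite /= partU; case: pselect.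
Qed.

Lemma carried_subpart n (x : chain T n) : small A B x -> carried B (x - part x).
Proof.
move=> xs.
have -> : x - part x =
    fglift (fun s : singular T n => << s >> - part << s >>) x.
  apply: (@freeg_lin_ext _ _ (idfun \- @part n)) => s _.
  by rewrite /= fgliftU.
apply: (@supp_fglift _ _ _ (@carried _ B n) _ _ _ _ xs).
  exact: carried_subspace.
move=> s sAB; rewrite partU; case: pselect => sA.
  by rewrite subrr; exact: supp0.
by rewrite subr0; case: sAB => // sB; apply: suppU.
Qed.

Lemma carried_setI n (x : chain T n) : carried A x -> carried B x -> carried C x.
Proof. by move=> xA xB s sx y; split; [exact: xA|exact: xB]. Qed.

Lemma carried_partI n (x : chain T n) : carried B x -> carried C (part x).
Proof.
move=> xB; apply: (@supp_fglift _ _ _ (@carried _ C n) _ _ _ _ xB).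
  exact: carried_subspace.
move=> s sB; case: pselect => [sA|nA]; last exact: supp0.
by apply: suppU => y; split.
Qed.

Lemma carriedIA n (x : chain T n) : carried C x -> carried A x.
Proof. by apply: carried_sub => y []. Qed.

Lemma carriedIB n (x : chain T n) : carried C x -> carried B x.
Proof. by apply: carried_sub => y []. Qed.

Let ZE n (x : chain T n) := small A B x /\ sing_cycle x.
Let BE n (x : chain T n) :=
  exists2 b : chain T n.+1, small A B b & sing_bd b = x.

Lemma sing_cycleD n (x y : chain T n) :
  sing_cycle x -> sing_cycle y -> sing_cycle (x + y).
Proof. by case: n x y => //= n x y x0 y0; rewrite linearD /= x0 y0 addr0. Qed.

Lemma sing_cycleZ n a (x : chain T n) : sing_cycle x -> sing_cycle (a *: x).
Proof. by case: n x => //= n x x0; rewrite linearZ /= x0 scaler0. Qed.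

Lemma sing_cycleN n (x : chain T n) : sing_cycle x -> sing_cycle (- x).
Proof. by case: n x => //= n x x0; rewrite linearN /= x0 oppr0. Qed.

Lemma sing_cycle_bd n (x : chain T n.+1) : sing_cycle (sing_bd x).
Proof. by case: n x => //= n x; exact: sing_bd_bd. Qed.

Lemma sing_cycle0 n : sing_cycle (0 : chain T n).
Proof. by case: n => //= n; rewrite linear0. Qed.

Lemma ZE_subspace n : @subspace_pred (chain T n) (@ZE n).
Proof.
split=> [|a x y [xs xZ] [ys yZ]].
  by split; [exact: supp0|exact: sing_cycle0].
split; first by apply: suppD => //; exact: suppZ.
by apply: sing_cycleD => //; exact: sing_cycleZ.
Qed.

Lemma BE_subspace n : @subspace_pred (chain T n) (@BE n).
Proof.
split; first by exists 0; [exact: supp0 | rewrite linear0].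
move=> a _ _ [x xA <-] [y yA <-]; exists (a *: x + y); last by rewrite linearP.
by apply: suppD => //; exact: suppZ.
Qed.

(** A cycle is homologous to its iterated subdivisions, and these are eventually
    small; the same applies to the chain that it bounds. *)
Lemma hdim_small n d : @qdim (chain T n) (@ZE n) (@BE n) d -> hdim W n d.
Proof.
have smallW k (x : chain T k) : small A B x -> carried W x.
  by apply: supp_impl => s [sA|sB] y; [case: (sA y)|case: (sB y)].
have WS k (x : chain T k) : carried W x -> small W W x.
  exact: carried_smalll.
have SW k (x : chain T k) : small W W x -> carried W x.
  by apply: supp_impl => s [].
apply: (@qdim_map _ _ _ _ _ _ idfun).
- exact: ZE_subspace.
- exact: BE_subspace.
- exact: bnd_subspace.
- by move=> x [xs xZ]; split=> //; exact: smallW.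
- by move=> x _ [b bs bE]; exists b => //; exact: smallW.
- move=> x [xs xZ] [b bW /= bx].
  have [k bk] := eventually_small oU oV WUV bW.
  have [c cs cE] := subdiv_iter_homotopic k xs xZ.
  have bE : forall k, sing_bd (iter k (@subdiv T n.+1) b) =
      iter k (@subdiv T n) (sing_bd b).
    by elim=> //= j IH; rewrite subdiv_bd IH.
  exists (iter k (@subdiv T n.+1) b - c); first exact: suppB.
  by rewrite linearB /= cE bE bx opprB addrCA subrr addr0.
- move=> y [yW yZ]; have [k yk] := eventually_small oU oV WUV yW.
  have [c cs cE] := subdiv_iter_homotopic k (WS _ _ yW) yZ.
  exists (iter k (@subdiv T n) y).
    split=> //; elim: k {yk c cs cE} => //= k IH; exact: subdiv_cycle.
  exists (- c); last by rewrite linearN /= cE opprB.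
  by apply: suppN; exact: SW.
Qed.

Let N n (z : chain T n) := [/\ cyc C z, bnd A z & bnd B z].
Let ZD n (x : chain T n * chain T n) := cyc A x.1 /\ cyc B x.2.
Let BD n (x : chain T n * chain T n) := bnd A x.1 /\ bnd B x.2.
Let M n (x : chain T n * chain T n) :=
  exists2 z, cyc C z & bnd A (x.1 - z) /\ bnd B (x.2 + z).
Let K n (x : chain T n) := exists a b, [/\ cyc A a, cyc B b & x = a + b].

Lemma N_subspace n : @subspace_pred (chain T n) (@N n).
Proof.
have [c0 cD] := cyc_subspace C n; have [a0 aD] := bnd_subspace A n.
have [b0 bD] := bnd_subspace B n.
split=> [//|a x y [x1 x2 x3] [y1 y2 y3]].
by split; [exact: cD|exact: aD|exact: bD].
Qed.

Lemma ZD_subspace n : @subspace_pred (chain T n * chain T n)%type (@ZD n).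
Proof.
have [c0 cD] := cyc_subspace A n; have [a0 aD] := cyc_subspace B n.
split=> [//|a x y [x1 x2] [y1 y2]].
by split; [exact: cD|exact: aD].
Qed.

Lemma BD_subspace n : @subspace_pred (chain T n * chain T n)%type (@BD n).
Proof.
have [c0 cD] := bnd_subspace A n; have [a0 aD] := bnd_subspace B n.
split=> [//|a x y [x1 x2] [y1 y2]].
by split; [exact: cD|exact: aD].
Qed.

Lemma M_subspace n : @subspace_pred (chain T n * chain T n)%type (@M n).
Proof.
have [c0 cD] := cyc_subspace C n; have [a0 aD] := bnd_subspace A n.
have [b0 bD] := bnd_subspace B n.
split=> [|a x y [z zC [x1 x2]] [w wC [y1 y2]]].
  by exists 0 => //=; rewrite subr0 addr0.
exists (a *: z + w); first exact: cD.
split=> /=.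
  by have := aD a _ _ x1 y1; rewrite scalerBr addrACA -opprD.
by have := bD a _ _ x2 y2; rewrite scalerDr addrACA.
Qed.

Lemma K_subspace n : @subspace_pred (chain T n) (@K n).
Proof.
have [c0 cD] := cyc_subspace A n; have [a0 aD] := cyc_subspace B n.
split; first by exists 0, 0; split=> //; rewrite addr0.
move=> a _ _ [x1 [x2 [h1 h2 ->]]] [y1 [y2 [h3 h4 ->]]].
exists (a *: x1 + y1), (a *: x2 + y2); split; [exact: cD|exact: aD|].
by rewrite scalerDr addrACA.
Qed.

Lemma cycIA n (z : chain T n) : cyc C z -> cyc A z.
Proof. by move=> [zC zZ]; split=> //; exact: carriedIA. Qed.

Lemma cycIB n (z : chain T n) : cyc C z -> cyc B z.
Proof. by move=> [zC zZ]; split=> //; exact: carriedIB. Qed.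

Lemma BE_K n (x : chain T n) : BE x -> K x.
Proof.
move=> [b bs <-]; exists (sing_bd (part b)), (sing_bd (b - part b)); split.
- split; [exact: (carried_bd (@carried_part _ b))|exact: sing_cycle_bd].
- split; [exact: (carried_bd (carried_subpart bs))|exact: sing_cycle_bd].
- by rewrite linearB /= addrC subrK.
Qed.

Lemma K_ZE n (x : chain T n) : K x -> ZE x.
Proof.
move=> [a [b [[aA aZ] [bB bZ] ->]]]; split; last exact: sing_cycleD.
by apply: suppD; [exact: carried_smalll|exact: carried_smallr].
Qed.

(** [K] consists of the sums of a cycle of [A] and a cycle of [B], modulo
    boundaries; the kernel of the sum map is spanned by the antidiagonal image
    of the cycles of [C]. *)
Lemma qdim_K n d : @qdim (chain T n * chain T n)%type (@ZD n) (@M n) d ->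
  @qdim (chain T n) (@K n) (@BE n) d.
Proof.
apply: (@qdim_map _ _ _ _ _ _ (@addpair (chain T n))).
- exact: ZD_subspace.
- exact: M_subspace.
- exact: BE_subspace.
- by move=> [a b] [/= aA bB]; exists a, b.
- move=> [x y] _ [z zC /= [[a aA aE] [b bB bE]]]; exists (a + b).
    by apply: suppD; [exact: carried_smalll|exact: carried_smallr].
  by rewrite linearD /= aE bE /addpair /= addrACA addNr addr0.
- move=> [x y] [/= [xA xZ] [yB yZ]] [e es eE].
  have sE : x - sing_bd (part e) = sing_bd (e - part e) - y.
    by rewrite linearB /= eE /addpair /= addrAC addrK.
  exists (x - sing_bd (part e)).
    split; last by apply: sing_cycleD => //; apply/sing_cycleN/sing_cycle_bd.
    apply: carried_setI.
      by apply: suppB => //; exact: (carried_bd (@carried_part _ e)).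
    by rewrite sE; apply: suppB => //; exact: (carried_bd (carried_subpart es)).
  split; rewrite /=.
    by exists (part e); [exact: carried_part|rewrite opprB addrC subrK].
  exists (e - part e); first exact: carried_subpart.
  by rewrite sE [RHS]addrC subrK.
- move=> _ [a [b [aA bB ->]]]; exists (a, b) => //.
  by rewrite /addpair subrr; case: (BE_subspace n).
Qed.

(** The inverse of the connecting map: a cycle of [C] that bounds in both [A]
    and [B] is sent to the difference of the two bounding chains. *)
Lemma qdim_ZE n d : @qdim (chain T n) (@N n) (@bnd T C n) d ->
  @qdim (chain T n.+1) (@ZE n.+1) (@K n.+1) d.
Proof.
apply: (@qdim_comap _ _ _ _ _ _ (@sing_bd T n \o @part n.+1)).
- exact: ZE_subspace.
- exact: K_subspace.
- exact: bnd_subspace.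
- move=> x [xs xZ] /=.
  have xE : sing_bd (part x) = sing_bd (- (x - part x)).
    by rewrite opprB linearB /= xZ subr0.
  have pA : carried A (part x) by exact: carried_part.
  have pB : carried B (- (x - part x)) by exact: (suppN (carried_subpart xs)).
  split.
  + split; last exact: sing_cycle_bd.
    by apply: carried_setI; [|rewrite xE]; exact: carried_bd.
  + by exists (part x).
  + by exists (- (x - part x)).
- move=> _ _ [a [b [[aA aZ] [bB bZ] ->]]] /=; exists (part b).
    exact: carried_partI.
  by rewrite !linearD /= (part_id aA) (aZ : sing_bd a = 0) add0r.
- move=> x [xs xZ] [w wC wE] /=.
  exists (part x - w), (x - part x + w).
  have aZ : sing_bd (part x - w) = 0 by rewrite linearB /= wE subrr.
  split; [split=> // | split=> // |].
  + by apply: suppB; [exact: carried_part|exact: carriedIA].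
  + by apply: suppD; [exact: carried_subpart|exact: carriedIB].
  + by rewrite /= linearD linearB /= xZ wE sub0r addNr.
  + by rewrite [RHS]addrC -addrA [w + _]addrC !subrK.
- move=> y [[yC yZ] [a aA aE] [b bB bE]].
  exists (a - b).
    split; last by rewrite /= linearB /= aE bE subrr.
    by apply: suppB; [exact: carried_smalll|exact: carried_smallr].
  exists (part b); first exact: carried_partI.
  rewrite /= [part (a - b)]linearB [sing_bd (_ - _)]linearB /= (part_id aA) aE.
  by rewrite opprB [RHS]addrC subrK.
Qed.

Lemma qdim_ZE0 : @qdim (chain T 0) (@ZE 0) (@K 0) 0.
Proof.
apply: qdim_eq0 => x [xs _]; exists (part x), (x - part x); split.
- by split=> //; exact: carried_part.
- by split=> //; exact: carried_subpart.
- by rewrite addrC subrK.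
Qed.

Lemma qdim_M n d : @qdim (chain T n) (@cyc T C n) (@N n) d ->
  @qdim (chain T n * chain T n)%type (@M n) (@BD n) d.
Proof.
apply: (@qdim_map _ _ _ _ _ _ (@antidiag (chain T n))).
- exact: cyc_subspace.
- exact: N_subspace.
- exact: BD_subspace.
- move=> z zC; exists z => //=; rewrite subrr addNr.
  by split; [case: (bnd_subspace A n)|case: (bnd_subspace B n)].
- move=> z _ [_ zA zB]; split=> //=.
  exact: (subspace_predN (bnd_subspace B n)).
- move=> z zC [/= zA zB]; split=> //.
  by rewrite -[z]opprK; exact: (subspace_predN (bnd_subspace B n)).
- by move=> [x y] [z zC [/= xz yz]]; exists z => //; split=> //=; rewrite opprK.
Qed.

(** The long exact sequence in numerical form: [r n] and [k n] are the rank and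
    the nullity of the map from the homology of the intersection to the sum of
    the homologies of the two parts, and [m n] is the dimension of its cokernel.
    *)
Lemma mayer_vietoris (a b c : nat -> nat) :
  (forall n, hdim A n (a n)) -> (forall n, hdim B n (b n)) ->
  (forall n, hdim C n (c n)) ->
  exists r k m : nat -> nat,
    [/\ forall n, (c n = r n + k n)%N, forall n, (a n + b n = m n + r n)%N
      & forall n, hdim W n (if n is n'.+1 then k n' + m n else m n)%N].
Proof.
move=> aH bH cH.
have /choice[f fP] : forall n, exists f : nat * nat * nat,
   [/\ @qdim (chain T n) (@cyc T C n) (@N n) f.1.1,
       @qdim (chain T n) (@N n) (@bnd T C n) f.1.2,
       (f.1.1 + f.1.2 = c n)%N,
       @qdim (chain T n * chain T n)%type (@ZD n) (@M n) f.2
     & (a n + b n = f.2 + f.1.1)%N].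
  move=> n.
  have [r [k [hr hk rk]]] : exists p q, [/\ @qdim (chain T n) (@cyc T C n) (@N n) p,
      @qdim (chain T n) (@N n) (@bnd T C n) q & (p + q = c n)%N].
    apply: qdim_split (cH n).
    - exact: cyc_subspace.
    - exact: N_subspace.
    - exact: bnd_subspace.
    - by move=> x [].
    - move=> x xC; have [bC bE] := xC; split; first exact: bnd_cyc.
        by exists bC => //; exact: carriedIA.
      by exists bC => //; exact: carriedIB.
  have [m [r' [hm hr' mr]]] : exists p q,
      [/\ @qdim (chain T n * chain T n)%type (@ZD n) (@M n) p,
          @qdim (chain T n * chain T n)%type (@M n) (@BD n) q
        & (p + q = a n + b n)%N].
    apply: (@qdim_split _ (@ZD n) (@M n) (@BD n)).
    - exact: ZD_subspace.
    - exact: M_subspace.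
    - exact: BD_subspace.
    - move=> [x y] [z zC [/= /bnd_cyc xz /bnd_cyc yz]]; split=> /=.
        rewrite -[x](subrK z); apply: (subspace_predD (cyc_subspace A n)) => //.
        exact: cycIA.
      rewrite -[y](addrK z); apply: (subspace_predB (cyc_subspace B n)) => //.
      exact: cycIB.
    - move=> [x y] [/= xA yB]; exists 0; first by case: (cyc_subspace C n).
      by rewrite /= subr0 addr0.
    - apply: qdim_prod (aH n) (bH n).
      + exact: bnd_subspace.
      + exact: bnd_subspace.
      + exact: cyc_subspace.
      + exact: cyc_subspace.
  exists (r, k, m); split=> //=; rewrite -mr; congr (_ + _)%N.
  exact: (qdim_unique (@BD_subspace n) hr' (qdim_M hr)).
exists (fun n => (f n).1.1), (fun n => (f n).1.2), (fun n => (f n).2); split.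
- by move=> n; case: (fP n).
- by move=> n; case: (fP n).
- move=> n; have [_ _ _ hm _] := fP n.
  apply: hdim_small.
  have hK := qdim_K hm.
  case: n hm hK => [|n] hm hK.
    have := qdim_add (@ZE_subspace 0) (@K_subspace 0) (@BE_subspace 0)
      (@K_ZE 0) (@BE_K 0) qdim_ZE0 hK.
    by rewrite add0n.
  have [_ hk _ _ _] := fP n.
  exact: (qdim_add (@ZE_subspace n.+1) (@K_subspace n.+1) (@BE_subspace n.+1)
      (@K_ZE n.+1) (@BE_K n.+1) (qdim_ZE hk) hK).
Qed.

End MayerVietoris.

Section EulerCharacteristic.

(** The Euler characteristic of a subset, in the sense of homology with
    supports. *)
Definition chi (T : topologicalType) (A : set T) (e : int) : Prop :=
  exists (N : nat) (b : nat -> nat),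
    [/\ forall n, hdim A n (b n), forall n, (N <= n)%N -> b n = 0%N
      & e = \sum_(n < N) (-1) ^+ n * (b n)%:Z].

Lemma euler_characteristicP (T : topologicalType) e :
  chi [set: T] e -> euler_characteristic T e.
Proof.
move=> [N [b [bH b0 ->]]]; exists N, b; split=> // n.
exact/homology_dimP.
Qed.

Lemma alt_sum_widen (N M : nat) (b : nat -> nat) :
  (forall n, (N <= n)%N -> b n = 0%N) -> (N <= M)%N ->
  \sum_(n < M) (-1) ^+ n * (b n)%:Z = \sum_(n < N) (-1) ^+ n * (b n)%:Z.
Proof.
move=> b0 NM; rewrite -(subnKC NM) big_split_ord /= [X in _ + X]big1 ?addr0 //.
by move=> i _; rewrite b0 ?leq_addr // mulr0.
Qed.

(** The ranks of the Mayer-Vietoris sequence cancel in the alternating sum. *)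
Lemma chi_union (T : topologicalType) (W U V : set T) a b c :
  open U -> open V -> W `<=` U `|` V ->
  chi (W `&` U) a -> chi (W `&` V) b -> chi (W `&` U `&` (W `&` V)) c ->
  chi W (a + b - c).
Proof.
move=> oU oV WUV [N1 [f1 [h1 z1 ->]]] [N2 [f2 [h2 z2 ->]]] [N3 [f3 [h3 z3 ->]]].
have [r [k [m [cE abE hW]]]] := mayer_vietoris oU oV WUV h1 h2 h3.
pose N := maxn N1 (maxn N2 N3).
have n1 : (N1 <= N)%N by rewrite /N; lia.
have n2 : (N2 <= N)%N by rewrite /N; lia.
have n3 : (N3 <= N)%N by rewrite /N; lia.
rewrite -(alt_sum_widen z1 n1) -(alt_sum_widen z2 n2) -(alt_sum_widen z3 n3).
have rk0 n : (N <= n)%N -> r n = 0%N /\ k n = 0%N.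
  move=> Nn; have := cE n; rewrite z3; last exact: leq_trans Nn.
  by move=> /esym/eqP; rewrite addn_eq0 => /andP[/eqP-> /eqP->].
have m0 n : (N <= n)%N -> m n = 0%N.
  move=> Nn; have := abE n; rewrite z1 ?z2; try exact: leq_trans Nn.
  by move=> /esym/eqP; rewrite addn_eq0 => /andP[/eqP->].
exists N.+1, (fun n => if n is n'.+1 then k n' + m n else m n)%N; split=> //.
  by case=> // n Nn; rewrite m0 ?(proj2 (rk0 n _)) // ltnW.
have -> : \sum_(n < N.+1) (-1) ^+ n *
      (if nat_of_ord n is n'.+1 then k n' + m n else m n)%N%:Z =
    \sum_(n < N) (-1) ^+ n * (m n)%:Z - \sum_(n < N) (-1) ^+ n * (k n)%:Z.
  have mE : \sum_(n < N) (-1) ^+ n * (m n)%:Z = \sum_(n < N.+1) (-1) ^+ n * (m n)%:Z.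
    by rewrite big_ord_recr /= m0 // mulr0 addr0.
  rewrite mE !big_ord_recl /= -addrA -sumrB; congr (_ + _).
  apply: eq_bigr => i _; rewrite exprS PoszD; ring.
rewrite -sumrB -big_split -sumrB /=; apply: eq_bigr => n _.
by have := abE n; have := cE n => -> abn; rewrite -!mulrDr -!mulrBr; congr (_ * _); lia.
Qed.

Lemma eq_chi (T : topologicalType) (A : set T) a b : a = b -> chi A a -> chi A b.
Proof. by move->. Qed.

Lemma chi_set0 (T : topologicalType) : chi (set0 : set T) 0.
Proof.
exists 0%N, (fun _ => 0%N); split=> //; last by rewrite big_ord0.
move=> n; apply: qdim_eq0 => x [x0 _].
have -> : x = 0.
  apply/eqP; rewrite -dom_eq0; apply/eqP.
  case E : (dom x) => [//|s l]; have := x0 s; rewrite E mem_head => /(_ isT).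
  by move=> /(_ (simplex_pt (simplex_vertex ord0))).
by case: (bnd_subspace (set0 : set T) n).
Qed.

Section Point.
Variables (T : topologicalType) (x0 : T).

Let ct n : continuous (fun _ : simplex n => x0).
Proof. exact: cst_continuous. Qed.

Definition const_sing n : singular T n := Singular (@ct n).

Lemma carried_pointP n (c : chain T n) :
  carried [set x0] c <-> exists a, c = a *: << const_sing n >>.
Proof.
split=> [cx|[a ->]]; last by apply: suppZ; apply: suppU.
exists (\sum_(s <- dom c) coeff s c).
rewrite -{1}(freeg_sumE c) scaler_suml !big_seq; apply: eq_bigr => s sc.
have -> : s = const_sing n.
  have /funext fE : sing_fun s =1 fun=> x0 by move=> y; exact: cx.
  case: s sc fE => f fc sc /= fE; subst f; congr Singular.
  exact: Prop_irrelevance.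
apply/eqP/freeg_eqP => y.
by rewrite coeffZ !coeffU mul1r.
Qed.

Lemma const_bd n :
  sing_bd (<< const_sing n.+1 >> : chain T n.+1) =
  (odd n)%:R *: (<< const_sing n >> : chain T n).
Proof.
rewrite sing_bdU.
have -> : \sum_(i < n.+2) (-1) ^+ i *: (<< sing_face i (const_sing n.+1) >> : chain T n) =
    (\sum_(i < n.+2) (-1) ^+ i) *: (<< const_sing n >> : chain T n).
  rewrite scaler_suml; apply: eq_bigr => i _; congr (_ *: _).
  by rewrite !mks_sing; apply: eq_mks.
congr (_ *: _).
have key m : \sum_(i < m) (-1) ^+ i = (odd m)%:R :> rat.
  elim: m => [|m IH]; first by rewrite big_ord0.
  by rewrite big_ord_recr /= IH -signr_odd; case: odd; rewrite ?expr0 ?expr1 ?add0r ?subrr.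
by rewrite key /= negbK.
Qed.

Lemma const_inj n a : a *: (<< const_sing n >> : chain T n) = 0 -> a = 0.
Proof.
move=> /(congr1 (coeff (const_sing n))).
by rewrite coeffZ coeffU eqxx coeff0 !mulr1.
Qed.

Lemma chi_point : chi [set x0] 1.
Proof.
exists 1%N, (fun n => if n is 0 then 1%N else 0%N); split=> //; last first.
- by rewrite big_ord1 expr0 mul1r.
- by case.
case=> [|n].
  exists (fun _ => << const_sing 0 >>); split.
  - by move=> _; split=> //; apply: suppU.
  - move=> c [/carried_pointP[a ->] _]; exists (fun _ => a).
    by rewrite big_ord1 subrr; case: (bnd_subspace [set x0] 0).
  - move=> a [_ /carried_pointP[b ->]]; rewrite big_ord1 linearZ /= const_bd.
    by rewrite scale0r scaler0 => /esym/const_inj a0 k; rewrite ord1.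
apply: qdim_eq0 => _ [/carried_pointP[a ->]] /=.
rewrite linearZ /= const_bd scalerA => /const_inj.
have [no|ne] := boolP (odd n).
  rewrite mulr1 => ->; rewrite scale0r.
  by case: (bnd_subspace [set x0] n.+1).
move=> _; exists (a *: << const_sing n.+2 >>).
  by apply/carried_pointP; exists a.
by rewrite linearZ /= const_bd /= ne scale1r.
Qed.

End Point.

Definition hequiv (T T' : topologicalType) (A : set T) (A' : set T') : Prop :=
  exists (f : T -> T') (g : T' -> T) (H : T * RR^o -> T) (H' : T' * RR^o -> T'),
  [/\ cts_on A f /\ (forall x, A x -> A' (f x)),
      cts_on A' g /\ (forall x, A' x -> A (g x)),
      [/\ cts_on [set p : T * RR^o | A p.1 /\ 0 <= (p.2 : RR) <= 1] H,
          (forall x (t : RR), A x -> 0 <= t <= 1 -> A (H (x, t))),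
          (forall x, A x -> H (x, 0) = g (f x)) &
          (forall x, A x -> H (x, 1) = x)] &
      [/\ cts_on [set p : T' * RR^o | A' p.1 /\ 0 <= (p.2 : RR) <= 1] H',
          (forall x (t : RR), A' x -> 0 <= t <= 1 -> A' (H' (x, t))),
          (forall x, A' x -> H' (x, 0) = f (g x)) &
          (forall x, A' x -> H' (x, 1) = x)]].

Lemma chi_hequiv (T T' : topologicalType) (A : set T) (A' : set T') e :
  hequiv A A' -> chi A e -> chi A' e.
Proof.
move=> [f [g [H [H' [[f1 f2] [g1 g2] [h1 h2 h3 h4] [k1 k2 k3 k4]]]]]].
move=> [N [b [bH b0 bE]]]; exists N, b; split=> // n.
exact: (hdim_equiv f1 g1 f2 g2 h1 h2 h3 h4 k1 k2 k3 k4).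
Qed.

Definition homeo (T T' : topologicalType) (A : set T) (A' : set T') : Prop :=
  exists (f : T -> T') (g : T' -> T),
  [/\ cts_on A f /\ (forall x, A x -> A' (f x)),
      cts_on A' g /\ (forall x, A' x -> A (g x)),
      forall x, A x -> g (f x) = x & forall x, A' x -> f (g x) = x].

Lemma homeo_hequiv (T T' : topologicalType) (A : set T) (A' : set T') :
  homeo A A' -> hequiv A A'.
Proof.
move=> [f [g [[f1 f2] [g1 g2] gf fg]]]; exists f, g, fst, fst; split=> //.
  by split=> //; [exact: cts_on_fst|move=> x Ax; rewrite gf].
by split=> //; [exact: cts_on_fst|move=> x Ax; rewrite fg].
Qed.

Lemma hequiv_prod (T1 T2 T : topologicalType) (K1 : set T1) (K2 : set T2)
    (Y : set T) : hequiv K1 K2 -> hequiv (Y `*` K1) (Y `*` K2).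
Proof.
move=> [f [g [H [H' [[f1 f2] [g1 g2] [h1 h2 h3 h4] [k1 k2 k3 k4]]]]]].
have sndc (S1 S2 : topologicalType) (K : set S1) (q : S1 -> S2) :
    cts_on K q -> cts_on (Y `*` K) (fun p : T * S1 => (p.1, q p.2)).
  move=> qc; apply: cts_on_pair; first exact: cts_on_fst.
  by apply: (@cts_on_comp _ _ _ _ K snd q) => //; [exact: cts_on_snd|move=> p []].
have Hc (S1 : topologicalType) (K : set S1) (q : S1 * RR^o -> S1) :
    cts_on [set p : S1 * RR^o | K p.1 /\ 0 <= (p.2 : RR) <= 1] q ->
    cts_on [set p : (T * S1) * RR^o | (Y `*` K) p.1 /\ 0 <= (p.2 : RR) <= 1]
      (fun p => (p.1.1, q (p.1.2, p.2))).
  move=> qc; apply: cts_on_pair.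
    exact: (cts_on_comp (@cts_on_fst _ _ _) (@cts_on_fst _ _ setT)).
  apply: (@cts_on_comp _ _ _ _ _ (fun p : (T * S1) * RR^o => (p.1.2, p.2)) q _ qc).
    apply: cts_on_pair; last exact: cts_on_snd.
    exact: (cts_on_comp (@cts_on_fst _ _ _) (@cts_on_snd _ _ setT)).
  by move=> p [[]].
exists (fun p => (p.1, f p.2)), (fun p => (p.1, g p.2)),
  (fun p => (p.1.1, H (p.1.2, p.2))), (fun p => (p.1.1, H' (p.1.2, p.2))); split.
- by split; [exact: sndc|move=> [y k] [Yy Kk]; split=> //; exact: f2].
- by split; [exact: sndc|move=> [y k] [Yy Kk]; split=> //; exact: g2].
- split; first exact: Hc.
  + by move=> [y k] t [Yy Kk] t01; split=> //; exact: h2.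
  + by move=> [y k] [Yy Kk] /=; rewrite h3.
  + by move=> [y k] [Yy Kk] /=; rewrite h4.
- split; first exact: Hc.
  + by move=> [y k] t [Yy Kk] t01; split=> //; exact: k2.
  + by move=> [y k] [Yy Kk] /=; rewrite k3.
  + by move=> [y k] [Yy Kk] /=; rewrite k4.
Qed.

(** [K] has Euler characteristic [c], multiplicatively in products. Unlike a
    Kuenneth formula, this form is inherited by unions directly from
    Mayer-Vietoris. *)
Definition mul_chi (T' : topologicalType) (K : set T') (c : int) : Prop :=
  forall (T : topologicalType) (Y : set T) y, chi Y y -> chi (Y `*` K) (y * c).

Lemma mul_chi_hequiv (T1 T2 : topologicalType) (K1 : set T1) (K2 : set T2) c :
  hequiv K1 K2 -> mul_chi K1 c -> mul_chi K2 c.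
Proof.
by move=> K12 Kc T Y y Yy; apply: chi_hequiv (Kc _ _ _ Yy); exact: hequiv_prod.
Qed.

Lemma mul_chi_homeo (T1 T2 : topologicalType) (K1 : set T1) (K2 : set T2) c :
  homeo K1 K2 -> mul_chi K1 c -> mul_chi K2 c.
Proof. by move=> /homeo_hequiv; exact: mul_chi_hequiv. Qed.

Lemma mul_chi_set0 (T' : topologicalType) : mul_chi (set0 : set T') 0.
Proof. by move=> T Y y _; rewrite mulr0 setX0; exact: chi_set0. Qed.

Lemma mul_chi_point (T' : topologicalType) (k : T') : mul_chi [set k] 1.
Proof.
move=> T Y y Yy; rewrite mulr1; apply: chi_hequiv Yy; apply: homeo_hequiv.
exists (fun y => (y, k)), fst; split=> //.
- split=> //; apply: cts_on_pair; last exact: cts_on_cst.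
  by apply: cts_on_continuous => x; exact: cvg_id.
- by split; [exact: cts_on_fst|move=> p []].
- by move=> [p q] [_ /= ->].
Qed.

Lemma mul_chi_union (T' : topologicalType) (K U V : set T') a b c :
  open U -> open V -> K `<=` U `|` V ->
  mul_chi (K `&` U) a -> mul_chi (K `&` V) b ->
  mul_chi (K `&` U `&` (K `&` V)) c -> mul_chi K (a + b - c).
Proof.
move=> oU oV KUV Ka Kb Kc T Y y Yy.
have sE (O : set T') : (Y `*` K) `&` (snd @^-1` O) = Y `*` (K `&` O).
  apply/seteqP; split=> p; first by move=> [[h1 h2] h3]; split=> //; split.
  by move=> [h1 [h2 h3]]; split=> //; split.
have oE (O : set T') : open O -> open (@snd T T' @^-1` O).
  by move=> oO; apply: open_comp => // p _; exact: cvg_snd.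
rewrite mulrBr mulrDr.
apply: (@chi_union _ _ (snd @^-1` U) (snd @^-1` V)).
- exact: oE.
- exact: oE.
- by move=> p [_ /KUV].
- by rewrite sE; exact: Ka.
- by rewrite sE; exact: Kb.
- rewrite !sE; have := Kc _ _ _ Yy; congr chi.
  apply/seteqP; split=> p.
    by move=> [h1 [[h2 h3] [h4 h5]]]; split; split.
  by move=> [[h1 [h2 h3]] [_ [h4 h5]]]; split=> //; split; split.
Qed.

End EulerCharacteristic.

(** * Euler characteristics of the factors *)

Section ComplexContinuity.
Variables (T : topologicalType) (A : set T).
Implicit Types f g : T -> CC^o.

Lemma cts_onD f g : cts_on A f -> cts_on A g -> cts_on A (fun x => f x + g x : CC^o).
Proof. by move=> fA gA x Ax; apply: cvgD; [exact: fA|exact: gA]. Qed.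

Lemma cts_onN f : cts_on A f -> cts_on A (fun x => - f x : CC^o).
Proof. by move=> fA x Ax; apply: cvgN; exact: fA. Qed.

Lemma cts_onM f g : cts_on A f -> cts_on A g -> cts_on A (fun x => f x * g x : CC^o).
Proof. by move=> fA gA x Ax; apply: cvgM; [exact: fA|exact: gA]. Qed.

Lemma cts_onV f : cts_on A f -> (forall x, A x -> f x != 0) ->
  cts_on A (fun x => (f x)^-1 : CC^o).
Proof. by move=> fA f0 x Ax; apply: cvgV; [exact: f0|exact: fA]. Qed.

Lemma real_complex_continuous : continuous (fun t : RR^o => (t%:C)%C : CC^o).
Proof.
move=> t U /nbhs_ballP[e /= e0 eU].
have [er ei] : e = (complex.Re e)%:C%C /\ 0 < complex.Re e.
  by move: e0; case: (e) => a b; rewrite ltcE /= => /andP[/eqP -> ->].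
apply/nbhs_ballP; exists (complex.Re e) => //= s; rewrite /ball /= => st.
apply: eU; rewrite /ball /= er -rmorphB /= normc_def /= expr0n /= addr0.
by rewrite sqrtr_sqr ltcR.
Qed.

Lemma Re_continuous : continuous (fun z : CC^o => complex.Re z : RR^o).
Proof.
move=> z U /nbhs_ballP[e /= e0 eU].
apply/nbhs_ballP; exists (e%:C)%C; first by rewrite /= ltcR.
move=> w; rewrite /ball /= => zw; apply: eU; rewrite /ball /=.
rewrite -ltcR; apply: le_lt_trans zw.
have -> : complex.Re z - complex.Re w = complex.Re (z - w) by case: (z) (w) => [a b] [c d].
exact: normc_ge_Re.
Qed.

Lemma Im_continuous : continuous (fun z : CC^o => complex.Im z : RR^o).
Proof.
have -> : (fun z : CC^o => complex.Im z : RR^o) = (fun z => complex.Re (- 'i%C * z)).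
  by apply/funext => -[a b] /=; ring.
move=> z; apply: (@continuous_comp _ _ _ (fun z : CC^o => - 'i%C * z : CC^o)).
  exact: mulrl_continuous.
exact: Re_continuous.
Qed.

End ComplexContinuity.

Section Factors.

Lemma ReN (z : CC) : complex.Re (- z) = - complex.Re z. Proof. by case: z. Qed.
Lemma ImN (z : CC) : complex.Im (- z) = - complex.Im z. Proof. by case: z. Qed.

Lemma neq0_ReIm (z : CC) :
  (z != 0) = (complex.Re z != 0) || (complex.Im z != 0).
Proof. by rewrite eq_complex negb_and. Qed.

(** The plane without the closed negative half line: it is star-shaped around
    [1], and with its opposite it covers the punctured plane. *)
Definition slit : set CC^o := [set z | 0 < complex.Re z \/ complex.Im z != 0].

Definition upper : set CC^o := [set z | 0 < complex.Im z].

Lemma cts_on_cid (A : set CC^o) : cts_on A (fun z => z : CC^o).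
Proof. by apply: cts_on_continuous => z; exact: cvg_id. Qed.

Lemma open_Re_gt : open [set z : CC^o | 0 < complex.Re z].
Proof.
apply: (@open_comp _ _ (fun z : CC^o => complex.Re z : RR^o) [set t | 0 < t]).
  by move=> z _; exact: Re_continuous.
exact: open_gt.
Qed.

Lemma open_Im_gt : open upper.
Proof.
apply: (@open_comp _ _ (fun z : CC^o => complex.Im z : RR^o) [set t | 0 < t]).
  by move=> z _; exact: Im_continuous.
exact: open_gt.
Qed.

Lemma open_opp (U : set CC^o) : open U -> open [set z : CC^o | U (- z)].
Proof.
move=> oU; apply: (@open_comp _ _ (fun z : CC^o => - z : CC^o) U) => // z _.
exact: opp_continuous.
Qed.

Lemma open_slit : open slit.
Proof.
have -> : slit = [set z | 0 < complex.Re z] `|` (upper `|` [set z | upper (- z)]).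
  apply/seteqP; split=> z; rewrite /slit /upper /= ImN oppr_gt0.
    move=> [|b0]; [by left|right].
    by have := lt_total b0 => /orP[]; [right|left].
  move=> [|[b0|b0]]; [by left|right|right]; first by rewrite gt_eqF.
  by rewrite lt_eqF.
apply: openU; first exact: open_Re_gt.
by apply: openU; [exact: open_Im_gt|apply: open_opp; exact: open_Im_gt].
Qed.

Lemma segment_gt0 (t a : RR) : 0 <= t <= 1 -> 0 < a -> 0 < 1 - t + t * a.
Proof.
move=> /andP[t0 t1] a0; have [->|tn1] := eqVneq t 1.
  by rewrite subrr add0r mul1r.
by rewrite ltr_wpDr ?mulr_ge0 ?(ltW a0) // subr_gt0 lt_neqAle tn1.
Qed.

(** A segment starting at [1] stays in the slit plane if its end does. *)
Lemma slit_segment (w : CC) (t : RR) : 0 <= t <= 1 ->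
  slit (1 + w) -> slit (1 + (t%:C)%C * w).
Proof.
have ReE (s : RR) : complex.Re (1 + (s%:C)%C * w) = 1 + s * complex.Re w.
  by case: (w) => a b /=; ring.
have ImE (s : RR) : complex.Im (1 + (s%:C)%C * w) = s * complex.Im w.
  by case: (w) => a b /=; ring.
have := ReE 1; have := ImE 1; rewrite !mul1r => Im1 Re1 t01.
rewrite /slit /= ReE ImE Im1 Re1 => -[a0|b0].
  by left; have := segment_gt0 t01 a0; rewrite mulrDr mulr1 addrA subrK.
have [->|tn0] := eqVneq t 0; first by left; rewrite mul0r addr0 ltr01.
by right; rewrite mulf_neq0.
Qed.

Lemma eq_mul_chi (T' : topologicalType) (K : set T') a b :
  a = b -> mul_chi K a -> mul_chi K b.
Proof. by move->. Qed.

(** A set that contracts to one of its points. *)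
Lemma mul_chi_star (T' : topologicalType) (K : set T') (k0 : T')
    (H : T' * RR^o -> T') :
  K k0 ->
  cts_on [set p : T' * RR^o | K p.1 /\ 0 <= (p.2 : RR) <= 1] H ->
  (forall x (t : RR), K x -> 0 <= t <= 1 -> K (H (x, t))) ->
  (forall x, K x -> H (x, 0) = k0) -> (forall x, K x -> H (x, 1) = x) ->
  mul_chi K 1.
Proof.
move=> K0 Hc HK H0 H1; apply: mul_chi_hequiv (mul_chi_point k0).
exists (fun=> k0), (fun=> k0), fst, H; split.
- by split=> //; exact: cts_on_cst.
- by split=> //; exact: cts_on_cst.
- by split=> //; exact: cts_on_fst.
- by split.
Qed.

Lemma cts_time (S : topologicalType) (A : set (S * RR^o)) :
  cts_on A (fun p => ((p.2 : RR)%:C)%C : CC^o).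
Proof.
apply: (cts_on_comp (@cts_on_snd _ _ _) (B := setT)) => //.
by apply: cts_on_continuous; exact: real_complex_continuous.
Qed.

Lemma mul_chi_slit : mul_chi slit 1.
Proof.
apply: (@mul_chi_star _ slit (1 : CC^o)
  (fun p : CC^o * RR^o => 1 + (p.2%:C)%C * (p.1 - 1) : CC^o)).
- by left; rewrite /= ltr01.
- apply: cts_onD; first exact: cts_on_cst.
  apply: cts_onM; first exact: cts_time.
  by apply: cts_onD; [exact: cts_on_fst|exact: cts_on_cst].
- move=> x t xs t01; apply: slit_segment => //; by rewrite addrC subrK.
- by move=> x _ /=; rewrite mul0r addr0.
- by move=> x _ /=; rewrite mul1r addrC subrK.
Qed.

Lemma mul_chi_upper : mul_chi upper 1.
Proof.
apply: (@mul_chi_star _ upper ('i%C : CC^o)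
  (fun p : CC^o * RR^o => 'i%C + (p.2%:C)%C * (p.1 - 'i%C) : CC^o)).
- by rewrite /upper /= ltr01.
- apply: cts_onD; first exact: cts_on_cst.
  apply: cts_onM; first exact: cts_time.
  by apply: cts_onD; [exact: cts_on_fst|exact: cts_on_cst].
- move=> z t; rewrite /upper /= => b0 t01.
  have -> : complex.Im ('i%C + (t%:C)%C * (z - 'i%C)) = 1 - t + t * complex.Im z.
    by case: (z) => a b /=; ring.
  exact: segment_gt0.
- by move=> x _ /=; rewrite mul0r addr0.
- by move=> x _ /=; rewrite mul1r addrC subrK.
Qed.

Lemma homeo_opp (A : set CC^o) : homeo A [set z : CC^o | A (- z)].
Proof.
exists (fun z => - z), (fun z => - z); split.
- by split=> [|x Ax]; [apply: cts_onN; exact: cts_on_cid|rewrite /= opprK].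
- by split=> [|x Ax] //; apply: cts_onN; exact: cts_on_cid.
- by move=> x _; rewrite opprK.
- by move=> x _; rewrite opprK.
Qed.

Definition punctured : set CC^o := [set z | z != 0].

Lemma punctured_slit : punctured `<=` slit `|` [set z | slit (- z)].
Proof.
move=> z; rewrite /punctured /= neq0_ReIm => z0.
have [b0|b0] := eqVneq (complex.Im z) 0; last by left; right.
move: z0; rewrite b0 eqxx orbF => a0; have := lt_total a0.
by move=> /orP[a0'|a0']; [right|left]; left; rewrite /= ?ReN ?oppr_gt0.
Qed.

Lemma slit_punctured : slit `<=` punctured.
Proof.
move=> z; rewrite /slit /punctured /= neq0_ReIm.
by move=> [a0|->]; rewrite ?orbT // gt_eqF.
Qed.

Lemma open_punctured : open punctured.
Proof.
have -> : punctured = slit `|` [set z | slit (- z)].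
  apply/seteqP; split; first exact: punctured_slit.
  by move=> z [/slit_punctured//|/slit_punctured]; rewrite /punctured /= oppr_eq0.
by apply: openU; [|apply: open_opp]; exact: open_slit.
Qed.

(** The punctured plane is covered by two opposite slit planes, which meet in
    two half planes: [1 + 1 - (1 + 1)]. *)
Lemma mul_chi_punctured : mul_chi punctured 0.
Proof.
have nslit := mul_chi_homeo (homeo_opp slit) mul_chi_slit.
have nupper := mul_chi_homeo (homeo_opp upper) mul_chi_upper.
pose I := [set z : CC^o | complex.Im z != 0].
have IE : I `<=` upper `|` [set z | upper (- z)].
  move=> z /= b0; have := lt_total b0; rewrite /upper /setU /= ImN oppr_gt0.
  by move=> /orP[]; [right|left].
have I2 : mul_chi I 2.
  apply: (@eq_mul_chi _ _ (1 + 1 - 0)) => //.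
  apply: (mul_chi_union open_Im_gt (open_opp open_Im_gt) IE).
  - suff -> : I `&` upper = upper by exact: mul_chi_upper.
    by apply/seteqP; split=> [z []//|[a b] b0]; split=> //; rewrite /I /= gt_eqF.
  - suff -> : I `&` [set z | upper (- z)] = [set z | upper (- z)] by [].
    apply/seteqP; split=> [z []//|[a b] b0]; split=> //.
    by move: b0; rewrite /I /upper /= oppr_gt0 => b0; rewrite lt_eqF.
  - rewrite [X in mul_chi X _](_ : _ = set0); first exact: mul_chi_set0.
    apply/seteqP; split=> // -[a b] [[_ b0] [_]] /=.
    by move: b0; rewrite /upper /= oppr_gt0 => b0 b0'; have := lt_trans b0 b0'; rewrite ltxx.
apply: (@eq_mul_chi _ _ (1 + 1 - 2)) => //.
apply: (mul_chi_union open_slit (open_opp open_slit) punctured_slit).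
- suff -> : punctured `&` slit = slit by exact: mul_chi_slit.
  by apply/seteqP; split=> [z []//|z zs]; split=> //; exact: slit_punctured.
- suff -> : punctured `&` [set z | slit (- z)] = [set z | slit (- z)] by [].
  apply/seteqP; split=> [z []//|z zs]; split=> //.
  by have := slit_punctured zs; rewrite /punctured /= oppr_eq0.
- rewrite [X in mul_chi X _](_ : _ = I) //.
  apply/seteqP; split=> -[a b].
    move=> [[_ h1] [_]] /=; move: h1; rewrite /slit /I /= oppr_eq0.
    by move=> [a0|//] [|//]; rewrite oppr_gt0 => a0'; have := lt_trans a0 a0'; rewrite ltxx.
  move=> b0; have sl : slit (Complex a b) by right.
  split; split=> //; [exact: slit_punctured|exact: slit_punctured|].
  by right; rewrite /= oppr_eq0.
Qed.

Lemma mul_chi_prod (T1 T2 : topologicalType) (K1 : set T1) (K2 : set T2) a b :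
  mul_chi K1 a -> mul_chi K2 b -> mul_chi (K1 `*` K2) (a * b).
Proof.
move=> h1 h2 T Y y Yy; rewrite mulrA.
apply: chi_hequiv (h2 _ _ _ (h1 _ _ _ Yy)); apply: homeo_hequiv.
have f1 (S1 S2 : topologicalType) (A : set (S1 * S2)) := @cts_on_fst S1 S2 A.
have f2 (S1 S2 : topologicalType) (A : set (S1 * S2)) := @cts_on_snd S1 S2 A.
exists (fun p => (p.1.1, (p.1.2, p.2))), (fun p => ((p.1, p.2.1), p.2.2)); split.
- split; last by move=> [[u v] w] [[/= ? ?] ?].
  apply: cts_on_pair; first exact: (cts_on_comp (f1 _ _ _) (f1 _ _ setT)).
  by apply: cts_on_pair => //; exact: (cts_on_comp (f1 _ _ _) (f2 _ _ setT)).
- split; last by move=> [u [v w]] [/= ? [? ?]].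
  apply: cts_on_pair; last exact: (cts_on_comp (f2 _ _ _) (f2 _ _ setT)).
  by apply: cts_on_pair => //; exact: (cts_on_comp (f2 _ _ _) (f1 _ _ setT)).
- by move=> [[]].
- by move=> [u []].
Qed.

Notation F := (CC^o * CC^o)%type.

Definition Bset : set F := [set p | 1 + p.1 * p.2 != 0].
Definition Bopen : set F := [set p | p.2 != 0 /\ 1 + p.1 * p.2 != 0].

Lemma cts_on_moment (A : set F) : cts_on A (fun p => 1 + p.1 * p.2 : CC^o).
Proof.
apply: cts_onD; first exact: cts_on_cst.
by apply: cts_onM; [exact: cts_on_fst|exact: cts_on_snd].
Qed.

(** The coordinates are [y] and [1 + x y]. *)
Lemma homeo_Bopen (K : set CC^o) : (forall u, K u -> u != 0) ->
  homeo (punctured `*` K) [set p : F | p.2 != 0 /\ K (1 + p.1 * p.2)].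
Proof.
move=> K0.
exists (fun p : F => ((p.2 - 1) / p.1, p.1)), (fun p : F => (p.2, 1 + p.1 * p.2)).
split.
- split.
    apply: cts_on_pair; last exact: cts_on_fst.
    apply: cts_onM.
      by apply: cts_onD; [exact: cts_on_snd|exact: cts_on_cst].
    by apply: cts_onV; [exact: cts_on_fst|move=> p []].
  by move=> [y u] [/= y0 uK]; split=> //=; rewrite divfK // addrC subrK.
- split; last by move=> [x y] [/= y0 uK]; split.
  by apply: cts_on_pair; [exact: cts_on_snd|exact: cts_on_moment].
- by move=> [y u] [/= y0 uK]; rewrite divfK // addrC subrK.
- by move=> [x y] [/= y0 uK]; rewrite addrAC subrr add0r mulfK.
Qed.

Lemma mul_chi_Bopen : mul_chi Bopen 0.
Proof.
apply: (mul_chi_homeo (homeo_Bopen (K := punctured) (fun u => id))).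
by apply: (@eq_mul_chi _ _ (0 * 0)) => //; apply: mul_chi_prod; exact: mul_chi_punctured.
Qed.

(** [Bset] is the union of the locus where the moment lies in the slit plane,
    which is star-shaped, and of [Bopen]; they meet in a product with a
    punctured plane, so the total is [1 + 0 - 0]. *)
Lemma mul_chi_Bset : mul_chi Bset 1.
Proof.
pose U := [set p : F | slit (1 + p.1 * p.2)].
pose V := [set p : F | p.2 != 0].
have slit0 u : slit u -> u != 0 by exact: slit_punctured.
have oU : open U.
  apply: (@open_comp _ _ (fun p : F => 1 + p.1 * p.2 : CC^o) slit).
    by move=> p _; have /cts_on_setT := @cts_on_moment setT; apply.
  exact: open_slit.
have oV : open V.
  apply: (@open_comp _ _ (fun p : F => p.2) punctured).
    by move=> p _; exact: cvg_snd.
  exact: open_punctured.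
have BUV : Bset `<=` U `|` V.
  move=> [x y] _; have [y0|y0] := eqVneq y 0; last by right.
  by left; rewrite /U /= y0 mulr0 addr0; left; rewrite /= ltr01.
apply: (@eq_mul_chi _ _ (1 + 0 - 0)) => //.
apply: (mul_chi_union oU oV BUV).
- have -> : Bset `&` U = U.
    by apply/seteqP; split=> [p []//|p pU]; split=> //; exact: slit0.
  apply: (@mul_chi_star _ U (0 : CC^o, 0 : CC^o)
    (fun p : F * RR^o => ((p.2%:C)%C * p.1.1 : CC^o, (p.2%:C)%C * p.1.2 : CC^o))).
  + by rewrite /U /= mulr0 addr0; left; rewrite /= ltr01.
  + apply: cts_on_pair; apply: cts_onM.
    * exact: cts_time.
    * exact: (cts_on_comp (@cts_on_fst _ _ _) (@cts_on_fst _ _ setT)).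
    * exact: cts_time.
    * exact: (cts_on_comp (@cts_on_fst _ _ _) (@cts_on_snd _ _ setT)).
  + move=> [x y] t xU /andP[t0 t1]; rewrite /U /= mulrACA -rmorphM.
    apply: slit_segment => //.
    by rewrite mulr_ge0 //= mulr_ile1.
  + by move=> [x y] _ /=; rewrite !mul0r.
  + by move=> [x y] _ /=; rewrite !mul1r.
- suff -> : Bset `&` V = Bopen by exact: mul_chi_Bopen.
  by apply/seteqP; split=> p [].
- have -> : Bset `&` U `&` (Bset `&` V) = [set p : F | p.2 != 0 /\ slit (1 + p.1 * p.2)].
    apply/seteqP; split=> p; first by move=> [[_ h] [_ h']].
    by move=> [h h']; split; split=> //; exact: slit0.
  apply: (mul_chi_homeo (homeo_Bopen slit0)).
  apply: (@eq_mul_chi _ _ (0 * 1)) => //.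
  by apply: mul_chi_prod; [exact: mul_chi_punctured|exact: mul_chi_slit].
Qed.

End Factors.

(** * Products of subsets *)
Section ProductSets.
Variables (S : topologicalType) (n : nat).

Lemma row_coord_continuous (i : 'I_n) : continuous (fun w : 'rV[S]_n => w 0 i).
Proof.
move=> w U /= wU; exists (fun k j => if j == i then U else setT).
  by move=> k j; rewrite ord1; case: eqP => [->|_] //; exact: filterT.
by move=> v /(_ 0 i); rewrite eqxx.
Qed.

Lemma cts_on_row (T : topologicalType) (A : set T) (f : T -> 'rV[S]_n) :
  (forall i, cts_on A (fun x => f x 0 i)) -> cts_on A f.
Proof.
move=> fA x Ax U [P Pn PU].
have Q i : (f @ within A (nbhs x)) [set w | P 0 i (w 0 i)].
  by have := fA i x Ax (P 0 i); apply; exact: Pn.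
apply: (@filterS _ (f @ within A (nbhs x)) _ _ _ _
  (@filter_forall _ _ _ (f @ within A (nbhs x)) _ Q)).
by move=> w wP; apply: PU => k i; rewrite ord1; exact: wP.
Qed.

Variables (Kf : 'I_n -> set S) (c : 'I_n -> int) (p0 : S).

Definition prodset : set 'rV[S]_n := [set w | forall i, Kf i (w 0 i)].

Definition partial_prodset (l : seq 'I_n) : set 'rV[S]_n :=
  [set w | forall i, if i \in l then Kf i (w 0 i) else w 0 i = p0].

(** The factors are put in one at a time, the others being kept at [p0]. *)
Lemma chi_prodset : (forall i, mul_chi (Kf i) (c i)) ->
  chi prodset (\prod_i c i).
Proof.
move=> Kc.
have step l : uniq l -> chi (partial_prodset l) (\prod_(i <- l) c i).
  elim: l => [_|a l IH] /=.
    rewrite big_nil.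
    have -> : partial_prodset [::] = [set const_mx p0].
      apply/seteqP; split=> [w wE|_ -> i]; last by rewrite mxE.
      by apply/rowP => i; rewrite mxE; exact: wE.
    exact: chi_point.
  move=> /andP[al ul]; rewrite big_cons mulrC.
  apply: chi_hequiv (Kc a _ _ _ (IH ul)); apply: homeo_hequiv.
  exists (fun p : 'rV[S]_n * S => \row_i if i == a then p.2 else p.1 0 i),
    (fun w : 'rV[S]_n => (\row_i (if i == a then p0 else w 0 i), w 0 a)); split.
  - split.
      apply: cts_on_row => i.
      rewrite (_ : (fun x => _) = (fun p : 'rV[S]_n * S =>
          if i == a then p.2 else p.1 0 i)); last by apply/funext => p; rewrite mxE.
      case: eqP => _; first exact: cts_on_snd.
      apply: (cts_on_comp (@cts_on_fst _ _ _) (B := setT)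
        (g := fun w : 'rV[S]_n => w 0 i)) => //.
      by apply: cts_on_continuous; exact: row_coord_continuous.
    move=> [w k] [/= wl kK] i; rewrite mxE inE.
    have [->//|ia] /= := eqVneq i a.
    exact: wl.
  - split.
      apply: cts_on_pair; last first.
        by apply: cts_on_continuous; exact: row_coord_continuous.
      apply: cts_on_row => i.
      rewrite (_ : (fun x => _) = (fun w : 'rV[S]_n =>
          if i == a then p0 else w 0 i)); last by apply/funext => p; rewrite mxE.
      case: eqP => _; first exact: cts_on_cst.
      by apply: cts_on_continuous; exact: row_coord_continuous.
    move=> w wl; split=> /=; last by have := wl a; rewrite inE eqxx.
    move=> i; rewrite mxE; have := wl i; rewrite inE.
    by have [->|ia] //= := eqVneq i a; rewrite (negPf al).
  - move=> [w k] [/= wl kK]; congr (_, _); last by rewrite mxE eqxx.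
    apply/rowP => i; rewrite !mxE; have [->|//] := eqVneq i a.
    by have := wl a; rewrite (negPf al).
  - move=> w wl; apply/rowP => i; rewrite !mxE.
    by have [->|] := eqVneq i a.
have := step _ (enum_uniq 'I_n); rewrite big_enum /=.
congr (chi _ _); apply/seteqP; split=> w wK i; have := wK i.
  by rewrite mem_enum.
by rewrite mem_enum.
Qed.

End ProductSets.

(** * Spanning trees, potentials and flows *)

(** Connectedness is used through cuts, which restrict to subgraphs and descend
    to contractions without any manipulation of paths. *)
Lemma gconnectedP (G : graph) :
  gconnected G <-> (0 < #|vert G|)%N /\
    forall A : {set vert G}, A != finset.set0 -> A != finset.setT ->
      exists e : edge G, (hd e \in A) != (tl e \in A).
Proof.
split=> [/andP[V0 /forallP conn]|[V0 cut]].
  split=> // A /set0Pn[u uA] AT.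
  have [v vA] : exists v, v \notin A.
    apply/existsP; apply: contraNT AT; rewrite negb_exists => /forallP AT.
    by apply/eqP/setP => w; rewrite inE; have := AT w; rewrite negbK.
  have uv : connect (@Defs.adjacent G) u v by have /forallP := conn u; apply.
  apply: contrapT => ncut.
  have cl : fingraph.closed (@Defs.adjacent G) (mem A).
    move=> x y /existsP[e exy]; apply: contrapT => xy; apply: ncut; exists e.
    case/orP: exy => /andP[/eqP-> /eqP->]; apply/eqP => h; apply: xy.
      exact: h.
    exact/esym/h.
  have e : (u \in A) = (v \in A) := closed_connect cl uv.
  by rewrite e (negPf vA) in uA.
rewrite /gconnected V0 /=; apply/forallP => u; apply/forallP => v.
pose A := [set w | connect (@Defs.adjacent G) u w]%SET.
have uA : u \in A by rewrite inE connect0.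
have [AT|AT] := eqVneq A finset.setT.
  by have : v \in A; [rewrite AT inE|rewrite inE].
have [|e eA] := cut A _ AT; first by apply/set0Pn; exists u.
have adj x y : connect (@Defs.adjacent G) u x -> Defs.adjacent x y ->
    connect (@Defs.adjacent G) u y.
  by move=> ux xy; apply: connect_trans ux _; exact: connect1.
have a1 : Defs.adjacent (hd e) (tl e) by apply/existsP; exists e; rewrite !eqxx.
have a2 : Defs.adjacent (tl e) (hd e) by apply/existsP; exists e; rewrite !eqxx orbT.
case/negP: eA; apply/eqP; rewrite !inE.
by apply/idP/idP => h; [exact: adj h a1|exact: adj h a2].
Qed.

Lemma subgraph_connectedP (G : graph) (S : {set edge G}) :
  gconnected (subgraph S) <-> (0 < #|vert G|)%N /\
    forall A : {set vert G}, A != finset.set0 -> A != finset.setT ->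
      exists2 e, e \in S & (hd e \in A) != (tl e \in A).
Proof.
split=> [/gconnectedP[V0 cut]|[V0 cut]].
  split=> // A A0 AT; have [[e eS] eA] := cut A A0 AT.
  by exists e.
apply/gconnectedP; split=> // A A0 AT; have [e eS eA] := cut A A0 AT.
by exists (exist _ e eS).
Qed.

Lemma subgraph_connectedS (G : graph) (S S' : {set edge G}) :
  S \subset S' -> gconnected (subgraph S) -> gconnected (subgraph S').
Proof.
move=> /fintype.subsetP SS' /subgraph_connectedP[V0 cut].
apply/subgraph_connectedP; split=> // A A0 AT.
by have [e /SS' eS eA] := cut A A0 AT; exists e.
Qed.

(** A tree on the vertex set [A], as the list of its edges in the order in which
    it is grown, last edge first; each edge points to the vertex it adds. *)
Inductive grown (G : graph) : {set vert G} -> seq (edge G * bool) -> Prop :=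
| grown1 v : grown [set v]%SET [::]
| grownS A l d : grown A l -> dsrc d \in A -> dtgt d \notin A ->
    grown (dtgt d |: A) (d :: l).

Section Trees.
Variable G : graph.
Implicit Types (A : {set vert G}) (l : seq (edge G * bool)) (e : edge G).

Definition ledges l : seq (edge G) := [seq d.1 | d <- l].

Lemma grown_ends A l e : grown A l -> e \in ledges l -> hd e \in A /\ tl e \in A.
Proof.
elim=> [//|{}A {}l d _ IH dA dnA]; rewrite inE => /orP[/eqP->|/IH[h1 h2]].
  by move: dA dnA; rewrite /dsrc /dtgt !inE; case: d.2 => dA _;
    rewrite dA eqxx ?orbT.
by rewrite !inE h1 h2 !orbT.
Qed.

Lemma grown_notin A l d : grown A l -> dtgt d \notin A -> d.1 \notin ledges l.
Proof.
move=> Al; apply: contra => /(grown_ends Al)[].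
by rewrite /dtgt; case: d.2.
Qed.

Lemma grown_size A l : grown A l -> #|A| = (size l).+1.
Proof.
elim=> [v|{}A {}l d _ IH _ dnA]; first by rewrite cards1.
by rewrite cardsU1 dnA IH.
Qed.

Lemma grown_uniq A l : grown A l -> uniq (ledges l).
Proof.
elim=> [//|{}A {}l d Al IH _ dnA] /=.
by rewrite IH (grown_notin Al dnA).
Qed.

Lemma grown_exists (S : {set edge G}) : gconnected (subgraph S) ->
  exists2 l, grown finset.setT l & {subset ledges l <= S}.
Proof.
move=> /subgraph_connectedP[V0 cut].
have step n : (n < #|vert G|)%N -> exists A l,
    [/\ grown A l, {subset ledges l <= S} & #|A| = n.+1].
  elim: n => [|n IH] nV.
    have [v _] : exists v : vert G, v \in vert G by apply/card_gt0P.
    by exists [set v]%SET, [::]; split; [exact: grown1| |rewrite cards1].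
  have [A [l [Al lS An]]] := IH (ltnW nV).
  have [||e eS eA] := cut A.
  - by rewrite -card_gt0 An.
  - by apply: contraTneq nV => AT; rewrite -leqNgt -An AT cardsT.
  pose d := (e, tl e \in A).
  have [sA tA] : dsrc d \in A /\ dtgt d \notin A.
    by move: eA; rewrite /d /dsrc /dtgt /=; case E : (tl e \in A);
      case E' : (hd e \in A); rewrite //= ?E ?E'.
  exists (dtgt d |: A), (d :: l); split; first exact: grownS.
    by move=> f; rewrite inE => /orP[/eqP->//|/lS].
  by rewrite cardsU1 tA An.
have [|A [l [Al lS An]]] := step #|vert G|.-1; first by rewrite prednK.
exists l => //; suff <- : A = finset.setT by [].
by apply/eqP; rewrite eqEcard finset.subsetT cardsT An (ltn_predK V0) /=.
Qed.

Section Groups.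
Variable M : zmodType.
Implicit Types (a m : edge G -> M) (b g : vert G -> M).

Definition dval (d : edge G * bool) (x : M) : M := if d.2 then x else - x.

(** The function on the vertices with prescribed coboundary on the tree,
    computed by following the growth of the tree; it vanishes at the root. *)
Fixpoint potential a l : vert G -> M :=
  if l is d :: l' then
    fun v => if v == dtgt d then potential a l' (dsrc d) + dval d (a d.1)
             else potential a l' v
  else fun=> 0.

Lemma potentialP a A l e : grown A l -> e \in ledges l ->
  cobd (potential a l) e = a e.
Proof.
elim=> [//|{}A {}l d Al IH dA dnA]; rewrite inE => /orP[/eqP->|el].
  have dst : dsrc d != dtgt d by apply: contraNneq dnA => <-.
  move: dst; rewrite /cobd /= /dsrc /dtgt /dval; case: d.2 => st.
    by rewrite eqxx (negPf st) addrAC subrr add0r.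
  by rewrite eqxx (negPf st) opprB addrC subrK.
have [h1 h2] := grown_ends Al el.
rewrite -(IH el) /cobd /=.
by rewrite !ifN //; apply: contraNneq dnA => <-.
Qed.

Lemma potential_unique g A l : grown A l ->
  (forall e, e \in ledges l -> cobd g e = 0) ->
  forall u v, u \in A -> v \in A -> g u = g v.
Proof.
elim=> [w _ u v|{}A {}l d Al IH dA dnA g0 u v].
  by rewrite !inE => /eqP-> /eqP->.
have gst : g (dtgt d) = g (dsrc d).
  have /eqP := g0 d.1 (mem_head _ _); rewrite /cobd subr_eq0 /dtgt /dsrc.
  by case: d.2 => /eqP.
have {}IH := IH (fun e el => g0 e (mem_behead (s := d.1 :: ledges l) el)).
have key w : w \in dtgt d |: A -> g w = g (dsrc d).
  by rewrite !inE => /orP[/eqP->//|wA]; exact: IH.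
by move=> /key-> /key->.
Qed.

(** The chain supported on the tree with prescribed boundary, computed by
    removing the leaves one after the other. *)
Fixpoint flow b l : edge G -> M :=
  if l is d :: l' then
    fun e => if e == d.1 then dval d (b (dtgt d))
             else flow (fun v => if v == dsrc d then b v + b (dtgt d) else b v) l' e
  else fun=> 0.

Lemma bdD a m v : bd (fun e => a e + m e) v = bd a v + bd m v.
Proof. by rewrite /bd !big_split opprD addrACA. Qed.

Lemma bdB a m v : bd (fun e => a e - m e) v = bd a v - bd m v.
Proof. by rewrite /bd !sumrB !opprD !opprK addrACA. Qed.

Lemma eq_bd a m v : a =1 m -> bd a v = bd m v.
Proof. by move=> am; rewrite /bd; congr (_ - _); apply: eq_bigr => e _. Qed.

Lemma sum_bd a : \sum_v bd a v = 0.
Proof.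
rewrite sumrB; apply/eqP; rewrite subr_eq0; apply/eqP.
have key (f : edge G -> vert G) : \sum_v \sum_(e | f e == v) a e = \sum_e a e.
  rewrite (exchange_big_dep xpredT) //=; apply: eq_bigr => e _.
  by rewrite (eq_bigl (pred1 (f e))) ?big_pred1_eq // => v /=; rewrite eq_sym.
by rewrite !key.
Qed.

Lemma bd_single e (x : M) v :
  bd (fun f => if f == e then x else 0) v =
  (if hd e == v then x else 0) - (if tl e == v then x else 0).
Proof.
have key (f : edge G -> vert G) :
    \sum_(e' | f e' == v) (if e' == e then x else 0) = if f e == v then x else 0.
  rewrite -big_mkcondr /=; case: ifP => fe.
    by rewrite (eq_bigl (pred1 e)) ?big_pred1_eq // => e' /=;
      have [->|] := eqVneq e' e; rewrite ?fe ?andbF.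
  by rewrite big_pred0 // => e'; have [->|] := eqVneq e' e; rewrite ?fe ?andbF.
by rewrite /bd !key.
Qed.

Lemma bd_dval d (x : M) v : dsrc d != dtgt d ->
  bd (fun f => if f == d.1 then dval d x else 0) v =
  if v == dtgt d then x else if v == dsrc d then - x else 0.
Proof.
rewrite bd_single /dtgt /dsrc /dval ![_ == v]eq_sym; case: d.2 => st.
  have [->|vh] := eqVneq v (hd d.1); first by rewrite eq_sym (negPf st) subr0.
  by case: ifP; rewrite ?subr0 ?sub0r.
have [->|vh] := eqVneq v (tl d.1); first by rewrite eq_sym (negPf st) sub0r opprK.
by case: ifP; rewrite ?subr0.
Qed.

Lemma flow_supp b l e : e \notin ledges l -> flow b l e = 0.
Proof.
elim: l b => [//|d l IH] b; rewrite inE negb_or => /andP[ed el] /=.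
by rewrite (negPf ed) IH.
Qed.

(** The last vertex grown is a leaf: the flow on its edge is prescribed, and is
    passed on to the other end. *)
Lemma flowP b A l : grown A l -> \sum_(v in A) b v = 0 ->
  forall v, bd (flow b l) v = if v \in A then b v else 0.
Proof.
move=> Al; elim: Al b => [w|{}A {}l d Al IH dA dnA] b.
  rewrite big_set1 => b0 v.
  rewrite [LHS](_ : _ = 0); last by rewrite /bd !big1 ?subr0.
  by rewrite inE; case: eqP => // ->.
rewrite big_setU1 //= => b0 v.
pose b' v := if v == dsrc d then b v + b (dtgt d) else b v.
have dst : dsrc d != dtgt d by apply: contraNneq dnA => <-.
have b'0 : \sum_(v in A) b' v = 0.
  move: b0; rewrite (bigD1 (dsrc d)) //= => b0.
  rewrite (bigD1 (dsrc d)) //= /b' eqxx addrAC addrC -[RHS]b0; congr (_ + (_ + _)).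
  by apply: eq_bigr => w /andP[_ /negPf->].
have dl := grown_notin Al dnA.
rewrite (@eq_bd _ (fun e => (if e == d.1 then dval d (b (dtgt d)) else 0) +
    flow b' l e)); last first.
  move=> e; case: eqP => [->|_]; last by rewrite add0r.
  by rewrite flow_supp // addr0.
rewrite bdD bd_dval // (IH b' b'0) !inE.
have [->|vt] := eqVneq v (dtgt d); first by rewrite (negPf dnA) addr0.
rewrite /b'; have [->|vs] /= := eqVneq v (dsrc d).
  by rewrite dA addrC addrK.
by rewrite add0r.
Qed.

(** Once the edges outside the tree are filled, the edges of the tree can be
    filled in a unique way to satisfy the moment equations. *)
Lemma flow_completion m b l v : grown finset.setT l -> \sum_v b v = 0 ->
  bd (fun e => m e + flow (fun v => b v - bd m v) l e) v = b v.
Proof.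
move=> Gl b0; rewrite bdD (flowP Gl); first by rewrite inE addrC subrK.
rewrite (eq_bigl xpredT) => [|w]; last by rewrite inE.
by rewrite sumrB sum_bd subr0.
Qed.

Lemma flow_unique a A l : grown A l ->
  (forall e, e \notin ledges l -> a e = 0) -> (forall v, bd a v = 0) ->
  forall e, a e = 0.
Proof.
move=> Al; elim: Al a => [w|{}A {}l d Al IH dA dnA] a asupp a0 e.
  exact: asupp.
have dst : dsrc d != dtgt d by apply: contraNneq dnA => <-.
have dl := grown_notin Al dnA.
have ad : a d.1 = 0.
  have := a0 (dtgt d).
  rewrite (@eq_bd _ (fun e => (if e == d.1 then dval d (dval d (a d.1)) else 0) +
    (if e == d.1 then 0 else a e))); last first.
    move=> f; case: eqP => [->|_]; last by rewrite add0r.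
    by rewrite addr0 /dval; case: d.2; rewrite ?opprK.
  rewrite bdD bd_dval // eqxx [X in _ + X](_ : _ = 0).
    by rewrite addr0 /dval; case: d.2 => // /eqP; rewrite oppr_eq0 => /eqP.
  rewrite /bd; have z (f : edge G -> vert G) :
      (forall e, e \in ledges l -> f e \in A) ->
      \sum_(e0 | f e0 == dtgt d) (if e0 == d.1 then 0 else a e0) = 0.
    move=> fA; apply: big1 => f0 /eqP ft; case: eqP => // /eqP f0d.
    apply: asupp; rewrite inE negb_or f0d /=; apply: contra dnA => /fA.
    by rewrite ft.
  by rewrite !z ?subrr // => f /(grown_ends Al)[].
apply: IH => // f fl; have [->//|fd] := eqVneq f d.1.
by apply: asupp; rewrite inE negb_or fd.
Qed.

End Groups.

(** Closure of the two constructions under any family of group-valued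
    functions that is stable under the group operations. *)
Section Closure.
Variables (M : zmodType) (Z : Type) (P : (Z -> M) -> Prop).
Hypotheses (P0 : P (fun=> 0)) (PN : forall f, P f -> P (fun z => - f z))
  (PD : forall f g, P f -> P g -> P (fun z => f z + g z)).

Lemma dval_closed d f : P f -> P (fun z => dval d (f z)).
Proof. by rewrite /dval; case: d.2 => // /PN. Qed.

Lemma potential_closed (a : Z -> edge G -> M) l v :
  (forall e, e \in ledges l -> P (fun z => a z e)) ->
  P (fun z => potential (a z) l v).
Proof.
elim: l v => [|d l IH] v aP //=.
have aP' e : e \in ledges l -> P (fun z => a z e).
  by move=> el; apply: aP; rewrite inE el orbT.
case: eqP => _; last exact: IH.
apply: PD; first exact: IH.
by apply: dval_closed; apply: aP; exact: mem_head.
Qed.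

Lemma flow_closed (b : Z -> vert G -> M) l e :
  (forall v, P (fun z => b z v)) -> P (fun z => flow (b z) l e).
Proof.
elim: l b => [|d l IH] b bP //=.
case: eqP => _; first exact: dval_closed.
apply: (IH (fun z v => if v == dsrc d then b z v + b z (dtgt d) else b z v)).
by move=> v; case: eqP => _ //; exact: PD.
Qed.

Lemma sum_closed (I : Type) (r : seq I) (Q : pred I) (f : I -> Z -> M) :
  (forall i, Q i -> P (f i)) -> P (fun z => \sum_(i <- r | Q i) f i z).
Proof.
move=> fP; elim: r => [|i r IH].
  by have -> : (fun z => \sum_(j <- [::] | Q j) f j z) = fun=> 0
    by apply/funext => z; rewrite big_nil.
have -> : (fun z => \sum_(j <- i :: r | Q j) f j z) = (fun z =>
    if Q i then f i z + \sum_(j <- r | Q j) f j z else \sum_(j <- r | Q j) f j z).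
  by apply/funext => z; rewrite big_cons.
by case: (boolP (Q i)) => // /fP fi; exact: PD.
Qed.

Lemma bd_closed (a : Z -> edge G -> M) v :
  (forall e, P (fun z => a z e)) -> P (fun z => bd (a z) v).
Proof.
move=> aP; rewrite /bd; apply: PD; first exact: sum_closed.
by apply: PN; exact: sum_closed.
Qed.

End Closure.

(** * Cycles and the first Betti number *)

Fixpoint walk (u : vert G) (p : seq (edge G * bool)) (v : vert G) : Prop :=
  if p is d :: p' then dsrc d = u /\ walk (dtgt d) p' v else u = v.

Lemma walk_rcons u p d : walk u p (dsrc d) -> walk u (rcons p d) (dtgt d).
Proof.
by elim: p u => [|d' p IH] u /= => [->|[-> /IH]].
Qed.

Lemma grown_walk A l : grown A l -> forall u v, u \in A -> v \in A ->
  exists p, [/\ walk u p v, uniq (ledges p) & {subset ledges p <= ledges l}].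
Proof.
elim=> [w u v|{}A {}l d Al IH dA dnA u v].
  by rewrite !inE => /eqP-> /eqP->; exists [::].
have dl := grown_notin Al dnA.
rewrite !inE; have [->|ut] := eqVneq u (dtgt d); have [->|vt] := eqVneq v (dtgt d).
- by exists [::].
- move=> _ /= vA; have [p [pw pu pl]] := IH _ _ dA vA.
  exists ((d.1, ~~ d.2) :: p); split=> /=.
  + by move: pw; rewrite /dsrc /dtgt /=; case: d.2.
  + by rewrite pu andbT; apply: contra dl => /pl.
  + by move=> f; rewrite !inE => /orP[->//|/pl->]; rewrite orbT.
- move=> /= uA _; have [p [pw pu pl]] := IH _ _ uA dA.
  exists (rcons p d); split; first exact: walk_rcons.
  + rewrite /ledges map_rcons rcons_uniq pu andbT.
    by apply: contra dl => /pl.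
  + move=> f; rewrite /ledges map_rcons mem_rcons !inE => /orP[->//|/pl->].
    by rewrite orbT.
- move=> /= uA vA; have [p [pw pu pl]] := IH _ _ uA vA.
  by exists p; split=> // f /pl; rewrite inE orbC => ->.
Qed.

Lemma walk_path d p v : walk (dtgt d) p v ->
  path (fun d d' => dtgt d == dsrc d') d p /\ dtgt (last d p) = v.
Proof.
by elim: p d => [|d' p IH] d //= [-> /IH[-> ->]]; rewrite eqxx.
Qed.

(** An edge outside the tree would close a path of the tree into a cycle. *)
Lemma acyclic_grown l : grown finset.setT l -> acyclic G ->
  forall e, e \in ledges l.
Proof.
move=> Gl ac e; apply: contrapT => /negP el.
have [p [pw pu pl]] := grown_walk Gl (finset.in_setT (hd e)) (finset.in_setT (tl e)).
have [pp plast] := @walk_path (e, true) p (tl e) pw.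
have epu : uniq (ledges ((e, true) :: p)).
  by rewrite /= pu andbT; apply: contra el => /pl.
have := ac ((e, true) :: p) isT epu; apply/negP; rewrite negbK /= rcons_path pp /=.
by rewrite plast.
Qed.

Lemma cycle_ends (s : seq (edge G * bool)) :
  cycle (fun d d' => dtgt d == dsrc d') s ->
  perm_eq [seq dtgt d | d <- s] [seq dsrc d | d <- s].
Proof.
case: s => [//|d s] /=.
have key x t : path (fun d d' => dtgt d == dsrc d') x t ->
    [seq dtgt d | d <- belast x t] = [seq dsrc d | d <- t].
  by elim: t x => //= y t IH x /andP[/eqP-> /IH->].
move=> /key; rewrite belast_rcons /= => ->.
by rewrite map_rcons perm_rcons.
Qed.

(** A cycle with distinct edges carries a nonzero circulation. *)
Lemma grown_acyclic l : grown finset.setT l -> (forall e, e \in ledges l) ->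
  acyclic G.
Proof.
move=> Gl all_l s s0 su; apply/negP => sc.
pose a e : int := \sum_(d <- s) (if e == d.1 then dval d 1 else 0).
have bda v : bd a v = 0.
  have -> : bd a v = \sum_(d <- s) ((dtgt d == v)%:R - (dsrc d == v)%:R).
    have -> : bd a v = \sum_(d <- s) bd (fun e => if e == d.1 then dval d 1 else 0) v.
      rewrite /bd sumrB; congr (_ - _); rewrite exchange_big //=.
    apply: eq_bigr => d _; rewrite bd_single /dval /dtgt /dsrc.
    by case: d.2; do 2 case: eqP => _ //=; rewrite ?subrr ?subr0 ?sub0r ?opprK ?addNr.
  rewrite sumrB; apply/eqP; rewrite subr_eq0; apply/eqP.
  have : \sum_(u <- [seq dtgt d | d <- s]) (u == v)%:R =
      \sum_(u <- [seq dsrc d | d <- s]) (u == v)%:R :> int.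
    exact: perm_big (cycle_ends sc).
  by rewrite !big_map.
have [d ds] : exists d, d \in s.
  by case: (s) s0 => [//|d s'] _; exists d; exact: mem_head.
have a0 : a d.1 = 0.
  by apply: (flow_unique Gl _ bda) => e; rewrite all_l.
move: su; rewrite (perm_uniq (perm_map _ (perm_to_rem ds))) /= => /andP[drem _].
move: a0; rewrite /a (big_rem d ds) /= eqxx big_seq big1 ?addr0.
  by rewrite /dval; case: d.2.
move=> d' d's; case: eqP => // dd'.
by case/negP: drem; apply/mapP; exists d'.
Qed.

End Trees.

Section Betti.
Variable G : graph.

Definition bd_ffun (a : {ffun edge G -> rat^o}) : {ffun vert G -> rat^o} :=
  [ffun v => bd a v].

Lemma bd_ffun_linear : linear bd_ffun.
Proof.
move=> c x y; apply/ffunP => v; rewrite !ffunE.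
have -> : bd (c *: x + y) v = bd (fun e => (c *: x) e + y e) v.
  by apply: eq_bd => e; rewrite ffunE.
rewrite bdD; congr (_ + _).
rewrite /bd scalerBr !scaler_sumr.
by congr (_ - _); apply: eq_bigr => e _; rewrite ffunE.
Qed.

HB.instance Definition _ := GRing.isLinear.Build rat
  {ffun edge G -> rat^o} {ffun vert G -> rat^o} *:%R bd_ffun bd_ffun_linear.

Definition total_ffun (b : {ffun vert G -> rat^o}) : rat^o := \sum_v b v.

Lemma total_ffun_linear : linear total_ffun.
Proof.
move=> c x y; rewrite /total_ffun scaler_sumr -big_split.
by apply: eq_bigr => v _; rewrite !ffunE.
Qed.

HB.instance Definition _ := GRing.isLinear.Build rat
  {ffun vert G -> rat^o} rat^o *:%R total_ffun total_ffun_linear.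

(** The image of the boundary of a connected graph is the hyperplane of sum
    zero, by the existence of flows on a spanning tree. *)
Lemma betti1_connected : gconnected G -> betti1 G = (#|edge G| + 1 - #|vert G|)%N.
Proof.
move=> Gc.
have [l Gl _] : exists2 l, @grown G finset.setT l &
    {subset ledges l <= [set: edge G]%SET}.
  apply: grown_exists; apply/subgraph_connectedP.
  have [V0 cut] := (gconnectedP G).1 Gc; split=> // A A0 AT.
  by have [e eA] := cut A A0 AT; exists e; rewrite ?inE.
have V0 : (0 < #|vert G|)%N by case/andP: Gc.
have -> : betti1 G = \dim (lker (linfun bd_ffun)) by [].
have imE : (limg (linfun bd_ffun) = lker (linfun total_ffun))%VS.
  apply/vspaceP => b; apply/idP/idP.
    move=> /memv_imgP[a _ ->]; rewrite memv_ker !lfunE /= /total_ffun.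
    apply/eqP; rewrite -[RHS](sum_bd a); apply: eq_bigr => v _.
    by rewrite ffunE.
  rewrite memv_ker lfunE /= => /eqP b0.
  have b0' : \sum_(v in finset.setT) b v = 0.
    by rewrite -[RHS]b0; apply: eq_bigl => v; rewrite inE.
  apply/memv_imgP; exists [ffun e => flow b l e]; first exact: memvf.
  apply/ffunP => v; rewrite lfunE ffunE.
  rewrite (@eq_bd _ _ _ (flow b l)); last by move=> e; rewrite ffunE.
  by rewrite (flowP Gl b0') inE.
have dimT : \dim (limg (linfun total_ffun)) = 1%N.
  apply/eqP; rewrite eqn_leq; apply/andP; split.
    by apply: leq_trans (dimvS (subvf _)) _; rewrite dimvf.
  rewrite lt0n dimv_eq0; apply/eqP => im0.
  have [v _] : exists v : vert G, v \in vert G by apply/card_gt0P.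
  have : total_ffun [ffun w => (w == v)%:R] \in limg (linfun total_ffun).
    by apply/memv_imgP; exists [ffun w => (w == v)%:R]; rewrite ?memvf ?lfunE.
  rewrite im0 memv0 /total_ffun (bigD1 v) //= big1 ?addr0 ?ffunE ?eqxx ?oner_eq0 //.
  by move=> w wv; rewrite ffunE (negPf wv).
have dE := limg_ker_dim (linfun bd_ffun) fullv.
have dV := limg_ker_dim (linfun total_ffun) fullv.
rewrite !capfv in dE dV; rewrite imE in dE; rewrite dimT in dV.
have e1 : \dim {: {ffun edge G -> rat^o}} = #|edge G|.
  by rewrite dimvf /dim /= muln1.
have e2 : \dim {: {ffun vert G -> rat^o}} = #|vert G|.
  by rewrite dimvf /dim /= muln1.
rewrite e1 in dE; rewrite e2 in dV.
by rewrite -dE -dV; lia.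
Qed.

End Betti.

(** * Spaces with functions *)

Section Ringed.

(** The axioms of a space with functions leave out that regular functions form
    rings and that their zero loci are closed; these pass to
    subspaces and quotients. *)
Record is_ringed (X : fspace) : Prop := IsRinged {
  ringed_fspace :> is_fspace X;
  regular_cst : forall (U : set X) (c : CC), zopen U -> regular U (fun=> c);
  regularD : forall (U : set X) (f g : X -> CC), zopen U ->
    regular U f -> regular U g -> regular U (fun x => f x + g x);
  regularM : forall (U : set X) (f g : X -> CC), zopen U ->
    regular U f -> regular U g -> regular U (fun x => f x * g x);
  zopen_neq0 : forall (U : set X) (f : X -> CC), zopen U ->
    regular U f -> zopen [set x | U x /\ f x != 0];
  regularV : forall (U : set X) (f : X -> CC), zopen U ->
    regular U f -> regular [set x | U x /\ f x != 0] (fun x => (f x)^-1) }.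

Section Basics.
Variable X : fspace.
Hypothesis FX : is_fspace X.
Implicit Types (U V : set X) (f g : X -> CC).

Lemma zopenT : zopen [set: X]. Proof. by case: FX. Qed.

Lemma zopenI U V : zopen U -> zopen V -> zopen (U `&` V).
Proof. by case: FX => _ h _ _; exact: h. Qed.

Lemma zopen_bigcup (F : set (set X)) :
  F `<=` zopen -> zopen (\bigcup_(U in F) U).
Proof. by case: FX => _ _ h _; exact: h. Qed.

Lemma zopen_local U :
  (forall x, U x -> exists V, [/\ zopen V, V x & V `<=` U]) -> zopen U.
Proof.
move=> H.
have -> : U = \bigcup_(V in [set V | zopen V /\ V `<=` U]) V.
  apply/seteqP; split=> x; last by move=> [V [_ VU]]; exact: VU.
  by move=> /H[V [oV Vx VU]]; exists V.
by apply: zopen_bigcup => V [].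
Qed.

Lemma regular_local U f : zopen U ->
  (forall x, U x -> exists V g, [/\ zopen V, V x, regular V g &
     forall y, U y -> V y -> f y = g y]) -> regular U f.
Proof. by move=> oU H; case: FX => _ _ _ h; exact/(h _ _ oU). Qed.

Lemma regular_eq U f g : zopen U -> (forall x, U x -> f x = g x) ->
  regular U f -> regular U g.
Proof.
move=> oU fg rf; apply: regular_local => // x Ux; exists U, f; split=> //.
by move=> y Uy _; rewrite fg.
Qed.

Lemma regular_sub U V f : zopen U -> zopen V -> V `<=` U ->
  regular U f -> regular V f.
Proof.
move=> oU oV VU rf; apply: regular_local => // x Vx; exists U, f; split=> //.
exact: VU.
Qed.

End Basics.

Section RingedTheory.
Variable X : fspace.
Hypothesis RX : is_ringed X.
Implicit Types (U V : set X) (f g : X -> CC).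

Lemma regular_sum U (I : Type) (r : seq I) (F : I -> X -> CC) : zopen U ->
  (forall i, regular U (F i)) -> regular U (fun x => \sum_(i <- r) F i x).
Proof.
move=> oU rF; elim: r => [|i r IH].
  apply: (regular_eq RX oU (f := fun=> 0)); last exact: regular_cst.
  by move=> x _; rewrite big_nil.
apply: (regular_eq RX oU (f := fun x => F i x + \sum_(i <- r) F i x)).
  by move=> x _; rewrite big_cons.
exact: regularD.
Qed.

Lemma regular_prod U (I : Type) (r : seq I) (F : I -> X -> CC) : zopen U ->
  (forall i, regular U (F i)) -> regular U (fun x => \prod_(i <- r) F i x).
Proof.
move=> oU rF; elim: r => [|i r IH].
  apply: (regular_eq RX oU (f := fun=> 1)); last exact: regular_cst.
  by move=> x _; rewrite big_nil.
apply: (regular_eq RX oU (f := fun x => F i x * \prod_(i <- r) F i x)).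
  by move=> x _; rewrite big_cons.
exact: regularM.
Qed.

Lemma regularX U f n : zopen U -> regular U f -> regular U (fun x => f x ^+ n).
Proof.
move=> oU rf; elim: n => [|n IH].
  by apply: (regular_eq RX oU (f := fun=> 1)) => //; exact: regular_cst.
apply: (regular_eq RX oU (f := fun x => f x * f x ^+ n)).
  by move=> x _; rewrite exprS.
exact: regularM.
Qed.

Lemma regular_meval U n (iota : X -> 'I_n -> CC) (p : mpoly n CC) : zopen U ->
  (forall i, regular U (iota^~ i)) -> regular U (fun x => meval (iota x) p).
Proof.
move=> oU ri.
apply: (regular_eq RX oU (f := fun x => \sum_(m <- msupp p)
  mcoeff m p * \prod_(i <- index_enum 'I_n) iota x i ^+ m i)).
  by move=> x _; rewrite mevalE.
apply: regular_sum => // m; apply: regularM => //; first exact: regular_cst.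
by apply: regular_prod => // i; exact: regularX.
Qed.

Lemma regularV_unit U f : zopen U -> regular U f -> (forall x, U x -> f x != 0) ->
  regular U (fun x => (f x)^-1).
Proof.
move=> oU rf f0; have := regularV RX oU rf.
by congr regular; apply/seteqP; split=> x; [case|move=> Ux; split=> //; exact: f0].
Qed.

(** Regular maps to the multiplicative group; in additive notation they form a
    group. *)
Definition cstar_regular U (f : X -> Cstar) := regular U (fun x => val (f x)).

Lemma cstar_regular0 U : zopen U -> cstar_regular U (fun=> 0).
Proof. by move=> oU; exact: regular_cst. Qed.

Lemma cstar_regularD U (f g : X -> Cstar) : zopen U ->
  cstar_regular U f -> cstar_regular U g -> cstar_regular U (fun x => f x + g x).
Proof. by move=> oU rf rg; exact: regularM. Qed.

Lemma cstar_regularN U (f : X -> Cstar) : zopen U ->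
  cstar_regular U f -> cstar_regular U (fun x => - f x).
Proof.
by move=> oU rf; apply: regularV_unit => // x _; exact: (valP (f x)).
Qed.

Lemma cstar_regular_cst U (c : Cstar) : zopen U -> cstar_regular U (fun=> c).
Proof. by move=> oU; exact: regular_cst. Qed.

End RingedTheory.

Lemma embedded_ringed (T : Type) (n : nat) (iota : T -> 'I_n -> CC) :
  is_ringed (embedded iota).
Proof.
have FX := embedded_is_fspace iota.
split=> //.
- move=> U c oU x Ux; exists (mpolyC n c), 1; rewrite meval1 oner_neq0.
  by split=> // y _ _; rewrite meval1 mevalC divr1.
- move=> U f g oU rf rg x Ux; have [p [q [qx fpq]]] := rf x Ux.
  have [p' [q' [qx' gpq]]] := rg x Ux.
  exists (p * q' + p' * q), (q * q'); rewrite mevalM mulf_neq0 //; split=> // y Uy.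
  rewrite mevalM mulf_eq0 negb_or => /andP[qy qy'].
  by rewrite (fpq _ Uy qy) (gpq _ Uy qy') addf_div // mevalD !mevalM.
- move=> U f g oU rf rg x Ux; have [p [q [qx fpq]]] := rf x Ux.
  have [p' [q' [qx' gpq]]] := rg x Ux.
  exists (p * p'), (q * q'); rewrite mevalM mulf_neq0 //; split=> // y Uy.
  rewrite mevalM mulf_eq0 negb_or => /andP[qy qy'].
  by rewrite (fpq _ Uy qy) (gpq _ Uy qy') mulf_div !mevalM.
- move=> U f [S US] rf; exists [set r | [set x | meval (iota x) r != 0] `<=`
     [set x | U x /\ f x != 0]].
  apply/seteqP; split=> [x [Ux fx]|x [r]]; last by move=> rU rx; exact: rU.
  have [p [q [qx fpq]]] := rf x Ux.
  have [s Ss sx] : exists2 s, S s & meval (iota x) s != 0 by rewrite US in Ux.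
  have px : meval (iota x) p != 0.
    by apply: contraNneq fx => px; rewrite (fpq _ Ux qx) px mul0r.
  exists (s * p * q); last by rewrite !mevalM !mulf_neq0.
  move=> y /=; rewrite !mevalM !mulf_eq0 !negb_or => /andP[/andP[sy py] qy].
  have Uy : U y by rewrite US; exists s.
  by split=> //; rewrite (fpq _ Uy qy) mulf_neq0 // invr_neq0.
- move=> U f oU rf x [Ux fx]; have [p [q [qx fpq]]] := rf x Ux.
  have px : meval (iota x) p != 0.
    by apply: contraNneq fx => px; rewrite (fpq _ Ux qx) px mul0r.
  exists (q * q), (p * q); rewrite mevalM mulf_neq0 //; split=> // y [Uy fy].
  rewrite !mevalM mulf_eq0 negb_or => /andP[py qy].
  by rewrite (fpq _ Uy qy) invf_div -mulf_div divff // mulr1.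
Qed.

Lemma embedded_coord (T : Type) (n : nat) (iota : T -> 'I_n -> CC) i :
  @regular (embedded iota) setT (iota^~ i).
Proof.
move=> x _; exists (mpolyX CC (mnm1 i)), 1; rewrite meval1 oner_neq0.
by split=> // y _ _; rewrite meval1 mevalXU divr1.
Qed.

Lemma quotient_ringed (X : fspace) (r : X -> X -> Prop) :
  is_ringed X -> is_ringed (quotient r).
Proof.
move=> RX; have FX : is_fspace X := RX.
split.
- split.
  + exact: (zopenT FX).
  + by move=> U V oU oV; exact: (zopenI FX).
  + move=> F Fo; rewrite /= (_ : _ @^-1` _ =
        \bigcup_(V in [set quotient_proj r @^-1` U | U in F]) V).
      by apply: (zopen_bigcup FX) => _ [U /Fo oU <-].
    apply/seteqP; split=> x; first by move=> [U FU Ux]; exists (quotient_proj r @^-1` U) => //; exists U.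
    by move=> [_ [U FU <-] Ux]; exists U.
  + move=> U f oU; split=> [rf x Ux|H]; first by exists U, f; split.
    apply: (regular_local FX oU) => x Ux; have [V [g [oV Vx rg fg]]] := H _ Ux.
    by exists (quotient_proj r @^-1` V), (g \o quotient_proj r); split=> // y; exact: fg.
- by move=> U c oU; exact: (regular_cst RX).
- by move=> U f g oU rf rg; exact: (regularD RX).
- by move=> U f g oU rf rg; exact: (regularM RX).
- by move=> U f oU rf; exact: (zopen_neq0 RX oU rf).
- by move=> U f oU rf; exact: (regularV RX oU rf).
Qed.

Lemma quotient_proj_morphism (X : fspace) (r : X -> X -> Prop) :
  @morphism X (quotient r) (quotient_proj r).
Proof. by move=> V oV; split. Qed.

Lemma subfspace_ringed (X : fspace) (S : set X) :
  is_ringed X -> is_ringed (subfspace S).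
Proof.
move=> RX; have FX : is_fspace X := RX.
pose res (U : set X) : set (subfspace S) := [set x | U (sval x)].
have resI U V : res U `&` res V = res (U `&` V) by [].
have FS : is_fspace (subfspace S).
  split.
  - by exists setT; first exact: (zopenT FX).
  - move=> _ _ [U oU ->] [V oV ->]; exists (U `&` V) => //; exact: (zopenI FX).
  - move=> F Fo; exists (\bigcup_(V in [set V | zopen V /\ F (res V)]) V).
      by apply: (zopen_bigcup FX) => V [].
    apply/seteqP; split=> x; last by move=> [V [_ FV] Vx]; exists (res V).
    move=> [W FW Wx]; have [V oV VE] := Fo _ FW.
    by exists V; [split=> //; rewrite /res -VE|rewrite VE in Wx].
  - move=> W f [W' oW' WE]; split=> [rf x Wx|H x Wx].
      by exists W, f; split=> //; exists W'.
    have [V [g [[V' oV' VE] Vx rg fg]]] := H x Wx.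
    have [U [k [oU Ux rk gk]]] := rg x Vx.
    exists (U `&` V'), k; split.
    + exact: (zopenI FX).
    + by split=> //; rewrite VE in Vx.
    + by apply: (regular_sub FX oU _ _ rk); [exact: (zopenI FX)|move=> y []].
    + by move=> y Wy [Uy Vy]; rewrite fg // ?gk // VE.
split=> //.
- move=> U c _ x _; exists setT, (fun=> c); split=> //; first exact: (zopenT FX).
  by apply: (regular_cst RX); exact: (zopenT FX).
- move=> W f g _ rf rg x Wx.
  have [U [k [oU Ux rk fk]]] := rf x Wx; have [V [l [oV Vx rl gl]]] := rg x Wx.
  have oI : zopen (U `&` V) by exact: (zopenI FX).
  exists (U `&` V), (fun y => k y + l y); split=> //.
    apply: (regularD RX) => //.
      by apply: (regular_sub FX oU oI _ rk) => y [].
    by apply: (regular_sub FX oV oI _ rl) => y [].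
  by move=> y Wy [Uy Vy]; rewrite fk // gl.
- move=> W f g _ rf rg x Wx.
  have [U [k [oU Ux rk fk]]] := rf x Wx; have [V [l [oV Vx rl gl]]] := rg x Wx.
  have oI : zopen (U `&` V) by exact: (zopenI FX).
  exists (U `&` V), (fun y => k y * l y); split=> //.
    apply: (regularM RX) => //.
      by apply: (regular_sub FX oU oI _ rk) => y [].
    by apply: (regular_sub FX oV oI _ rl) => y [].
  by move=> y Wy [Uy Vy]; rewrite fk // gl.
- move=> W f [W' oW' WE] rf; apply: (zopen_local FS) => x [Wx fx].
  have [U [k [oU Ux rk fk]]] := rf x Wx.
  exists (res ([set y | U y /\ k y != 0] `&` W')); split.
  + exists ([set y | U y /\ k y != 0] `&` W') => //.
    by apply: (zopenI FX) => //; exact: (zopen_neq0 RX).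
  + by split; [split=> //=; rewrite -fk|rewrite WE in Wx].
  + move=> y [[Uy ky] Wy].
    have Wy' : W y by rewrite WE.
    by split=> //; rewrite fk.
- move=> W f oW rf x [Wx fx].
  have [U [k [oU Ux rk fk]]] := rf x Wx.
  exists [set y | U y /\ k y != 0], (fun y => (k y)^-1); split.
  + exact: (zopen_neq0 RX).
  + by split=> //; rewrite -fk.
  + exact: (regularV RX).
  + by move=> y [Wy fy] [Uy ky]; rewrite fk.
Qed.

(** * Morphisms *)

Lemma sval_morphism (X : fspace) (S : set X) :
  @morphism (subfspace S) X (fun x => sval x).
Proof.
move=> V oV; split; first by exists V.
by move=> g rg x Vx; exists V, g; split.
Qed.

Lemma regular_sval (X : fspace) (S U : set X) (f : X -> CC) : zopen U ->
  S `<=` U -> regular U f -> @regular (subfspace S) setT (fun x => f (sval x)).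
Proof.
by move=> oU SU rf x _; exists U, f; split=> //; apply: SU; case: x.
Qed.

Lemma morphism_sub (Z X : fspace) (S : set X) (f : Z -> X)
    (fS : forall z, S (f z)) : is_fspace Z -> morphism f ->
  @morphism Z (subfspace S) (fun z => exist _ (f z) (fS z)).
Proof.
move=> FZ mf _ [U oU ->]; have [oU' rU'] := mf _ oU; split=> // g rg.
apply: (regular_local FZ oU') => z Uz.
have [V [h [oV Vz rh gh]]] := rg (exist _ (f z) (fS z)) Uz.
have [oV' rV'] := mf _ oV.
by exists (f @^-1` V), (h \o f); split=> //; [exact: rV'|move=> y Uy Vy; exact: gh].
Qed.

Lemma morphism_comp (X Y Z : fspace) (f : X -> Y) (g : Y -> Z) :
  morphism f -> morphism g -> morphism (g \o f).
Proof.
move=> mf mg V oV; have [oV' rV'] := mg _ oV; have [oV'' rV''] := mf _ oV'.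
by split=> // h hr; exact: rV'' (rV' _ hr).
Qed.

Lemma morphism_embedded (Z : fspace) (T : Type) (n : nat)
    (iota : T -> 'I_n -> CC) (f : Z -> T) : is_ringed Z ->
  (forall i, regular [set: Z] (fun z => iota (f z) i)) ->
  @morphism Z (embedded iota) f.
Proof.
move=> RZ ri; have FZ : is_fspace Z := RZ.
have rp (p : mpoly n CC) : regular [set: Z] (fun z => meval (iota (f z)) p).
  exact: (regular_meval RZ p (zopenT FZ) ri).
have op (p : mpoly n CC) : zopen [set z : Z | meval (iota (f z)) p != 0].
  have := zopen_neq0 RZ (zopenT FZ) (rp p); congr zopen.
  by apply/seteqP; split=> z //= [].
move=> V oV; have oV' : zopen (f @^-1` V).
  case: oV => S ->; apply: (zopen_local FZ) => z [p Sp pz].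
  by exists [set z | meval (iota (f z)) p != 0]; split=> // y py; exists p.
split=> // g rg; apply: (regular_local FZ oV') => z Vz.
have [p [q [qz gpq]]] := rg _ Vz.
exists [set z | meval (iota (f z)) q != 0],
  (fun z => meval (iota (f z)) p * (meval (iota (f z)) q)^-1); split=> //.
  apply: (regularM RZ) => //.
    exact: (regular_sub FZ (zopenT FZ)).
  have := regularV RZ (zopenT FZ) (rp q); congr regular.
  by apply/seteqP; split=> y //= [].
by move=> y Vy qy /=; exact: gpq.
Qed.

Lemma isomorphic_sym (X Y : fspace) : isomorphic X Y -> isomorphic Y X.
Proof. by move=> [f [g [? ? ? ?]]]; exists g, f. Qed.

Lemma isomorphic_subsub (X : fspace) (S : set X) (S' : set (subfspace S))
    (S'' : set X) : is_ringed X ->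
  (forall x, S'' (sval x) <-> S' x) -> S'' `<=` S ->
  isomorphic (@subfspace (subfspace S) S') (subfspace S'').
Proof.
move=> RX SS' SS.
have R1 := subfspace_ringed S RX; have R2 := subfspace_ringed S' R1.
have R3 := subfspace_ringed S'' RX.
have h1 (x : subfspace S') : S'' (sval (sval x)) by apply/SS'; case: x.
have h2 (x : subfspace S'') : S (sval x) by apply: SS; case: x.
have h3 (x : subfspace S'') : S' (exist _ (sval x) (h2 x)).
  by apply/SS' => /=; case: x.
exists (fun x => exist _ (sval (sval x)) (h1 x)),
  (fun x => exist _ (exist _ (sval x) (h2 x)) (h3 x)); split.
- apply: (@morphism_sub (subfspace S') X S'' (fun x => sval (sval x)) h1 R2).
  exact (morphism_comp (@sval_morphism (subfspace S) S') (@sval_morphism X S)).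
- apply: (@morphism_sub (subfspace S'') (subfspace S) S'
    (fun x => exist _ (sval x) (h2 x)) h3 R3).
  apply: (@morphism_sub (subfspace S'') X S (fun x => sval x) h2 R3).
  exact: sval_morphism.
- move=> x; apply: eq_sig_hprop => [? ? ?|]; first exact: Prop_irrelevance.
  by apply: eq_sig_hprop => [? ? ?|] //; exact: Prop_irrelevance.
- by move=> x; apply: eq_sig_hprop => [? ? ?|] //; exact: Prop_irrelevance.
Qed.

(** * Separatedness *)

(** Two points are told apart by a regular function [f] on a common open set
    [U]. Then [f p.1 - f p.2] is regular on the square of [U], and its
    nonvanishing locus is a neighbourhood of the given pair that misses the
    diagonal. *)
Definition separating (X : fspace) : Prop := forall x y : X, x <> y ->
  exists (U : set X) f, [/\ zopen U, U x, U y, regular U f & f x != f y].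

Lemma separating_zseparated (X : fspace) :
  is_ringed X -> separating X -> zseparated X.
Proof.
move=> RX sX [x y] /= /sX[U [f [oU Ux Uy rf fxy]]].
exists U, U, (fun p => f p.1 - f p.2); split=> //.
- exists 2%N, (fun k z => if k == ord0 then f z else -1),
    (fun k z => if k == ord0 then 1 else f z); split.
  + by move=> k; case: (k == ord0) => //; exact: (regular_cst RX).
  + by move=> k; case: (k == ord0) => //; exact: (regular_cst RX).
  + by move=> p; rewrite big_ord_recl big_ord1 /= mulr1 mulN1r.
- by split=> //; split=> //=; rewrite subr_eq0.
- by move=> q _ _ /=; rewrite subr_eq0 => h qq; rewrite qq eqxx in h.
Qed.

Lemma separating_sub (X : fspace) (S : set X) :
  separating X -> separating (subfspace S).
Proof.
move=> sX x y xy.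
have [|U [f [oU Ux Uy rf fxy]]] := sX (sval x) (sval y).
  move=> sxy; apply: xy; apply: eq_sig_hprop => [? ? ?|]; last exact: sxy.
  exact: Prop_irrelevance.
exists [set z | U (sval z)], (fun z => f (sval z)); split=> //.
  by exists U.
by move=> z Uz; exists U, f; split.
Qed.

Lemma separating_embedded (T : Type) (n : nat) (iota : T -> 'I_n -> CC) :
  (forall x y, iota x = iota y -> x = y) -> separating (embedded iota).
Proof.
move=> inj x y xy.
have [i xyi] : exists i, iota x i != iota y i.
  apply: contrapT => nex; apply: xy; apply: inj; apply/funext => i.
  by apply/eqP; apply: contrapT => /negP xyi; apply: nex; exists i.
exists setT, (iota^~ i); split=> //; first exact: (zopenT (embedded_is_fspace iota)).
exact: embedded_coord.
Qed.

End Ringed.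

(** * Affine varieties and products *)

Section AffineVarieties.

Definition from_fin n (i : fin n) : 'I_n := Ordinal (svalP i).

Lemma from_finK n (i : fin n) : to_fin (from_fin i) = i.
Proof. by apply: val_inj. Qed.

Lemma to_finK n (i : 'I_n) : from_fin (to_fin i) = i.
Proof. exact: val_inj. Qed.

Definition lift_mpoly n (p : mpoly n CC) : mpoly n.+1 CC :=
  comp_mpoly [tuple mpolyX CC (mnm1 (fintype.lift ord_max i)) | i < n] p.

Lemma meval_lift_mpoly n (p : mpoly n CC) (z : 'I_n.+1 -> CC) :
  meval z (lift_mpoly p) = meval (fun i => z (fintype.lift ord_max i)) p.
Proof.
rewrite /lift_mpoly comp_mpoly_meval; apply: meval_eq => i.
by rewrite tnth_mktuple mevalXU.
Qed.

(** Rabinowitsch's trick: an inequation [q != 0] becomes the equation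
    [q * t = 1] in one more variable [t]. *)
Lemma affine_embedded (T : Type) n (iota : T -> 'I_n -> CC)
    (eqs : set (mpoly n CC)) (q : mpoly n CC) :
  (forall x y, iota x = iota y -> x = y) ->
  (forall x p, eqs p -> meval (iota x) p = 0) ->
  (forall x, meval (iota x) q != 0) ->
  (forall z : 'I_n -> CC, (forall p, eqs p -> meval z p = 0) ->
     meval z q != 0 -> exists x, iota x = z) ->
  affine (embedded iota).
Proof.
move=> inj eq0 q0 surj.
pose S : set (mpoly n.+1 CC) := [set r | (exists2 p, eqs p & r = lift_mpoly p) \/
  r = lift_mpoly q * mpolyX CC (mnm1 ord_max) - 1].
pose w (x : T) (i : 'I_n.+1) : CC :=
  if unlift ord_max i is Some j then iota x j else (meval (iota x) q)^-1.
have wl x : (fun i => w x (fintype.lift ord_max i)) = iota x.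
  by apply/funext => i; rewrite /w liftK.
have wS x r : S r -> meval (fun i => w x (from_fin (to_fin i))) r = 0.
  have -> : (fun i => w x (from_fin (to_fin i))) = w x.
    by apply/funext => i; rewrite to_finK.
  move=> [[p /eq0 pe ->]|->]; first by rewrite meval_lift_mpoly wl pe.
  rewrite mevalB mevalM meval_lift_mpoly wl mevalXU meval1 /w unlift_none.
  by rewrite mulfV ?subrr.
pose f (x : T) : algebraic_set S := exist _ (fun i => w x (from_fin i)) (wS x).
have gP (z : algebraic_set S) : exists x,
    iota x = fun i => sval z (to_fin (fintype.lift ord_max i)).
  case: z => z zS /=; apply: surj.
    move=> p pe; have := zS (lift_mpoly p); rewrite meval_lift_mpoly; apply.
    by left; exists p.
  have := zS (lift_mpoly q * mpolyX CC (mnm1 ord_max) - 1) (or_intror erefl).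
  rewrite mevalB mevalM meval_lift_mpoly mevalXU meval1 => /eqP.
  rewrite subr_eq0; apply: contraTneq; rewrite /comp => ->.
  by rewrite mul0r eq_sym oner_neq0.
pose g (z : algebraic_set S) : T := sval (cid (gP z)).
have gE z : iota (g z) = fun i => sval z (to_fin (fintype.lift ord_max i)).
  by rewrite /g; case: cid.
exists n.+1, S, f, g.
have R1 := embedded_ringed iota.
have R2 := embedded_ringed (fun z : algebraic_set S => sval z \o @to_fin n.+1).
have T1 := zopenT R1.
split.
- apply: morphism_embedded => // i; rewrite /f /=.
  apply: (regular_eq R1 T1 (f := fun x => w x i)).
    by move=> x _; rewrite to_finK.
  rewrite /w; case: unlift => [j|]; first exact: embedded_coord.
  apply: (regularV_unit R1 T1); last by move=> x _; exact: q0.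
  apply: (regular_meval R1 q T1) => j; exact: embedded_coord.
- apply: morphism_embedded => // i.
  apply: (regular_eq R2 (zopenT R2) (f := fun z => sval z (to_fin (fintype.lift ord_max i)))).
    by move=> z _; rewrite gE.
  exact: (@embedded_coord _ _ (fun z : algebraic_set S => sval z \o @to_fin n.+1)
    (fintype.lift ord_max i)).
- by move=> x; apply: inj; rewrite gE; apply/funext => i /=; rewrite to_finK /w liftK.
- move=> z; apply: eq_sig_hprop => [? ? ?|]; first exact: Prop_irrelevance.
  apply/funext => i; rewrite /= -[in RHS](from_finK i) /w.
  case: unliftP => [j ->|->]; first by rewrite gE.
  rewrite gE; case: (z) => z' /= z'S.
  have := z'S (lift_mpoly q * mpolyX CC (mnm1 ord_max) - 1) (or_intror erefl).
  rewrite mevalB mevalM meval_lift_mpoly mevalXU meval1 /comp => /eqP.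
  rewrite subr_eq0 mulrC => /eqP h.
  by rewrite -[LHS]mul1r -h mulfK //; apply: contra_eq_neq h => ->;
    rewrite mulr0 eq_sym oner_neq0.
Qed.

(** Affineness is required of the members of the cover only, and separatedness
    has been reduced to separation of points by regular functions on a common
    open set. *)
Lemma variety_cover (X : fspace) (I : finType) (U : I -> set X) :
  is_ringed X -> separating X -> (forall i, zopen (U i)) ->
  (forall x, exists i, U i x) -> (forall i, affine (subfspace (U i))) ->
  is_variety X.
Proof.
move=> RX sX oU cU aU; split; [exact: RX| |exact: separating_zseparated].
exists #|I|, (fun k => U (enum_val k)); split=> // x.
by have [i Uix] := cU x; exists (enum_rank i); rewrite enum_rankK.
Qed.

Lemma affine_iso (X Y : fspace) : isomorphic X Y -> affine Y -> affine X.
Proof.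
move=> XY [n [S YS]]; exists n, S; exact: isomorphic_trans XY YS.
Qed.

Lemma variety_embedded (T : Type) n (iota : T -> 'I_n -> CC) :
  (forall x y, iota x = iota y -> x = y) -> affine (embedded iota) ->
  is_variety (embedded iota).
Proof.
move=> inj aff; have RX := embedded_ringed iota.
apply: (@variety_cover _ unit (fun=> setT)) => //.
- exact: separating_embedded.
- by move=> _; exact: (zopenT RX).
- by move=> _; apply: affine_iso aff; exact: (isomorphic_setT RX).
Qed.

(** * Products of embedded spaces *)

Definition join_iota (T T' : Type) n m (iota : T -> 'I_n -> CC)
    (iota' : T' -> 'I_m -> CC) (p : T * T') : 'I_(n + m) -> CC :=
  join_fam (iota p.1) (iota' p.2).

Section Product.
Variables (T T' : Type) (n m : nat) (iota : T -> 'I_n -> CC)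
  (iota' : T' -> 'I_m -> CC).
Let X := embedded iota.
Let Y := embedded iota'.
Let E := embedded (join_iota iota iota').
Let RE : is_ringed E := embedded_ringed _.
Let FE : is_fspace E := RE.

Lemma join_fst_morphism : @morphism E X fst.
Proof.
apply: morphism_embedded => // i.
apply: (regular_eq FE (zopenT FE) (f := fun p => join_iota iota iota' p (lshift m i))).
  by move=> p _; rewrite /join_iota join_faml.
exact: (@embedded_coord _ _ (join_iota iota iota') (lshift m i)).
Qed.

Lemma join_snd_morphism : @morphism E Y snd.
Proof.
apply: morphism_embedded => // i.
apply: (regular_eq FE (zopenT FE) (f := fun p => join_iota iota iota' p (rshift n i))).
  by move=> p _; rewrite /join_iota join_famr.
exact: (@embedded_coord _ _ (join_iota iota iota') (rshift n i)).
Qed.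

Lemma join_open (U : set X) (V : set Y) : zopen U -> zopen V ->
  @zopen E (U `*` V).
Proof.
move=> oU oV; apply: (zopenI FE).
  by have [] := join_fst_morphism oU.
by have [] := join_snd_morphism oV.
Qed.

Lemma tensor_regular (U : set X) (V : set Y) h : zopen U -> zopen V ->
  tensor U V h -> @regular E (U `*` V) h.
Proof.
move=> oU oV [k [f [g [rf rg hE]]]]; have oUV := join_open oU oV.
apply: (regular_eq FE oUV (f := fun p => \sum_(i < k) f i p.1 * g i p.2)).
  by move=> p _; rewrite hE.
apply: (regular_sum RE _ oUV) => i; apply: (regularM RE oUV).
  have [oU' rU'] := join_fst_morphism oU.
  by apply: (regular_sub FE oU' oUV _ (rU' _ (rf i))) => p [].
have [oV' rV'] := join_snd_morphism oV.
by apply: (regular_sub FE oV' oUV _ (rV' _ (rg i))) => p [].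
Qed.

(** Monomials in the joint coordinates split into two factors. *)
Lemma tensor_meval (r : mpoly (n + m) CC) :
  @tensor X Y setT setT (fun p => meval (join_iota iota iota' p) r).
Proof.
have RX : is_ringed X := embedded_ringed _.
have RY : is_ringed Y := embedded_ringed _.
pose s := msupp r.
exists (size s), (fun k x => mcoeff (nth (@mnm0 (n + m)) s k) r *
    \prod_(i < n) iota x i ^+ (nth (@mnm0 (n + m)) s k) (lshift m i)),
  (fun k y => \prod_(i < m) iota' y i ^+ (nth (@mnm0 (n + m)) s k) (rshift n i)); split.
- move=> k; apply: (regularM RX (zopenT RX)); first by apply: (regular_cst RX); exact: (zopenT RX).
  apply: (regular_prod RX _ (zopenT RX)) => i.
  by apply: (regularX RX _ (zopenT RX)); exact: embedded_coord.
- move=> k; apply: (regular_prod RY _ (zopenT RY)) => i.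
  by apply: (regularX RY _ (zopenT RY)); exact: embedded_coord.
- move=> p; rewrite mevalE (big_nth (@mnm0 (n + m))) big_mkord; apply: eq_bigr => k _.
  rewrite -mulrA; congr (_ * _); rewrite big_split_ord /=.
  congr (_ * _); apply: eq_bigr => i _.
    by rewrite /join_iota join_faml.
  by rewrite /join_iota join_famr.
Qed.

Lemma isomorphic_product : isomorphic E (product X Y).
Proof.
have TX : @zopen X setT by exact: (zopenT (embedded_is_fspace _)).
have TY : @zopen Y setT by exact: (zopenT (embedded_is_fspace _)).
exists idfun, idfun; split=> //.
- move=> W oW.
  have oW' : @zopen E W.
    apply: (zopen_local FE) => p /oW[U [V [h [oU oV th [Up [Vp hp]] UVW]]]].
    exists [set q | (U `*` V) q /\ h q != 0]; split.
    + exact: (zopen_neq0 RE (join_open oU oV) (tensor_regular oU oV th)).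
    + by split.
    + by move=> q [[Uq Vq] hq]; exact: UVW.
  split=> // f rf; apply: (regular_local FE oW') => p Wp.
  have [U [V [a [b [[oU oV] [ta tb] [Up Vp] bp fab]]]]] := rf p Wp.
  have oUV := join_open oU oV.
  have ra := tensor_regular oU oV ta; have rb := tensor_regular oU oV tb.
  have ob := zopen_neq0 RE oUV rb.
  exists ([set q | (U `*` V) q /\ b q != 0]), (fun q => a q * (b q)^-1); split=> //.
    apply: (regularM RE ob); last exact: (regularV RE oUV rb).
    by apply: (regular_sub FE oUV ob _ ra) => q [].
  by move=> q Wq [[Uq Vq] bq]; exact: fab.
- move=> W oW; split.
    case: oW => S ->; move=> p [r Sr rp].
    exists setT, setT, (fun q => meval (join_iota iota iota' q) r); split=> //.
      exact: tensor_meval.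
    by move=> q _ _ rq; exists r.
  move=> f rf p Wp; have [a [b [bp fab]]] := rf p Wp.
  exists setT, setT, (fun q => meval (join_iota iota iota' q) a),
    (fun q => meval (join_iota iota iota' q) b); split=> //.
    by split; exact: tensor_meval.
  by move=> q Wq _ _; exact: fab.
Qed.

End Product.

(** * Classes of varieties *)

Lemma motivic_classE (X : fspace) (h : is_variety X) :
  motivic_class X = k0_class (K0gen (Variety h)).
Proof.
rewrite /motivic_class; case: pselect => // h'.
by rewrite (Prop_irrelevance h h').
Qed.

Lemma mc_iso (X Y : fspace) : is_variety X -> is_variety Y -> isomorphic X Y ->
  motivic_class X = motivic_class Y.
Proof.
move=> hX hY XY; rewrite (motivic_classE hX) (motivic_classE hY).
by apply/k0_classP; exact: k0_iso.
Qed.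

Lemma mc_product (X Y P : fspace) : is_variety X -> is_variety Y ->
  is_variety P -> isomorphic P (product X Y) ->
  motivic_class P = motivic_class X * motivic_class Y.
Proof.
move=> hX hY hP PXY.
rewrite (motivic_classE hX) (motivic_classE hY) (motivic_classE hP).
rewrite -[RHS]/(k0_mul _ _) k0_mulE.
by apply/k0_classP; exact: k0_product.
Qed.

Lemma mc_scissor (X U Z : fspace) (S : set X) : zopen (~` S) ->
  is_variety X -> is_variety U -> is_variety Z ->
  isomorphic U (subfspace (~` S)) -> isomorphic Z (subfspace S) ->
  motivic_class X = motivic_class U + motivic_class Z.
Proof.
move=> oS hX hU hZ XU XZ.
rewrite (motivic_classE hX) (motivic_classE hU) (motivic_classE hZ).
rewrite -[RHS]/(k0_add _ _) k0_addE.
by apply/k0_classP; apply: (@k0_scissor (Variety hX) _ _ S).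
Qed.

Lemma mc_point (X : fspace) : is_variety X -> (exists x : X, forall y, y = x) ->
  motivic_class X = 1.
Proof.
move=> hX X1; rewrite (motivic_classE hX) -[RHS]/(k0_class K0one).
by apply/k0_classP; exact: k0_point.
Qed.

(** The relations contain no statement about the empty variety; cutting it along
    its empty subset gives [[X] = [X] + [X]]. *)
Lemma mc_empty (X : fspace) : is_variety X -> (X -> False) -> motivic_class X = 0.
Proof.
move=> hX X0.
have SE (S : set X) : isomorphic X (subfspace S).
  exists (fun x => match X0 x with end), (fun x => sval x); split.
  - move=> V _; have e (W W' : set X) : W = W' by apply/seteqP; split=> x; case: (X0 x).
    case: hX => [[oT _ _ sh] _ _]; rewrite [X in zopen X](e _ setT); split=> // g _.
    rewrite [X in regular X](e _ setT); apply/sh => // x; by case: (X0 x).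
  - exact: sval_morphism.
  - by move=> x; case: (X0 x).
  - by move=> x; case: (X0 (sval x)).
have hX' := hX; case: hX' => [[oT _ _ _] _ _].
rewrite (motivic_classE hX).
have : k0_rel (K0gen (Variety hX)) (K0add (K0gen (Variety hX)) (K0gen (Variety hX))).
  apply: (@k0_scissor (Variety hX) (Variety hX) (Variety hX) set0).
  - by rewrite setC0.
  - exact (SE set0).
  - exact (SE (~` set0)).
move=> /k0_classP h.
have {}h : k0_class (K0gen (Variety hX)) =
    k0_class (K0gen (Variety hX)) + k0_class (K0gen (Variety hX)).
  by rewrite {1}h -k0_addE.
by apply: (addrI (k0_class (K0gen (Variety hX)))); rewrite addr0 -h.
Qed.

End AffineVarieties.

(** * Local models *)

Section ToCstar.

Definition to_cstar (c : CC) : Cstar := insubd (cstar_one : {z : CC | z != 0}) c.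

Lemma val_to_cstar c : c != 0 -> val (to_cstar c) = c.
Proof. by move=> c0; rewrite /to_cstar val_insubd c0. Qed.

Lemma cstar_valD (a b : Cstar) : val (a + b) = val a * val b. Proof. by []. Qed.
Lemma cstar_valN (a : Cstar) : val (- a) = (val a)^-1. Proof. by []. Qed.
Lemma cstar_neq0 (a : Cstar) : val a != 0. Proof. exact: valP a. Qed.

End ToCstar.

Section Model.
Variables (G : graph) (T C D : {set edge G}).
Implicit Types (e : edge G).

(** A point for the edges of [T], which stands for a spanning tree; otherwise
    the locus in the plane where [y] does not vanish if [e] is in [C] and
    vanishes if [e] is in [D]. *)
Definition edge_factor e : set (CC * CC) := if e \in T then [set (0, 0)]
  else [set p | [/\ 1 + p.1 * p.2 != 0, e \in C -> p.2 != 0 & e \in D -> p.2 = 0]].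

(** The product of the factors, encoded along the enumeration of the edges. *)
Definition model : Type :=
  {w : fin #|edge G| -> CC * CC | forall e, edge_factor e (w (to_fin (enum_rank e)))}.

Definition mcoord (w : model) e : CC * CC := sval w (to_fin (enum_rank e)).

Definition model_iota (w : model) (k : 'I_#|{: edge G * bool}|) : CC :=
  let: (e, b) := enum_val k in if b then (mcoord w e).1 else (mcoord w e).2.

Lemma model_ext (w w' : model) : (forall e, mcoord w e = mcoord w' e) -> w = w'.
Proof.
move=> ww'; apply: eq_sig_hprop => [? ? ?|]; first exact: Prop_irrelevance.
apply/funext => i.
have -> : i = to_fin (enum_rank (enum_val (from_fin i))).
  by rewrite enum_valK from_finK.
exact: ww'.
Qed.

Lemma model_iota_inj (w w' : model) : model_iota w = model_iota w' -> w = w'.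
Proof.
move=> ww'; apply: model_ext => e.
have h b := congr1 (fun f => f (enum_rank (e, b))) ww'.
have := h true; have := h false; rewrite /model_iota !enum_rankK => h1 h2.
by rewrite [LHS]surjective_pairing h1 h2 -surjective_pairing.
Qed.

Let M := embedded model_iota.
Let RM : is_ringed M := embedded_ringed _.
Let TM : zopen [set: M] := zopenT RM.

Lemma mcoord1_regular e : @regular M setT (fun w => (mcoord w e).1).
Proof.
apply: (regular_eq RM TM _ (@embedded_coord _ _ model_iota (enum_rank (e, true)))).
by move=> w _; rewrite /model_iota enum_rankK.
Qed.

Lemma mcoord2_regular e : @regular M setT (fun w => (mcoord w e).2).
Proof.
apply: (regular_eq RM TM _ (@embedded_coord _ _ model_iota (enum_rank (e, false)))).
by move=> w _; rewrite /model_iota enum_rankK.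
Qed.

Lemma mcoord_unit (w : model) e : 1 + (mcoord w e).1 * (mcoord w e).2 != 0.
Proof.
have := svalP w e; rewrite /edge_factor -/(mcoord w e); case: ifP => _; last by case.
by move=> ->; rewrite mulr0 addr0 oner_neq0.
Qed.

(** The vanishing conditions are equations, and the product of the quantities
    that must not vanish is inverted by Rabinowitsch's trick. *)
Lemma affine_model : affine M.
Proof.
pose X1 e := mpolyX CC (mnm1 (enum_rank (e, true))).
pose X2 e := mpolyX CC (mnm1 (enum_rank (e, false))).
pose eqs : set (mpoly #|{: edge G * bool}| CC) := [set p | exists e,
  (e \in T /\ (p = X1 e \/ p = X2 e)) \/ (e \in D /\ p = X2 e)].
pose q : mpoly #|{: edge G * bool}| CC :=
  \prod_(e | e \notin T) ((1 + X1 e * X2 e) * (if e \in C then X2 e else 1)).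
have ev1 c e : meval c (X1 e) = c (enum_rank (e, true)) by rewrite mevalXU.
have ev2 c e : meval c (X2 e) = c (enum_rank (e, false)) by rewrite mevalXU.
have iE w e b : model_iota w (enum_rank (e, b)) =
    if b then (mcoord w e).1 else (mcoord w e).2 by rewrite /model_iota enum_rankK.
have evq c : meval c q = \prod_(e | e \notin T)
   ((1 + c (enum_rank (e, true)) * c (enum_rank (e, false))) *
    (if e \in C then c (enum_rank (e, false)) else 1)).
  rewrite /q rmorph_prod /=; apply: eq_bigr => e _.
  rewrite mevalM mevalD mevalM ev1 ev2 meval1; congr (_ * _).
  by case: ifP => _; rewrite ?ev2 ?meval1.
apply: (@affine_embedded _ _ _ eqs q).
- exact: model_iota_inj.
- move=> w p [e [[eT pE]|[eD ->]]].
    have := svalP w e; rewrite /edge_factor -/(mcoord w e) eT => we.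
    by case: pE => ->; rewrite ?ev1 ?ev2 iE we.
  rewrite ev2 iE; have := svalP w e.
  by rewrite /edge_factor -/(mcoord w e); case: ifP => _ => [->|[_ _ /(_ eD)]].
- move=> w; rewrite evq; apply/prodf_neq0 => e eT.
  rewrite !iE mulf_neq0 ?mcoord_unit //; case: ifP => eC; last exact: oner_neq0.
  by have := svalP w e; rewrite /edge_factor -/(mcoord w e) (negPf eT) => -[_ /(_ eC)].
- move=> c ceq cq.
  pose wf (i : fin #|edge G|) : CC * CC :=
    (c (enum_rank (enum_val (from_fin i), true)),
     c (enum_rank (enum_val (from_fin i), false))).
  have wP e : edge_factor e (wf (to_fin (enum_rank e))).
    rewrite /wf to_finK enum_rankK /edge_factor; case: ifP => eT.
      rewrite -ev1 -ev2 !ceq //; exists e; left; split=> //; [by right|by left].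
    move: cq; rewrite evq => /prodf_neq0/(_ e); rewrite eT => /(_ isT).
    rewrite mulf_eq0 negb_or => /andP[h1 h2]; split=> //=.
      by move=> eC; rewrite eC in h2.
    by move=> eD; rewrite -ev2 ceq //; exists e; right.
  exists (exist _ wf wP); apply/funext => k; rewrite /model_iota.
  case E : (enum_val k) => [e b]; rewrite /mcoord /= /wf to_finK enum_rankK.
  have <- : enum_rank (e, b) = k by rewrite -E enum_valK.
  by case: b {E}.
Qed.

End Model.

(** * The level set and its orbits *)

Section LevelSet.
Variables (G : graph) (eta : vert G -> Cstar).
Implicit Types (z : level_set eta) (e : edge G).

Definition xc z e : CC := (val (Defs.coord (sval z) e)).1.
Definition yc z e : CC := (val (Defs.coord (sval z) e)).2.
Definition mom z e : Cstar := moment (Defs.coord (sval z) e).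

Lemma val_mom z e : val (mom z e) = 1 + xc z e * yc z e. Proof. by []. Qed.

Lemma bd_mom z v : bd (mom z) v = eta v. Proof. exact: (svalP z). Qed.

Definition level_fun (u : edge G -> Bfactor) : fin #|edge G| -> Bfactor :=
  fun i => u (enum_val (from_fin i)).

Lemma coord_level u e : Defs.coord (level_fun u) e = u e.
Proof. by rewrite /Defs.coord /level_fun to_finK enum_rankK. Qed.

Lemma level_exists (u : edge G -> CC * CC) (m : edge G -> Cstar) :
  (forall e, val (m e) = 1 + (u e).1 * (u e).2) -> bd m =1 eta ->
  exists z, forall e, xc z e = (u e).1 /\ yc z e = (u e).2.
Proof.
move=> mu bdm.
have uB e : 1 + (u e).1 * (u e).2 != 0 by rewrite -mu; exact: cstar_neq0.
pose v e : Bfactor := exist _ (u e) (uB e).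
have vP : bd (fun e => moment (Defs.coord (level_fun v) e)) =1 eta.
  move=> w; rewrite -bdm; apply: eq_bd => e; rewrite coord_level.
  by apply: val_inj; rewrite /= mu.
exists (exist _ (level_fun v) vP) => e.
by rewrite /xc /yc [sval _]/(level_fun v) coord_level.
Qed.

Lemma same_orbitE z w : same_orbit z w <-> exists g : vert G -> Cstar,
  forall e, xc w e = val (cobd g e) * xc z e /\
            yc w e = (val (cobd g e))^-1 * yc z e.
Proof.
split=> -[g H]; exists g => e; have := H e; first by rewrite /xc /yc => ->.
by move=> [h1 h2]; rewrite [LHS]surjective_pairing; congr (_, _).
Qed.

Lemma same_orbit_refl z : same_orbit z z.
Proof.
by apply/same_orbitE; exists (fun=> 0) => e; rewrite /cobd subrr invr1 !mul1r.
Qed.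

Lemma same_orbit_sym z w : same_orbit z w -> same_orbit w z.
Proof.
move=> /same_orbitE[g H]; apply/same_orbitE; exists (fun v => - g v) => e.
have [-> ->] := H e; have -> : cobd (fun v => - g v) e = - cobd g e.
  by rewrite /cobd opprB opprK addrC.
move: (cobd g e) => a.
by rewrite cstar_valN invrK mulKf ?mulVKf ?cstar_neq0.
Qed.

Lemma same_orbit_trans z w t : same_orbit z w -> same_orbit w t -> same_orbit z t.
Proof.
move=> /same_orbitE[g H] /same_orbitE[k K]; apply/same_orbitE.
exists (fun v => k v + g v) => e; have [-> ->] := K e; have [-> ->] := H e.
have -> : cobd (fun v => k v + g v) e = cobd k e + cobd g e.
  by rewrite /cobd opprD addrACA.
by move: (cobd k e) (cobd g e) => a b; rewrite cstar_valD invfM !mulrA.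
Qed.

Let X := Bvar eta.
Let LS := level_space eta.

Definition proj z : X := quotient_proj (@same_orbit G eta) z.

Lemma proj_eqP z w : proj z = proj w <-> same_orbit z w.
Proof.
split=> [/(congr1 sval) /= h|zw].
  by rewrite h; exact: same_orbit_refl.
apply: eq_sig_hprop => [? ? ?|]; first exact: Prop_irrelevance.
apply/funext => t; apply/propext; split=> h.
  exact: same_orbit_trans (same_orbit_sym zw) h.
exact: same_orbit_trans zw h.
Qed.

(** A choice of a point in each orbit. *)
Definition reprX (A : X) : level_set eta := sval (cid (svalP A)).

Lemma reprXK A : proj (reprX A) = A.
Proof.
apply: eq_sig_hprop => [? ? ?|]; first exact: Prop_irrelevance.
by rewrite /reprX /=; case: cid => z /= ->.
Qed.

Lemma reprX_orbit z : same_orbit z (reprX (proj z)).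
Proof. by apply/proj_eqP; rewrite reprXK. Qed.

Lemma level_ringed : is_ringed LS. Proof. exact: embedded_ringed. Qed.

Lemma Bvar_ringed : is_ringed X.
Proof. exact: quotient_ringed level_ringed. Qed.

Let RL := level_ringed.
Let RX := Bvar_ringed.
Let TL : zopen [set: LS] := zopenT RL.

Lemma regular_xc e : @regular LS setT (xc^~ e).
Proof.
have := @embedded_coord (level_set eta) _ (fun z k => let: (e, b) := enum_val k in
       let p := val (Defs.coord (sval z) e) in if b then p.1 else p.2)
  (enum_rank (e, true)).
by apply: (regular_eq RL TL) => z _; rewrite enum_rankK.
Qed.

Lemma regular_yc e : @regular LS setT (yc^~ e).
Proof.
have := @embedded_coord (level_set eta) _ (fun z k => let: (e, b) := enum_val k in
       let p := val (Defs.coord (sval z) e) in if b then p.1 else p.2)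
  (enum_rank (e, false)).
by apply: (regular_eq RL TL) => z _; rewrite enum_rankK.
Qed.

(** The locally closed set where [y] does not vanish on [C] and vanishes on [D];
    these conditions are invariant under the group. *)
Definition piece (C D : {set edge G}) : set X := [set A |
  (forall e, e \in C -> yc (reprX A) e != 0) /\
  (forall e, e \in D -> yc (reprX A) e = 0)].

Lemma orbit_yc z w e : same_orbit z w -> (yc w e == 0) = (yc z e == 0).
Proof.
move=> /same_orbitE[g /(_ e)[_ ->]].
by rewrite mulf_eq0 invr_eq0 (negPf (cstar_neq0 _)).
Qed.

Lemma piece_proj C D z : piece C D (proj z) <->
  (forall e, e \in C -> yc z e != 0) /\ (forall e, e \in D -> yc z e = 0).
Proof.
have E e := orbit_yc e (reprX_orbit z).
split=> -[h1 h2]; split=> e eC.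
- by rewrite -E; exact: h1.
- by apply/eqP; rewrite -E; apply/eqP; exact: h2.
- by rewrite E; exact: h1.
- by apply/eqP; rewrite E; apply/eqP; exact: h2.
Qed.

Lemma piece_open C : zopen (piece C finset.set0).
Proof.
have rp : @regular LS setT (fun z => \prod_(e <- enum C) yc z e).
  by apply: (regular_prod RL _ TL) => e; exact: regular_yc.
have o := zopen_neq0 RL TL rp.
suff E : quotient_proj (@same_orbit G eta) @^-1` piece C finset.set0 =
    [set z : LS | [set: LS] z /\ \prod_(e <- enum C) yc z e != 0].
  by move: o; rewrite -E.
apply/seteqP; split=> z; last first.
  move=> [_]; rewrite prodf_seq_neq0 => /allP h.
  apply/piece_proj; split=> e eC; last by rewrite inE in eC.
  by have /h : e \in enum C by rewrite mem_enum.
move=> /piece_proj[h _]; split=> //.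
by rewrite /= prodf_seq_neq0; apply/allP => e; rewrite mem_enum => /h.
Qed.

(** * The chart of a spanning tree *)

Section Chart.
Variable l : seq (edge G * bool).
Hypothesis Gl : grown finset.setT l.
Hypothesis eta_sum : sum_zero eta.
Let T : {set edge G} := [set e | e \in ledges l]%SET.

(** The gauge transformation that normalizes [y] to [1] on the tree, unique up
    to constants. *)
Definition gauge z : vert G -> Cstar :=
  potential (fun e => to_cstar (yc z e)) l.

Lemma cobd_gauge z e : e \in T -> cobd (gauge z) e = to_cstar (yc z e).
Proof. by rewrite inE => eT; exact: potentialP Gl eT. Qed.

Lemma cobdB (g k : vert G -> Cstar) e :
  cobd (fun v => g v - k v) e = cobd g e - cobd k e.
Proof. by rewrite /cobd !opprD !opprK addrACA. Qed.

Lemma cobd_unique (g k : vert G -> Cstar) :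
  (forall e, e \in T -> cobd g e = cobd k e) -> forall e, cobd g e = cobd k e.
Proof.
move=> gk e; pose h v := g v - k v.
have hE f : cobd h f = cobd g f - cobd k f by exact: cobdB.
have h0 : forall u v, u \in finset.setT -> v \in finset.setT -> h u = h v.
  apply: (potential_unique Gl) => f fT; rewrite hE gk ?subrr //.
  by rewrite inE.
apply/eqP; rewrite -subr_eq0 -hE; apply/eqP.
by rewrite /cobd (h0 (hd e) (tl e)) ?subrr ?finset.in_setT.
Qed.

(** The coordinates after the gauge transformation, off the tree. On the tree,
    where [y] is normalized to [1] and [x] is redundant, both are set to [0]. *)
Definition nx z e : CC := if e \in T then 0 else val (cobd (gauge z) e) * xc z e.
Definition ny z e : CC := if e \in T then 0 else (val (cobd (gauge z) e))^-1 * yc z e.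

Lemma normal_mom z e : e \notin T -> 1 + nx z e * ny z e = val (mom z e).
Proof.
move=> eT; rewrite /nx /ny (negPf eT) mulrACA mulfV ?cstar_neq0 //.
by rewrite mul1r.
Qed.

Definition on_tree z := forall e, e \in T -> yc z e != 0.

Lemma on_tree_orbit z w : same_orbit z w -> on_tree z -> on_tree w.
Proof. by move=> zw zT e /zT; rewrite (orbit_yc e zw). Qed.

(** Points in one orbit have the same normalized coordinates, since the
    transformation between them is absorbed by the gauge, up to a constant. *)
Lemma gauge_orbit z w : on_tree z -> same_orbit z w ->
  forall e, nx w e = nx z e /\ ny w e = ny z e.
Proof.
move=> zT zw; have wT := on_tree_orbit zw zT; move: zw => /same_orbitE[g H].
have key e : cobd (gauge w) e = cobd (fun v => gauge z v - g v) e.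
  apply: cobd_unique => f fT; rewrite cobd_gauge //.
  rewrite cobdB.
  rewrite cobd_gauge //; apply: val_inj.
  have := wT f fT; have := zT f fT; have [_ ->] := H f.
  move: (cobd g f) => a yz yw; rewrite cstar_valD cstar_valN !val_to_cstar //.
  by rewrite mulrC.
move=> e; rewrite /nx /ny; case: ifP => // _; have [-> ->] := H e.
rewrite key cobdB.
move: (cobd (gauge z) e) (cobd g e) => a b.
rewrite cstar_valD cstar_valN invfM invrK !mulrA.
by split; congr (_ * _); rewrite ?mulfVK ?mulfK ?cstar_neq0.
Qed.

(** The coordinates on the edges of the tree are recovered from the moment map
    equations: the moments off the tree are known, and those on the tree are the
    flow that balances them. *)
Definition off_tree (u : edge G -> CC * CC) e : Cstar :=
  if e \in T then 0 else to_cstar (1 + (u e).1 * (u e).2).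

Definition total_mom (u : edge G -> CC * CC) e : Cstar :=
  off_tree u e + flow (fun v => eta v - bd (off_tree u) v) l e.

Lemma bd_total_mom u v : bd (total_mom u) v = eta v.
Proof.
exact: flow_completion.
Qed.

Lemma total_mom_off u e : e \notin T -> 1 + (u e).1 * (u e).2 != 0 ->
  val (total_mom u e) = 1 + (u e).1 * (u e).2.
Proof.
move=> eT u0; rewrite /total_mom /off_tree (negPf eT) flow_supp ?addr0.
  by rewrite val_to_cstar.
by move: eT; rewrite inE.
Qed.

Definition fill (u : edge G -> CC * CC) e : CC * CC :=
  if e \in T then (val (total_mom u e) - 1, 1) else u e.

Lemma fill_exists u : (forall e, e \notin T -> 1 + (u e).1 * (u e).2 != 0) ->
  exists z, forall e, xc z e = (fill u e).1 /\ yc z e = (fill u e).2.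
Proof.
move=> u0; apply: (level_exists (m := total_mom u)); last exact: bd_total_mom.
move=> e; rewrite /fill; case: ifP => eT.
  by rewrite -[RHS]/(1 + (val (total_mom u e) - 1) * 1) mulr1 addrC subrK.
by rewrite total_mom_off ?eT // u0 ?eT.
Qed.

Lemma fill_gauge u z : (forall e, xc z e = (fill u e).1 /\ yc z e = (fill u e).2) ->
  forall e, e \notin T -> nx z e = (u e).1 /\ ny z e = (u e).2.
Proof.
move=> zu; have g0 e : cobd (gauge z) e = cobd (fun=> 0) e.
  apply: cobd_unique => f fT; rewrite cobd_gauge //; apply: val_inj.
  have [_ ->] := zu f; rewrite /fill fT /cobd subrr val_to_cstar //.
  exact: oner_neq0.
move=> e eT; rewrite /nx /ny (negPf eT) g0 /cobd subrr invr1 !mul1r.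
by have [-> ->] := zu e; rewrite /fill (negPf eT).
Qed.

(** A point is in the orbit of the point rebuilt from its normalized
    coordinates: both satisfy the moment equations with the same moments off the
    tree, and a flow on the tree is unique. *)
Lemma fill_orbit z w : on_tree z ->
  (forall e, xc w e = (fill (fun f => (nx z f, ny z f)) e).1 /\
             yc w e = (fill (fun f => (nx z f, ny z f)) e).2) ->
  same_orbit z w.
Proof.
move=> zT wE; apply/same_orbitE; exists (gauge z).
pose u f := (nx z f, ny z f).
have uE e : e \notin T -> 1 + (u e).1 * (u e).2 = 1 + xc z e * yc z e.
  exact: normal_mom.
have momE e : total_mom u e = mom z e.
  apply/eqP; rewrite -subr_eq0; apply/eqP; move: e.
  apply: (flow_unique Gl) => [e eT|v]; last first.
    by rewrite bdB bd_total_mom bd_mom subrr.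
  have {}eT : e \notin T by rewrite inE.
  apply/eqP; rewrite subr_eq0; apply/eqP/val_inj.
  apply: (etrans (total_mom_off eT _)); last by rewrite uE.
  by rewrite uE // -val_mom cstar_neq0.
move=> e; have [-> ->] := wE e; rewrite -/u /fill; case: ifP => eT; last first.
  by rewrite /u /nx /ny eT.
rewrite cobd_gauge // val_to_cstar; last exact: zT.
split; last by rewrite mulVf // zT.
rewrite -[LHS]/(val (total_mom u e) - 1) momE val_mom.
by rewrite mulrC addrAC subrr add0r.
Qed.

Let U := [set z : LS | on_tree z].

Lemma on_tree_open : @zopen LS U.
Proof.
suff <- : quotient_proj (@same_orbit G eta) @^-1` piece T finset.set0 = U.
  exact: (piece_open T).
apply/seteqP; split=> z; first by move=> /piece_proj[].
by move=> zT; apply/piece_proj; split=> // e; rewrite inE.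
Qed.

(** The gauge is a product of coordinates [y] of the tree and of their inverses.
    *)
Lemma gauge_regular e : cstar_regular U (fun z => cobd (gauge z) e).
Proof.
have oU := on_tree_open.
have P0 : cstar_regular U (fun=> 0) by exact: (cstar_regular0 RL).
have PN f : cstar_regular U f -> cstar_regular U (fun z => - f z).
  exact: (cstar_regularN RL).
have PD f g : cstar_regular U f -> cstar_regular U g ->
    cstar_regular U (fun z => f z + g z) by exact: (cstar_regularD RL).
have gv v : cstar_regular U (fun z => gauge z v).
  apply: (potential_closed P0 PN PD) => f fT.
  apply: (regular_eq RL oU (f := yc^~ f)).
    by move=> z zT; rewrite val_to_cstar //; apply: zT; rewrite inE.
  exact: (regular_sub RL TL oU _ (regular_yc f)).
by apply: PD => //; exact: PN.
Qed.

Lemma nx_regular e : @regular LS U (nx^~ e).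
Proof.
have oU := on_tree_open; rewrite /nx; case: (boolP (e \in T)) => _; first exact: (regular_cst RL).
apply: (regularM RL oU); first exact: gauge_regular.
exact: (regular_sub RL TL oU _ (regular_xc e)).
Qed.

Lemma ny_regular e : @regular LS U (ny^~ e).
Proof.
have oU := on_tree_open; rewrite /ny; case: (boolP (e \in T)) => _; first exact: (regular_cst RL).
apply: (regularM RL oU).
  apply: (regularV_unit RL oU); first exact: gauge_regular.
  by move=> z _; exact: cstar_neq0.
exact: (regular_sub RL TL oU _ (regular_yc e)).
Qed.

(** A function on the quotient is regular if the invariant function that it
    comes from is. *)
Lemma descend_regular (f : level_set eta -> CC) :
  (forall z w, on_tree z -> same_orbit z w -> f w = f z) ->
  @regular LS U f -> @regular X (piece T finset.set0) (fun A => f (reprX A)).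
Proof.
move=> finv rf; have oU := on_tree_open.
have UE : quotient_proj (@same_orbit G eta) @^-1` (piece T finset.set0) = U.
  apply/seteqP; split=> z; first by move=> /piece_proj[].
  by move=> zT; apply/piece_proj; split=> // e; rewrite inE.
suff : @regular LS U ((fun A => f (reprX A)) \o quotient_proj (@same_orbit G eta)).
  by rewrite -UE.
apply: (regular_eq RL oU _ rf) => z zT.
by rewrite -[RHS]/(f (reprX (proj z))) (finv _ _ zT (reprX_orbit z)).
Qed.

Lemma nxX_regular e : @regular X (piece T finset.set0) (fun A => nx (reprX A) e).
Proof.
apply: (@descend_regular (nx^~ e)); last exact: nx_regular.
by move=> z w zT zw; have [] := gauge_orbit zT zw e.
Qed.

Lemma nyX_regular e : @regular X (piece T finset.set0) (fun A => ny (reprX A) e).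
Proof.
apply: (@descend_regular (ny^~ e)); last exact: ny_regular.
by move=> z w zT zw; have [] := gauge_orbit zT zw e.
Qed.

(** A point is determined up to the group by its normalized coordinates. *)
Lemma chart_inj z w : on_tree z -> on_tree w ->
  (forall e, nx z e = nx w e /\ ny z e = ny w e) -> same_orbit z w.
Proof.
move=> zT wT zw.
have uE : (fun f => (nx z f, ny z f)) = (fun f => (nx w f, ny w f)).
  by apply/funext => f; have [-> ->] := zw f.
have [t tE] : exists t, forall e,
    xc t e = (fill (fun f => (nx z f, ny z f)) e).1 /\
    yc t e = (fill (fun f => (nx z f, ny z f)) e).2.
  by apply: fill_exists => e eT; rewrite normal_mom // cstar_neq0.
apply: (same_orbit_trans (fill_orbit zT tE)); apply: same_orbit_sym.
by apply: fill_orbit => //; rewrite -uE.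
Qed.

Variables C D : {set edge G}.
Hypotheses (TC : T \subset C) (TD : forall e, e \in T -> e \notin D).

Let M := embedded (@model_iota G T C D).
Let RM : is_ringed M := embedded_ringed _.
Let TM : zopen [set: M] := zopenT RM.

Lemma total_mom_regular e :
  @cstar_regular M setT (fun w => total_mom (mcoord w) e).
Proof.
have P0 : @cstar_regular M setT (fun=> 0) by exact: (cstar_regular0 RM).
have PN f : @cstar_regular M setT f -> @cstar_regular M setT (fun w => - f w).
  exact: (cstar_regularN RM).
have PD f g : @cstar_regular M setT f -> @cstar_regular M setT g ->
    @cstar_regular M setT (fun w => f w + g w) by exact: (cstar_regularD RM).
have Poff f : @cstar_regular M setT (fun w => off_tree (mcoord w) f).
  rewrite /off_tree; case: (boolP (f \in T)) => _ //.
  apply: (regular_eq RM TM (f := fun w => 1 + (mcoord w f).1 * (mcoord w f).2)).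
    by move=> w _; rewrite val_to_cstar ?mcoord_unit.
  apply: (regularD RM TM); first exact: (regular_cst RM).
  by apply: (regularM RM TM); [exact: mcoord1_regular|exact: mcoord2_regular].
apply: (PD _ _) => //.
apply: (flow_closed (b := fun w v => eta v - bd (off_tree (mcoord w)) v) P0 PN PD).
move=> v; apply: (PD _ _); first exact: (cstar_regular_cst RM).
by apply: (PN _); exact: (bd_closed (a := fun w => off_tree (mcoord w)) P0 PN PD).
Qed.

Lemma model_level_exists (w : model T C D) :
  exists z, forall e, xc z e = (fill (mcoord w) e).1 /\ yc z e = (fill (mcoord w) e).2.
Proof. by apply: fill_exists => e _; exact: mcoord_unit. Qed.

Definition model_level (w : model T C D) : level_set eta := sval (cid (model_level_exists w)).

Lemma model_levelE w e : xc (model_level w) e = (fill (mcoord w) e).1 /\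
  yc (model_level w) e = (fill (mcoord w) e).2.
Proof. by rewrite /model_level; case: cid. Qed.

Lemma model_level_morphism : @morphism M LS model_level.
Proof.
apply: morphism_embedded => // k; case E : (enum_val k) => [e b].
have rT (c : bool) : @regular M setT (fun w =>
    if c then xc (model_level w) e else yc (model_level w) e).
  case: c.
    apply: (regular_eq RM TM (f := fun w => if e \in T then
        val (total_mom (mcoord w) e) - 1 else (mcoord w e).1)).
      by move=> w _; have [-> _] := model_levelE w e; rewrite /fill; case: ifP.
    case: (boolP (e \in T)) => _; last exact: mcoord1_regular.
    apply: (regularD RM TM); first exact: total_mom_regular.
    exact: (regular_cst RM).
  apply: (regular_eq RM TM (f := fun w => if e \in T then 1 else (mcoord w e).2)).
    by move=> w _; have [_ ->] := model_levelE w e; rewrite /fill; case: ifP.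
  by case: (boolP (e \in T)) => _; [exact: (regular_cst RM)|exact: mcoord2_regular].
exact: rT b.
Qed.

Lemma model_level_piece w : piece C D (proj (model_level w)).
Proof.
apply/piece_proj; split=> e eC; have [_ ->] := model_levelE w e; rewrite /fill.
  have := svalP w e; rewrite /edge_factor -/(mcoord w e); case: ifP => eT.
    by move=> _; exact: oner_neq0.
  by move=> [_ /(_ eC)].
have eT : e \notin T by apply: contraL eC => /TD.
by have := svalP w e; rewrite /edge_factor -/(mcoord w e) (negPf eT) => -[_ _ /(_ eC)].
Qed.

Lemma piece_on_tree A : piece C D A -> on_tree (reprX A).
Proof. by move=> [h _] e eT; apply: h; exact: (fintype.subsetP TC). Qed.

Lemma normal_factor A e : piece C D A ->
  edge_factor T C D e (nx (reprX A) e, ny (reprX A) e).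
Proof.
move=> pA; have AT := piece_on_tree pA; rewrite /edge_factor.
case: ifP => eT; first by rewrite /nx /ny eT.
have [h1 h2] := pA; split.
- by rewrite normal_mom ?eT // cstar_neq0.
- by move=> /h1 yA; rewrite /ny eT mulf_neq0 // invr_neq0 // cstar_neq0.
- by move=> /h2 yA; rewrite /ny eT yA mulr0.
Qed.

Definition normal_fun (A : X) (i : fin #|edge G|) : CC * CC :=
  let e := enum_val (from_fin i) in (nx (reprX A) e, ny (reprX A) e).

Lemma normal_funE A e :
  normal_fun A (to_fin (enum_rank e)) = (nx (reprX A) e, ny (reprX A) e).
Proof. by rewrite /normal_fun to_finK enum_rankK. Qed.

Lemma to_model_subproof (A : subfspace (piece C D)) e :
  edge_factor T C D e (normal_fun (sval A) (to_fin (enum_rank e))).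
Proof. by rewrite normal_funE; apply: normal_factor; case: A. Qed.

Definition to_model (A : subfspace (piece C D)) : model T C D :=
  exist _ _ (to_model_subproof A).

Lemma mcoord_to_model A e :
  mcoord (to_model A) e = (nx (reprX (sval A)) e, ny (reprX (sval A)) e).
Proof. exact: normal_funE. Qed.

(** Normalized coordinates in one direction, and filling in the tree in the
    other. *)
Theorem chart : isomorphic (subfspace (piece C D)) M.
Proof.
have RS := subfspace_ringed (piece C D) RX.
have sub : piece C D `<=` piece T finset.set0.
  move=> A [h _]; split=> e; last by rewrite inE.
  by move=> eT; apply: h; exact: (fintype.subsetP TC).
exists to_model, (fun w => exist _ (proj (model_level w)) (model_level_piece w)).
split.
- apply: (morphism_embedded RS) => k; rewrite /model_iota.
  case: (enum_val k) => e b; case: b.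
    apply: (regular_eq RS (zopenT RS) (f := fun A => nx (reprX (sval A)) e)).
      by move=> A _; rewrite mcoord_to_model.
    exact: (@regular_sval X _ _ (fun A => nx (reprX A) e) (piece_open T) sub
      (nxX_regular e)).
  apply: (regular_eq RS (zopenT RS) (f := fun A => ny (reprX (sval A)) e)).
    by move=> A _; rewrite mcoord_to_model.
  exact: (@regular_sval X _ _ (fun A => ny (reprX A) e) (piece_open T) sub
    (nyX_regular e)).
- apply: (@morphism_sub M X (piece C D) (fun w => proj (model_level w))
    model_level_piece RM).
  exact (morphism_comp model_level_morphism (@quotient_proj_morphism LS _)).
- move=> A; apply: eq_sig_hprop => [? ? ?|]; first exact: Prop_irrelevance.
  rewrite /= -[RHS]reprXK; apply/proj_eqP/same_orbit_sym.
  apply: fill_orbit; first by apply: piece_on_tree; case: A.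
  move=> e; have [-> ->] := model_levelE (to_model A) e.
  rewrite (_ : mcoord (to_model A) = fun f => (nx (reprX (sval A)) f, ny (reprX (sval A)) f)) //.
  by apply/funext => f; rewrite mcoord_to_model.
- move=> w; apply: model_ext => e; rewrite mcoord_to_model /=.
  have ot : on_tree (model_level w).
    move=> f fT; have [_ ->] := model_levelE w f; rewrite /fill fT.
    exact: oner_neq0.
  have [-> ->] := gauge_orbit ot (reprX_orbit (model_level w)) e.
  have [eT|eT] := boolP (e \in T).
    rewrite /nx /ny eT; have := svalP w e.
    by rewrite /edge_factor -/(mcoord w e) eT => ->.
  have [-> ->] := fill_gauge (model_levelE w) eT.
  by rewrite -surjective_pairing.
Qed.

End Chart.

End LevelSet.

(** * The pieces are varieties *)

Section PieceVariety.
Variables (G : graph) (eta : vert G -> Cstar).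
Hypothesis eta_sum : sum_zero eta.
Hypothesis eta_gen : generic eta.
Let X := Bvar eta.
Let RX : is_ringed X := Bvar_ringed eta.
Implicit Types (z : level_set eta) (e : edge G) (S C D : {set edge G}).

Lemma mom_neq0 z e : mom z e != 0 -> yc z e != 0.
Proof.
apply: contraNneq => y0; apply/eqP/val_inj.
by rewrite val_mom y0 mulr0 addr0.
Qed.

(** The moments solve [bd a = eta], so this is the connectedness provided by
    genericity. *)
Lemma mom_connected z : gconnected (subgraph [set e | mom z e != 0]%SET).
Proof. by apply: eta_gen => v; exact: bd_mom. Qed.

Lemma support_connected z : gconnected (subgraph [set e | yc z e != 0]%SET).
Proof.
apply: subgraph_connectedS (mom_connected z).
by apply/fintype.subsetP => e; rewrite !inE; exact: mom_neq0.
Qed.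

Lemma piece_disconnected S (A : X) : ~~ gconnected (subgraph S) ->
  ~ piece S (~: S)%SET A.
Proof.
move=> /negP Sn [h1 h2]; apply: Sn.
suff -> : S = [set e | yc (reprX A) e != 0]%SET by exact: support_connected.
apply/setP => e; rewrite inE; apply/idP/idP => [/h1 //|].
by apply: contraR => eS; apply/eqP/h2; rewrite inE.
Qed.

Lemma orbit_xy z w e : same_orbit z w -> xc w e * yc w e = xc z e * yc z e.
Proof.
move=> /same_orbitE[g /(_ e)[-> ->]].
by rewrite mulrACA divff ?mul1r // cstar_neq0.
Qed.

(** The products [x y] are functions on the quotient. When they agree at two
    points, these have the same moments, hence lie in the chart of a common
    spanning tree, where the normalized coordinates separate them. *)
Lemma Bvar_separating : separating X.
Proof.
move=> A B AB; pose z := reprX A; pose w := reprX B.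
have [[e ze]|zw] := pselect (exists e, xc z e * yc z e != xc w e * yc w e).
  exists setT, (fun A => xc (reprX A) e * yc (reprX A) e); split=> //.
    exact: zopenT RX.
  have RL := level_ringed eta.
  suff : @regular (level_space eta) setT
    ((fun A => xc (reprX A) e * yc (reprX A) e) \o quotient_proj (@same_orbit G eta)) by [].
  apply: (regular_eq RL (zopenT RL) (f := fun z => xc z e * yc z e)).
    move=> t _; rewrite -(orbit_xy e (reprX_orbit t)) //.
  by apply: (regularM RL (zopenT RL)); [exact: regular_xc|exact: regular_yc].
have zwE e : xc z e * yc z e = xc w e * yc w e.
  by apply/eqP/negPn/negP => ze; apply: zw; exists e.
have momE e : mom z e = mom w e by apply: val_inj; rewrite !val_mom zwE.
have [l Gl lS] := grown_exists (mom_connected z).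
have zT : on_tree l z.
  by move=> e; rewrite inE => /lS; rewrite inE => /mom_neq0.
have wT : on_tree l w.
  by move=> e; rewrite inE => /lS; rewrite inE momE => /mom_neq0.
have [[e ne]|nn] := pselect (exists e, (nx l z e != nx l w e) \/ (ny l z e != ny l w e)).
  exists (piece [set e in ledges l]%SET finset.set0).
  have pA : piece [set e in ledges l]%SET finset.set0 A.
    by split=> f; rewrite ?inE // => fT; apply: zT; rewrite inE.
  have pB : piece [set e in ledges l]%SET finset.set0 B.
    by split=> f; rewrite ?inE // => fT; apply: wT; rewrite inE.
  case: ne => ne.
    exists (fun A => nx l (reprX A) e); split=> //; first exact: piece_open.
    exact: nxX_regular.
  exists (fun A => ny l (reprX A) e); split=> //; first exact: piece_open.
  exact: nyX_regular.
case: AB; rewrite -(reprXK A) -(reprXK B); apply/proj_eqP.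
apply: (chart_inj Gl eta_sum zT wT) => e; split.
  by apply/eqP/negPn/negP => h; apply: nn; exists e; left.
by apply/eqP/negPn/negP => h; apply: nn; exists e; right.
Qed.

(** The sets whose chart covers a part of the piece on which [y] vanishes on
    [D]. *)
Definition chart_support D S := gconnected (subgraph S) && [disjoint S & D].

Lemma piece_affine C D S : chart_support D S ->
  affine (subfspace (piece (eta := eta) (C :|: S)%SET D)).
Proof.
move=> /andP[Sc SD]; have [l Gl lS] := grown_exists Sc.
have TS : [set e in ledges l]%SET \subset S.
  by apply/fintype.subsetP => e; rewrite inE => /lS.
apply: (@affine_iso _ _ (chart Gl eta_sum _ _) (affine_model _ _ _)).
  by apply: (fintype.subset_trans TS); exact: finset.subsetUr.
by move=> e /(fintype.subsetP TS) eS; rewrite (disjointFr SD).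
Qed.

(** The charts [y <> 0] on [S], for connected [S] disjoint from [D], cover the
    piece; on each of them the piece is a model, hence affine. *)
Lemma piece_variety C D : is_variety (subfspace (piece (eta := eta) C D)).
Proof.
have RS := subfspace_ringed (piece (eta := eta) C D) RX.
apply: (@variety_cover (subfspace (piece (eta := eta) C D))
  {S : {set edge G} | chart_support D S}
  (fun i => [set A | piece (val i) finset.set0 (sval A)]) RS).
- exact: separating_sub Bvar_separating.
- by move=> i; exists (piece (val i) finset.set0) => //; exact: piece_open.
- move=> [A [h1 h2]].
  have SP : chart_support D [set e | yc (reprX A) e != 0]%SET.
    rewrite /chart_support support_connected /=.
    rewrite finset.disjoints_subset; apply/fintype.subsetP => e; rewrite !inE.
    by apply: contra => /h2 /eqP.
  exists (exist (fun S => chart_support _ S) _ SP); split=> e; rewrite ?inE //=.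
- move=> [S SP] /=.
  apply: (@affine_iso _ (subfspace (piece (C :|: S)%SET D))); last exact: piece_affine.
  apply: isomorphic_subsub => //.
    move=> [A [h1 h2]] /=; split=> -[h3 h4]; split=> e.
    + by move=> eS; apply: h3; rewrite inE eS orbT.
    + by rewrite inE.
    + by rewrite inE => /orP[/h1|/h3].
    + exact: h2.
  by move=> A [h1 h2]; split=> // e eC; apply: h1; rewrite inE eC.
Qed.

Lemma piece0T : piece (eta := eta) finset.set0 finset.set0 = setT.
Proof. by apply/seteqP; split=> // A _; split=> e; rewrite inE. Qed.

Theorem Bvar_variety : is_variety X.
Proof.
apply: (@variety_cover X {S : {set edge G} | chart_support finset.set0 S}
  (fun i => piece (val i) finset.set0) RX).
- exact: Bvar_separating.
- by move=> i; exact: piece_open.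
- move=> A.
  have SP : chart_support finset.set0 [set e | yc (reprX A) e != 0]%SET.
    by rewrite /chart_support support_connected disjoint_sym finset.disjoints_subset finset.sub0set.
  by exists (exist (fun S => chart_support _ S) _ SP); split=> e; rewrite ?inE.
- by move=> [S SP]; have := piece_affine finset.set0 SP; rewrite finset.set0U.
Qed.

Lemma mc_Bvar_piece :
  motivic_class X = motivic_class (subfspace (piece (eta := eta) finset.set0 finset.set0)).
Proof.
apply: mc_iso; [exact: Bvar_variety|exact: piece_variety|].
by rewrite piece0T; apply: isomorphic_sym; apply: isomorphic_setT; case: RX.
Qed.

(** The locus [y = 0] of the edge [e] is closed in the piece. *)
Lemma mc_piece_split C D e :
  motivic_class (subfspace (piece (eta := eta) C D)) =
  motivic_class (subfspace (piece (eta := eta) (e |: C)%SET D)) +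
  motivic_class (subfspace (piece (eta := eta) C (e |: D)%SET)).
Proof.
pose P := piece (eta := eta) C D.
pose S : set (subfspace P) := [set A | yc (reprX (sval A)) e = 0].
have iso1 : isomorphic (subfspace (~` S)) (subfspace (piece (eta := eta) (e |: C)%SET D)).
  apply: (@isomorphic_subsub X P (~` S) _ RX).
    move=> [A [h1 h2]] /=; split.
      by move=> [h3 h4] /= /eqP; apply/negP/h3; rewrite !inE eqxx.
    move=> /= /eqP ye; split=> // f; rewrite !inE => /orP[/eqP->|/h1] //.
  by move=> A [h1 h2]; split=> // f fC; apply: h1; rewrite !inE fC orbT.
have iso2 : isomorphic (subfspace S) (subfspace (piece (eta := eta) C (e |: D)%SET)).
  apply: (@isomorphic_subsub X P S _ RX).
    move=> [A [h1 h2]] /=; split.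
      by move=> [h3 h4]; apply: h4; rewrite !inE eqxx.
    by move=> ye; split=> // f; rewrite !inE => /orP[/eqP->|/h2].
  by move=> A [h1 h2]; split=> // f fC; apply: h2; rewrite !inE fC orbT.
apply: (@mc_scissor _ _ _ S); try exact: piece_variety.
- exists (piece [set e]%SET finset.set0); first exact: piece_open.
  apply/seteqP; split=> -[A pA] /=.
    by move=> /eqP ye; split=> f; rewrite inE // => /eqP->.
  by move=> [h _] /eqP; apply/negP/h; rewrite inE.
- exact: isomorphic_sym.
- exact: isomorphic_sym.
Qed.

End PieceVariety.

(** * Classes of the models *)

Lemma regular_pull (Y Z : fspace) (f : Y -> Z) (h : Z -> CC) : is_ringed Z ->
  morphism f -> regular [set: Z] h -> regular [set: Y] (fun y => h (f y)).
Proof. by move=> RZ mf rh; have [_ /(_ _ rh)] := mf setT (zopenT RZ). Qed.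

Lemma morphism_join (Z : fspace) (A B : Type) n m (iota : A -> 'I_n -> CC)
    (iota' : B -> 'I_m -> CC) (f : Z -> A * B) : is_ringed Z ->
  @morphism Z (embedded iota) (fun z => (f z).1) ->
  @morphism Z (embedded iota') (fun z => (f z).2) ->
  @morphism Z (embedded (join_iota iota iota')) f.
Proof.
move=> RZ m1 m2; apply: morphism_embedded => // i.
have TZ := zopenT RZ; rewrite -(splitK i); case: (fintype.split i) => k /=.
  apply: (regular_eq RZ TZ (f := fun z => iota (f z).1 k)).
    by move=> z _; rewrite /join_iota join_faml.
  apply: (regular_pull (embedded_ringed _) m1 (@embedded_coord _ _ iota k)).
apply: (regular_eq RZ TZ (f := fun z => iota' (f z).2 k)).
  by move=> z _; rewrite /join_iota join_famr.
apply: (regular_pull (embedded_ringed _) m2 (@embedded_coord _ _ iota' k)).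
Qed.

Section Models.
Variables (G : graph) (T C D : {set edge G}).
Implicit Types (e : edge G).

Lemma model_exists (u : edge G -> CC * CC) : (forall e, edge_factor T C D e (u e)) ->
  exists w : model T C D, forall e, mcoord w e = u e.
Proof.
move=> uP; pose v (i : fin #|edge G|) := u (enum_val (from_fin i)).
have vE e : v (to_fin (enum_rank e)) = u e by rewrite /v to_finK enum_rankK.
have vP e : edge_factor T C D e (v (to_fin (enum_rank e))) by rewrite vE.
by exists (exist _ v vP) => e; rewrite /mcoord /= vE.
Qed.

Definition model_of u (uP : forall e, edge_factor T C D e (u e)) : model T C D :=
  sval (cid (model_exists uP)).

Lemma model_ofE u (uP : forall e, edge_factor T C D e (u e)) e :
  mcoord (model_of uP) e = u e.
Proof. by rewrite /model_of; case: cid. Qed.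

Lemma mcoordP (w : model T C D) e : edge_factor T C D e (mcoord w e).
Proof. exact: svalP w e. Qed.

Lemma morphism_model (Z : fspace) (f : Z -> model T C D) : is_ringed Z ->
  (forall e, regular [set: Z] (fun z => (mcoord (f z) e).1)) ->
  (forall e, regular [set: Z] (fun z => (mcoord (f z) e).2)) ->
  @morphism Z (embedded (@model_iota G T C D)) f.
Proof.
move=> RZ r1 r2; apply: morphism_embedded => // k.
have TZ := zopenT RZ; case E : (enum_val k) => [e b]; case: b E => E.
  by apply: (regular_eq RZ TZ _ (r1 e)) => z _; rewrite /model_iota E.
by apply: (regular_eq RZ TZ _ (r2 e)) => z _; rewrite /model_iota E.
Qed.

Lemma model_variety : is_variety (embedded (@model_iota G T C D)).
Proof.
by apply: variety_embedded; [exact: model_iota_inj|exact: affine_model].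
Qed.

End Models.

(** The factor of an edge outside the tree, as the model of the graph with one
    edge, so that it is a variety like all the models. *)
Definition plane (c d : bool) : fspace := embedded
  (@model_iota loop_graph finset.set0 [set x | c]%SET [set x | d]%SET).

Lemma plane_variety c d : is_variety (plane c d).
Proof. exact: model_variety. Qed.

Lemma factor_plane c d (p : CC * CC) :
  @edge_factor loop_graph finset.set0 [set x | c]%SET [set x | d]%SET tt p <->
  [/\ 1 + p.1 * p.2 != 0, c -> p.2 != 0 & d -> p.2 = 0].
Proof. by rewrite /edge_factor !inE /=; split=> -[h1 h2 h3]; split=> //; rewrite ?inE // => h; apply: h2 + apply: h3; rewrite ?inE. Qed.

Section SplitModel.
Variables (G : graph) (T C D : {set edge G}) (e : edge G).
Hypothesis eT : e \notin T.
Let T1 : {set edge G} := (e |: T)%SET.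
Let M := embedded (@model_iota G T C D).
Let M1 := embedded (@model_iota G T1 C D).
Let P := plane (e \in C) (e \in D).
Let RM : is_ringed M := embedded_ringed _.
Let E := embedded (join_iota
  (@model_iota loop_graph finset.set0 [set x | e \in C]%SET [set x | e \in D]%SET)
  (@model_iota G T1 C D)).
Let RE : is_ringed E := embedded_ringed _.

Let fst_fun (w : M) (_ : unit) : CC * CC := mcoord w e.

Lemma fst_funP w (x : unit) : @edge_factor loop_graph finset.set0
  [set x | e \in C]%SET [set x | e \in D]%SET x (fst_fun w x).
Proof.
by case: x; apply/factor_plane; have := mcoordP w e; rewrite /edge_factor (negPf eT).
Qed.

Let snd_fun (w : M) f : CC * CC := if f == e then (0, 0) else mcoord w f.

Lemma snd_funP w f : edge_factor T1 C D f (snd_fun w f).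
Proof.
rewrite /snd_fun /edge_factor !inE; case: eqP => //= _; exact: mcoordP.
Qed.

Let join_fun (p : E) f : CC * CC :=
  if f == e then @mcoord loop_graph _ _ _ p.1 tt else mcoord p.2 f.

Lemma join_funP p f : edge_factor T C D f (join_fun p f).
Proof.
rewrite /join_fun; case: eqP => [->|/eqP fe].
  by rewrite /edge_factor (negPf eT); apply/factor_plane; exact: (mcoordP p.1 tt).
have := mcoordP p.2 f; rewrite /edge_factor !inE (negPf fe) /=; exact.
Qed.

(** The factor of [e] is split off by enlarging [T], which replaces this factor
    by a point. *)
Lemma isomorphic_split_model : isomorphic M (product P M1).
Proof.
apply: isomorphic_trans (isomorphic_product _ _).
exists (fun w => (@model_of loop_graph _ _ _ _ (fst_funP w), model_of (snd_funP w)) : E).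
exists (fun p => model_of (join_funP p)).
split.
- apply: morphism_join => //; apply: morphism_model => // f.
  + apply: (regular_eq RM (zopenT RM) _ (@mcoord1_regular G T C D e)) => w _.
    by rewrite model_ofE.
  + apply: (regular_eq RM (zopenT RM) _ (@mcoord2_regular G T C D e)) => w _.
    by rewrite model_ofE.
  + apply: (regular_eq RM (zopenT RM)
      (f := fun w => if f == e then 0 else (mcoord w f).1)).
      by move=> w _; rewrite model_ofE /snd_fun; case: ifP.
    case: (f == e); [exact: (regular_cst RM _ (zopenT RM))|exact: mcoord1_regular].
  + apply: (regular_eq RM (zopenT RM)
      (f := fun w => if f == e then 0 else (mcoord w f).2)).
      by move=> w _; rewrite model_ofE /snd_fun; case: ifP.
    case: (f == e); [exact: (regular_cst RM _ (zopenT RM))|exact: mcoord2_regular].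
- have mf := @join_fst_morphism _ _ _ _
    (@model_iota loop_graph finset.set0 [set x | e \in C]%SET [set x | e \in D]%SET)
    (@model_iota G T1 C D).
  have ms := @join_snd_morphism _ _ _ _
    (@model_iota loop_graph finset.set0 [set x | e \in C]%SET [set x | e \in D]%SET)
    (@model_iota G T1 C D).
  apply: morphism_model => // f.
    apply: (regular_eq RE (zopenT RE) (f := fun p => if f == e then
        (@mcoord loop_graph _ _ _ p.1 tt).1 else (mcoord p.2 f).1)).
      by move=> p _; rewrite model_ofE /join_fun; case: ifP.
    case: (f == e).
      exact: (regular_pull (embedded_ringed _) mf (@mcoord1_regular loop_graph _ _ _ tt)).
    exact: (regular_pull (embedded_ringed _) ms (@mcoord1_regular _ _ _ _ f)).
  apply: (regular_eq RE (zopenT RE) (f := fun p => if f == e then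
      (@mcoord loop_graph _ _ _ p.1 tt).2 else (mcoord p.2 f).2)).
    by move=> p _; rewrite model_ofE /join_fun; case: ifP.
  case: (f == e).
    exact: (regular_pull (embedded_ringed _) mf (@mcoord2_regular loop_graph _ _ _ tt)).
  exact: (regular_pull (embedded_ringed _) ms (@mcoord2_regular _ _ _ _ f)).
- move=> w; apply: model_ext => f; rewrite model_ofE /join_fun /= !model_ofE.
  by rewrite /fst_fun /snd_fun; case: eqP => [->|].
- move=> [p q]; congr (_, _); apply: model_ext => f; rewrite model_ofE.
    by rewrite /fst_fun model_ofE /join_fun eqxx; case: f.
  rewrite /snd_fun model_ofE /join_fun /=; case: eqP => // ->.
  by have := mcoordP q e; rewrite /edge_factor !inE eqxx.
Qed.

End SplitModel.

Section ModelClass.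
Variables (G : graph) (C D : {set edge G}).
Implicit Types (T : {set edge G}) (e : edge G).

Lemma mc_model_full : motivic_class (embedded (@model_iota G finset.setT C D)) = 1.
Proof.
apply: mc_point; first exact: model_variety.
have P e : edge_factor finset.setT C D e (0, 0) by rewrite /edge_factor !inE.
exists (model_of P) => w; apply: model_ext => e; rewrite model_ofE.
by have := mcoordP w e; rewrite /edge_factor !inE.
Qed.

Lemma mc_model T : motivic_class (embedded (@model_iota G T C D)) =
  \prod_(e | e \notin T) motivic_class (plane (e \in C) (e \in D)).
Proof.
have [n] := ubnP #|(~: T)%SET|; elim: n T => // n IH T.
have [T0|[e]] := finset.set_0Vmem (~: T)%SET.
  rewrite (_ : T = finset.setT) => [_|]; last by rewrite -[T]finset.setCK T0 finset.setC0.
  by rewrite mc_model_full big_pred0 // => e; rewrite inE.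
rewrite inE => eT lt.
rewrite (mc_product (plane_variety _ _) (model_variety _ _ _)
  (model_variety _ _ _) (isomorphic_split_model C D eT)).
rewrite (bigD1 e) //=; congr (_ * _).
rewrite IH; last first.
  rewrite ltnS in lt; apply: leq_trans lt; apply: proper_card.
  apply/properP; split; last by exists e; rewrite !inE ?eqxx.
  by apply/fintype.subsetP => f; rewrite !inE negb_or => /andP[].
by apply: eq_bigl => f; rewrite !inE negb_or andbC.
Qed.

End ModelClass.

(** * The classes of the factors *)

Section Factors.

Definition punctured_line : fspace :=
  embedded (fun (a : Cstar) (_ : 'I_1) => val a).

Lemma punctured_line_variety : is_variety punctured_line.
Proof.
have inj (a b : Cstar) : (fun _ : 'I_1 => val a) = (fun=> val b) -> a = b.
  by move=> /(congr1 (fun f => f ord0)) /val_inj.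
apply: variety_embedded => //.
apply: (affine_embedded (eqs := set0) (q := mpolyX CC (mnm1 ord0))) => //.
  by move=> a; rewrite mevalXU; exact: cstar_neq0.
move=> z _; rewrite mevalXU => z0; exists (to_cstar (z ord0)).
by apply/funext => i; rewrite val_to_cstar // (ord1 i).
Qed.

Lemma morphism_const (Z : fspace) (T : Type) n (iota : T -> 'I_n -> CC) (x : T) :
  is_ringed Z -> @morphism Z (embedded iota) (fun=> x).
Proof.
by move=> RZ; apply: morphism_embedded => // i; exact: (regular_cst RZ _ (zopenT RZ)).
Qed.

Lemma mc_punctured_line : motivic_class punctured_line = LL - 1.
Proof.
pose R1 : is_ringed affine_line := embedded_ringed _.
pose pt0 := embedded (@model_iota loop_graph finset.setT finset.set0 finset.set0).
have Rp : is_ringed pt0 := embedded_ringed _.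
have Rc : is_ringed punctured_line := embedded_ringed _.
have co : @regular affine_line setT id := @embedded_coord _ _ (fun (z : CC) (_ : 'I_1) => z) ord0.
have [p0] : exists x : pt0, True.
  have P e : @edge_factor loop_graph finset.setT finset.set0 finset.set0 e (0, 0).
    by rewrite /edge_factor !inE.
  by exists (model_of P).
have pE (x : pt0) : x = p0.
  apply: model_ext => e; have := mcoordP x e; have := mcoordP p0 e.
  by rewrite /edge_factor !inE => -> ->.
pose Z0 : set affine_line := [set (0 : CC)].
have o : @zopen affine_line (~` Z0).
  have := zopen_neq0 R1 (zopenT R1) co; rewrite (_ : [set x | _] = ~` Z0) //.
  by apply/seteqP; split=> x /=; [move=> [_ /eqP]|move=> /eqP].
rewrite /LL (@mc_scissor _ punctured_line pt0 Z0 o) //.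
- by rewrite mc_model_full addrK.
- exact: affine_line_is_variety.
- exact: punctured_line_variety.
- exact: model_variety.
- have f1 (a : Cstar) : (~` Z0) (val a) by apply/eqP; exact: cstar_neq0.
  exists (fun a => exist _ (val a) (f1 a)), (fun z => to_cstar (sval z)); split.
  + apply: (@morphism_sub punctured_line affine_line (~` Z0) (fun a => val a) f1 Rc).
    apply: morphism_embedded => // i.
    exact: (@embedded_coord _ _ (fun (a : Cstar) (_ : 'I_1) => val a) i).
  + have RS := subfspace_ringed (~` Z0) R1.
    apply: morphism_embedded => // i.
    apply: (regular_eq RS (zopenT RS) _
      (regular_sval (S := ~` Z0) (zopenT R1) (@subsetT _ _) co)) => z _.
    by rewrite val_to_cstar //; apply/eqP; exact: (svalP z).
  + by move=> a; apply: val_inj; rewrite val_to_cstar // cstar_neq0.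
  + move=> z; apply: eq_sig_hprop => [? ? ?|]; first exact: Prop_irrelevance.
    by rewrite /= val_to_cstar //; apply/eqP; exact: (svalP z).
- have f0 (x : pt0) : Z0 (0 : CC) by [].
  exists (fun x => exist _ (0 : CC) (f0 x)), (fun=> p0); split.
  + apply: (@morphism_sub pt0 affine_line Z0 (fun=> 0) f0 Rp); exact: morphism_const.
  + exact: morphism_const (subfspace_ringed _ R1).
  + by move=> x; rewrite [RHS]pE.
  + move=> z; apply: eq_sig_hprop => [? ? ?|]; first exact: Prop_irrelevance.
    by case: z => z /= ->.
Qed.

Let pc (c d : bool) (w : plane c d) : CC * CC := @mcoord loop_graph _ _ _ w tt.

Lemma plane_regular1 c d : @regular (plane c d) setT (fun w => (pc w).1).
Proof. exact: mcoord1_regular. Qed.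

Lemma plane_regular2 c d : @regular (plane c d) setT (fun w => (pc w).2).
Proof. exact: mcoord2_regular. Qed.

Lemma planeP c d (w : plane c d) :
  [/\ 1 + (pc w).1 * (pc w).2 != 0, c -> (pc w).2 != 0 & d -> (pc w).2 = 0].
Proof. by apply/factor_plane; exact: (mcoordP w tt). Qed.

Lemma plane_exists (c d : bool) (p : CC * CC) :
  [/\ 1 + p.1 * p.2 != 0, c -> p.2 != 0 & d -> p.2 = 0] ->
  exists w : plane c d, pc w = p.
Proof.
move=> hp; have P (e : edge loop_graph) : @edge_factor loop_graph finset.set0
    [set x | c]%SET [set x | d]%SET e ((fun=> p) e).
  by case: e; apply/factor_plane.
by exists (model_of P); rewrite /pc model_ofE.
Qed.

Lemma plane_ext c d (w w' : plane c d) : pc w = pc w' -> w = w'.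
Proof. by move=> ww'; apply: model_ext; case. Qed.

Lemma morphism_plane (Z : fspace) (c d : bool) (f : Z -> plane c d) : is_ringed Z ->
  regular [set: Z] (fun z => (pc (f z)).1) ->
  regular [set: Z] (fun z => (pc (f z)).2) -> morphism f.
Proof. by move=> RZ r1 r2; apply: morphism_model => //; case. Qed.

Lemma mc_plane_line : motivic_class (plane false true) = LL.
Proof.
pose R1 : is_ringed affine_line := embedded_ringed _.
have Rp : is_ringed (plane false true) := embedded_ringed _.
have co : @regular affine_line setT id := @embedded_coord _ _ (fun (z : CC) (_ : 'I_1) => z) ord0.
have ex (x : CC) : exists w : plane false true, pc w = (x, 0).
  by apply: plane_exists; rewrite mulr0 addr0; split=> //; exact: oner_neq0.
apply: mc_iso; [exact: plane_variety|exact: affine_line_is_variety|].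
exists (fun w => (pc w).1), (fun x => sval (cid (ex x))).
have exE x : pc (sval (cid (ex x))) = (x, 0) by case: cid.
split.
- by apply: morphism_embedded => // i; exact: plane_regular1.
- apply: morphism_plane => //.
    by apply: (regular_eq R1 (zopenT R1) _ co) => x _; rewrite exE.
  apply: (regular_eq R1 (zopenT R1) _ (regular_cst R1 0 (zopenT R1))) => x _.
  by rewrite exE.
- move=> w; apply: plane_ext; rewrite exE [RHS]surjective_pairing.
  by have [_ _ ->] := planeP w.
- by move=> x; rewrite exE.
Qed.

(** The map [(x, y) |-> (1 + x y, y)] identifies the locus [y <> 0] with the
    product of two punctured lines. *)
Lemma mc_plane_open : motivic_class (plane true false) = (LL - 1) ^+ 2.
Proof.
pose iota (a : Cstar) (_ : 'I_1) := val a.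
pose E := embedded (join_iota iota iota).
have RE : is_ringed E := embedded_ringed _.
have Rp : is_ringed (plane true false) := embedded_ringed _.
have co : @regular punctured_line setT (fun a => val a) := @embedded_coord _ _ iota ord0.
have ex (m : E) : exists w : plane true false,
    pc w = ((val m.1 - 1) / val m.2, val m.2).
  apply: plane_exists; have [n1 n2] := (cstar_neq0 m.1, cstar_neq0 m.2).
  by rewrite /= divfK // addrC subrK.
have exE m : pc (sval (cid (ex m))) = ((val m.1 - 1) / val m.2, val m.2) by case: cid.
have c1 : @regular E setT (fun m => val m.1).
  exact: (regular_pull (embedded_ringed _) (@join_fst_morphism _ _ _ _ iota iota) co).
have c2 : @regular E setT (fun m => val m.2).
  exact: (regular_pull (embedded_ringed _) (@join_snd_morphism _ _ _ _ iota iota) co).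
rewrite expr2 -mc_punctured_line; apply: mc_product.
- exact: punctured_line_variety.
- exact: punctured_line_variety.
- exact: plane_variety.
apply: isomorphic_trans (isomorphic_product _ _).
have TE := zopenT RE; have Tp := zopenT Rp.
exists (fun w => (to_cstar (1 + (pc w).1 * (pc w).2), to_cstar (pc w).2) : E).
exists (fun m => sval (cid (ex m))).
split.
- apply: morphism_join => //; apply: morphism_embedded => // i.
    apply: (regular_eq Rp Tp (f := fun w => 1 + (pc w).1 * (pc w).2)).
      by move=> w _; have [h _ _] := planeP w; rewrite val_to_cstar.
    apply: (regularD Rp Tp); first exact: (regular_cst Rp).
    by apply: (regularM Rp Tp); [exact: plane_regular1|exact: plane_regular2].
  apply: (regular_eq Rp Tp _ (@plane_regular2 true false)) => w _.
  by have [_ h _] := planeP w; rewrite val_to_cstar // h.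
- apply: morphism_plane => //.
    apply: (regular_eq RE TE (f := fun m => (val m.1 - 1) * (val m.2)^-1)).
      by move=> m _; rewrite exE.
    apply: (regularM RE TE); last first.
      by apply: (regularV_unit RE TE c2) => m _; exact: cstar_neq0.
    by apply: (regularD RE TE) => //; exact: (regular_cst RE).
  by apply: (regular_eq RE TE _ c2) => m _; rewrite exE.
- move=> w; apply: plane_ext; rewrite exE; have [h1 h2 _] := planeP w.
  rewrite !val_to_cstar //= ?h2 // addrAC subrr add0r mulfK ?h2 //.
  by rewrite -surjective_pairing.
- move=> [a b]; rewrite exE /=; congr (_, _); apply: val_inj.
    rewrite divfK ?(cstar_neq0 b) // addrC subrK.
    exact: val_to_cstar (cstar_neq0 a).
  exact: val_to_cstar (cstar_neq0 b).
Qed.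

End Factors.

(** * The state sum *)

Section StateSum.
Variables (G : graph) (eta : vert G -> Cstar).
Hypothesis eta_sum : sum_zero eta.
Hypothesis eta_gen : generic eta.
Implicit Types (C D S : {set edge G}) (e : edge G).
Let P C D := subfspace (piece (eta := eta) C D).

(** With [T] a spanning tree inside [S], the edges of [S] outside [T] contribute
    [(LL - 1) ^+ 2] each and the edges outside [S] contribute [LL] each. *)
Lemma mc_stratum S : gconnected (subgraph S) ->
  motivic_class (P S (~: S)%SET) =
  (LL - 1) ^+ (2 * (#|S| + 1 - #|vert G|)) * LL ^+ (#|edge G| - #|S|).
Proof.
move=> Sc; have [l Gl lS] := grown_exists Sc; pose T := [set e in ledges l]%SET.
have TS : T \subset S by apply/fintype.subsetP => e; rewrite inE => /lS.
have TD e : e \in T -> e \notin (~: S)%SET.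
  by move=> /(fintype.subsetP TS) eS; rewrite inE eS.
rewrite (mc_iso (piece_variety eta_sum eta_gen _ _) (model_variety _ _ _)
  (chart Gl eta_sum TS TD)) mc_model -/T.
have cT : (#|T| + 1)%N = #|vert G|.
  have := grown_size Gl; rewrite cardsT => ->.
  rewrite addn1 /T cardsE; congr _.+1.
  by rewrite (card_uniqP (grown_uniq Gl)) size_map.
rewrite (bigID (mem S)) /=; congr (_ * _).
  rewrite (eq_bigr (fun=> (LL - 1) ^+ 2)) => [|e /andP[eT eS]]; last first.
    by rewrite inE eS mc_plane_open.
  rewrite (eq_bigl (fun e => e \in S :\: T)%SET) => [|e]; last by rewrite finset.in_setD.
  rewrite prodr_const -exprM cardsD (finset.setIidPr TS) -cT.
  by rewrite subnDr.
rewrite (eq_bigr (fun=> LL)) => [|e /andP[eT eS]]; last first.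
  by rewrite inE (negPf eS) mc_plane_line.
rewrite (eq_bigl (fun e => e \in ~: S)%SET) => [|e]; last first.
  rewrite finset.in_setC andb_idl // => eS; apply: contra eS; exact: (fintype.subsetP TS).
by rewrite prodr_const cardsCs finset.setCK.
Qed.

Lemma disjoint_setU1 e C D :
  [disjoint (e |: C)%SET & D]%B = (e \notin D) && [disjoint C & D]%B.
Proof. by rewrite -disjointU1; apply: eq_disjoint => x; rewrite !inE. Qed.

(** Each edge is cut in turn, until every [y] is known to vanish or not. *)
Lemma mc_piece_sum C D : [disjoint C & D]%B ->
  motivic_class (P C D) =
  \sum_(S : {set edge G} | (C \subset S) && [disjoint S & D]%B)
    motivic_class (P S (~: S)%SET).
Proof.
have [n] := ubnP #|(~: (C :|: D))%SET|; elim: n C D => // n IH C D lt CD.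
have [CD1|[e]] := finset.set_0Vmem (~: (C :|: D))%SET.
  have DE : D = (~: C)%SET.
    apply/setP => e; have := congr1 (fun A : {set _} => e \in A) CD1.
    rewrite !inE => /negbFE/orP[eC|eD]; first by rewrite eC (disjointFr CD).
    by rewrite eD; apply/esym; rewrite (disjointFl CD).
  rewrite (big_pred1 C) ?DE // => S.
  rewrite /= disjoint_sym finset.disjoints_subset finset.setCS.
  by rewrite finset.eqEsubset; case: (S \subset C); rewrite ?andbT ?andbF.
rewrite !inE negb_or => /andP[eC eD].
have lt' (A : {set edge G}) : ((C :|: D) \subset A)%SET -> e \in A ->
    (#|(~: A)%SET| < n)%N.
  move=> sA eA; rewrite ltnS in lt; apply: leq_trans lt; apply: proper_card.
  apply/properP; split; first by rewrite finset.setCS.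
  by exists e; rewrite !inE ?eA // negb_or eC.
rewrite (mc_piece_split eta_sum eta_gen C D e).
rewrite (IH (e |: C)%SET D); first last.
- by rewrite disjoint_setU1 eD CD.
- by rewrite -finset.setUA lt' ?finset.subsetUr // !inE eqxx.
rewrite (IH C (e |: D)%SET); first last.
- by rewrite disjoint_sym disjoint_setU1 eC disjoint_sym.
- by rewrite finset.setUCA lt' ?finset.subsetUr // !inE eqxx.
rewrite [RHS](bigID (fun S => e \in S)) /=; congr (_ + _); apply: eq_bigl => S.
  by rewrite finset.subUset finset.sub1set; case: (e \in S); rewrite ?andbT ?andbF.
rewrite !(disjoint_sym S) disjoint_setU1.
by rewrite andbA andbAC.
Qed.

(** Disconnected strata are empty by genericity. *)
Theorem mc_Bvar_sum : motivic_class (Bvar eta) =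
  \sum_(S : {set edge G} | gconnected (subgraph S))
    (LL - 1) ^+ (2 * (#|S| + 1 - #|vert G|)) * LL ^+ (#|edge G| - #|S|).
Proof.
rewrite mc_Bvar_piece // mc_piece_sum; last by rewrite finset.disjoints_subset finset.sub0set.
rewrite [RHS]big_mkcond /=; apply: eq_big => [S|S _].
  by rewrite finset.sub0set disjoint_sym finset.disjoints_subset finset.sub0set.
case: ifPn => Sc; first exact: mc_stratum.
apply: mc_empty; first exact: piece_variety.
by move=> [A]; exact: piece_disconnected.
Qed.

End StateSum.

(** * Deletion and contraction *)

Section SubSums.
Variables (I : finType) (Q : pred I).

Lemma sum_sub (M : nmodType) (P : pred I) (F : I -> M) :
  \sum_(x : {x | Q x} | P (val x)) F (val x) = \sum_(i | Q i && P i) F i.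
Proof.
rewrite [RHS](reindex_omap (val : {x | Q x} -> I) insub) /=; last first.
  by move=> i /andP[Qi _]; rewrite insubT.
by apply: eq_bigl => x; rewrite valK eqxx andbT (valP x).
Qed.

Lemma sum_powerset_sub (M : nmodType) (P : pred {set I}) (F : {set I} -> M) :
  \sum_(S : {set {x | Q x}} | P [set val x | x in S]%SET) F [set val x | x in S]%SET =
  \sum_(S : {set I} | (S \subset Q) && P S) F S.
Proof.
rewrite [RHS](reindex_onto (fun S : {set {x | Q x}} => [set val x | x in S]%SET)
  (fun S => [set x | val x \in S]%SET)) /=; last first.
  move=> S /andP[/fintype.subsetP SQ _]; apply/setP => i; apply/imsetP/idP.
    by move=> [x]; rewrite inE => xS ->.
  by move=> iS; exists (exist _ i (SQ _ iS)) => //; rewrite inE.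
apply: eq_bigl => S.
have -> : ([set val x | x in S]%SET \subset Q) = true.
  by apply/fintype.subsetP => _ /imsetP[x _ ->]; exact: (valP x).
rewrite /=; suff -> : ([set x | val x \in [set val x | x in S]]%SET == S) = true by rewrite andbT.
apply/eqP/setP => x; rewrite inE; apply/imsetP/idP => [[y yS /val_inj->//]|xS].
by exists x.
Qed.

Definition extend0 (M : zmodType) (a : {x | Q x} -> M) (i : I) : M :=
  if insub i is Some x then a x else 0.

Lemma extend0_val (M : zmodType) (a : {x | Q x} -> M) x : extend0 a (val x) = a x.
Proof. by rewrite /extend0 valK. Qed.

Lemma extend0_out (M : zmodType) (a : {x | Q x} -> M) i : ~~ Q i -> extend0 a i = 0.
Proof. by move=> Qi; rewrite /extend0 insubN. Qed.

Lemma sum_extend0 (M : zmodType) (a : {x | Q x} -> M) (P : pred I) :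
  \sum_(i | P i) extend0 a i = \sum_(x : {x | Q x} | P (val x)) a x.
Proof.
under [RHS]eq_bigr do rewrite -extend0_val.
rewrite (sum_sub P) [LHS](bigID Q) /= [X in _ + X]big1 ?addr0.
  by apply: eq_bigl => i; rewrite andbC.
by move=> i /andP[_ Qi]; exact: extend0_out.
Qed.

End SubSums.

Section DeleteContract.
Variables (G : graph) (e : edge G).
Implicit Types (v : vert G) (f : edge G).

Section Delete.
Let G' := delete e.

Lemma bd_delete (A : zmodType) (a : edge G' -> A) v : bd (extend0 a) v = bd a v.
Proof. by rewrite /bd !sum_extend0. Qed.

Lemma delete_connected (S : {set edge G'}) :
  gconnected (subgraph S) = gconnected (subgraph [set val f | f in S]%SET).
Proof.
apply/idP/idP => /subgraph_connectedP[V0 h]; apply/subgraph_connectedP; split=> // A A0 A1.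
  by have [f fS fA] := h A A0 A1; exists (val f); first exact: imset_f.
by have [_ /imsetP[f fS ->] fA] := h A A0 A1; exists f.
Qed.

(** Solutions on the deletion are the solutions that vanish on [e]. *)
Lemma delete_generic (A : zmodType) (eta : vert G -> A) :
  generic eta -> @generic G' A eta.
Proof.
move=> gen a ae; rewrite delete_connected.
apply: subgraph_connectedS (gen (extend0 a) _); last by move=> v; rewrite bd_delete ae.
apply/fintype.subsetP => f; rewrite inE => af.
have [fe|fe] := boolP (f \in [set~ e]%SET); last by rewrite extend0_out ?eqxx in af.
by apply/imsetP; exists (exist _ f fe) => //; rewrite inE -extend0_val.
Qed.

End Delete.

Section Contract.
Hypothesis not_loop : ~~ is_loop e.
Let G' := Defs.contract e.

Lemma block_hd : block e (hd e) = ends e.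
Proof. by rewrite /block !inE eqxx. Qed.

Lemma block_tl : block e (tl e) = ends e.
Proof. by rewrite /block !inE eqxx orbT. Qed.

Lemma mem_block v w : (w \in block e v) = (to_block e w == to_block e v).
Proof.
rewrite -(inj_eq val_inj) /= /block; case: ifP => vE; case: ifP => wE.
- by rewrite eqxx.
- by apply/esym/negbTE; apply: contraFN wE => /eqP <-; rewrite inE.
- rewrite inE; transitivity false.
    by apply/negbTE; apply: contraFN vE => /eqP <-.
  by apply/esym/negbTE; apply: contraFN vE => /eqP->; rewrite inE.
- by rewrite inE (inj_eq set1_inj).
Qed.

Lemma to_block_surj (B : vert G') : exists v, B = to_block e v.
Proof.
case: B => B hB; have /imsetP[v _ BE] := hB; exists v; exact: val_inj.
Qed.

Lemma mem_vert (B : vert G') v : (v \in val B) = (to_block e v == B).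
Proof. by have [w ->] := to_block_surj B; rewrite /= mem_block. Qed.

Lemma card_contract : #|vert G'| = #|vert G|.-1.
Proof.
have -> : #|vert G'| = #|blocks e| by rewrite card_sig.
have -> : blocks e = [set block e v | v in [set~ tl e]]%SET.
  apply/setP => B; apply/imsetP/imsetP => -[v vP ->]; last by exists v.
  have [->|vt] := eqVneq v (tl e); last by exists v; rewrite ?inE.
  by exists (hd e); rewrite ?inE ?block_hd ?block_tl.
rewrite card_in_imset; first by rewrite cardsC1.
move=> v w; rewrite !inE => vt wt vw.
have : v \in block e w by rewrite mem_block; apply/eqP/val_inj.
rewrite /block; case: ifP => [|_]; last by rewrite inE => /eqP.
by rewrite !inE (negPf vt) (negPf wt) !orbF => /eqP-> /eqP->.
Qed.

(** A cut of the contraction is a cut of the graph that does not separate the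
    ends of [e]. *)
Lemma contract_connected (S : {set edge G'}) :
  gconnected (subgraph S) = gconnected (subgraph (e |: [set val f | f in S])%SET).
Proof.
apply/idP/idP => /subgraph_connectedP[V0 h]; apply/subgraph_connectedP.
  have V1 : (0 < #|vert G|)%N by apply/card_gt0P; exists (hd e).
  split=> // A A0 A1; have [eA|eA] := eqVneq (hd e \in A) (tl e \in A); last first.
    by exists e; rewrite ?inE ?eqxx.
  pose B : {set vert G'} := [set b | [exists v, (v \in A) && (b == to_block e v)]]%SET.
  have BE v : (to_block e v \in B) = (v \in A).
    rewrite inE; apply/existsP/idP => [[w /andP[wA]]|vA]; last by exists v; rewrite vA eqxx.
    rewrite -mem_block /block; case: ifP => wE; last by rewrite inE => /eqP->.
    by move: wE; rewrite !inE => /orP[]/eqP we /orP[]/eqP->; move: wA; rewrite we ?eA // -eA.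
  have B0 : B != finset.set0.
    by have /finset.set0Pn[v vA] := A0; apply/finset.set0Pn; exists (to_block e v); rewrite BE.
  have B1 : B != [set: vert G']%SET.
    apply: contraNneq A1 => BT; apply/eqP/setP => v.
    by rewrite -BE BT !finset.in_setT.
  have [f fS fB] := h B B0 B1; exists (val f); first by rewrite inE imset_f ?orbT.
  by move: fB; rewrite /= !BE.
have V1 : (0 < #|vert G'|)%N by apply/card_gt0P; exists (to_block e (hd e)).
split=> // B B0 B1; pose A : {set vert G} := [set v | to_block e v \in B]%SET.
have A0 : A != finset.set0.
  have /finset.set0Pn[b bB] := B0; apply/finset.set0Pn; have [v bE] := to_block_surj b.
  by exists v; rewrite inE -bE.
have A1 : A != [set: vert G]%SET.
  apply: contraNneq B1 => AT; apply/eqP/setP => b; have [v ->] := to_block_surj b.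
  by have := finset.in_setT v; rewrite -AT !inE.
have [f] := h A A0 A1; rewrite inE => /orP[|/imsetP[g gS ->]]; last first.
  by rewrite !inE; exists g.
by rewrite inE => /eqP->; rewrite !inE (_ : to_block e (tl e) = to_block e (hd e)) ?eqxx //;
  apply: val_inj; rewrite /= block_hd block_tl.
Qed.

Lemma sum_contract (A : zmodType) (F : vert G -> A) :
  \sum_(B : vert G') \sum_(v in val B) F v = \sum_v F v.
Proof.
rewrite [RHS](partition_big (to_block e) xpredT) //=; apply: eq_bigr => B _.
by apply: eq_bigl => v; rewrite mem_vert.
Qed.

Lemma bd_contract (A : zmodType) (a : edge G' -> A) (B : vert G') :
  \sum_(v in val B) bd (extend0 a) v = bd a B.
Proof.
have key (h : edge G -> vert G) : \sum_(v in val B) \sum_(f | h f == v) extend0 a f =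
    \sum_(f : edge G' | to_block e (h (val f)) == B) a f.
  rewrite (exchange_big_dep (fun f => to_block e (h f) == B)) /=; last first.
    by move=> v f; rewrite mem_vert => vB /eqP ->.
  rewrite -(sum_extend0 a (fun f => to_block e (h f) == B)).
  apply: eq_bigr => f fB; rewrite (big_pred1 (h f)) // => v /=.
  by rewrite eq_sym andb_idl // => /eqP->; rewrite mem_vert.
by rewrite /bd sumrB !key.
Qed.

(** A solution on the contraction extends uniquely to a solution on the graph:
    the value on [e] is determined by the equation at the head of [e], and the
    equation at the tail follows from the equation at the merged vertex. *)
Lemma contract_generic (A : zmodType) (eta : vert G -> A) :
  generic eta -> generic (contract_param eta e).
Proof.
move=> gen a ae; rewrite contract_connected.
pose c := eta (hd e) - bd (extend0 a) (hd e).
pose a1 f := extend0 a f + (if f == e then c else 0).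
have ht : tl e != hd e by rewrite eq_sym.
apply: subgraph_connectedS (gen a1 _); last first.
  have E : \sum_(v in ends e) bd (extend0 a) v = \sum_(v in ends e) eta v.
    have := ae (to_block e (hd e)); rewrite -bd_contract /contract_param /=.
    by rewrite block_hd.
  rewrite !big_setU1 ?inE 1?eq_sym //= !big_set1 in E.
  move=> v; rewrite bdD bd_single.
  have [<-|vh] := eqVneq (hd e) v; first by rewrite (negPf ht) subr0 addrC subrK.
  have [<-|vt] := eqVneq (tl e) v.
    rewrite sub0r /c opprB addrA [bd _ _ + _]addrC E.
    by rewrite addrC addKr.
  rewrite subr0 addr0.
  have := ae (to_block e v); rewrite -bd_contract /contract_param /= /block.
  by rewrite !inE !(eq_sym v) (negPf vh) (negPf vt) !big_set1.
apply/fintype.subsetP => f; rewrite !inE /a1; have [//|fe] := eqVneq f e.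
rewrite addr0 => af; apply/imsetP.
by exists (exist _ f fe) => //; rewrite inE -extend0_val.
Qed.

Lemma contract_sum_zero (A : zmodType) (eta : vert G -> A) :
  sum_zero eta -> sum_zero (contract_param eta e).
Proof. by rewrite /sum_zero sum_contract. Qed.

End Contract.
End DeleteContract.

(** * Recursion for the state sum *)

Section Recursion.
Variables (R : comPzRingType) (L : R).

(** The term of a connected spanning subgraph, with the first Betti numbers of
    connected graphs expressed by counting. *)
Definition state_weight (nV nE nS : nat) : R :=
  (L - 1) ^+ (2 * (nS + 1 - nV)) * L ^+ (nE - nS).

Definition state_sum (G : graph) : R :=
  \sum_(S : {set edge G} | gconnected (subgraph S))
    state_weight #|vert G| #|edge G| #|S|.

Variables (G : graph) (e : edge G).
Let conn (S : {set edge G}) := gconnected (subgraph S).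
Let weight (S : {set edge G}) := state_weight #|vert G| #|edge G| #|S|.

Lemma edges_gt0 : (0 < #|edge G|)%N.
Proof. by apply/card_gt0P; exists e. Qed.

Lemma state_sum_delete :
  \sum_(S : {set edge G} | (e \notin S) && conn S) weight S =
  state_sum (delete e) * L.
Proof.
rewrite /state_sum big_distrl /=.
rewrite (eq_bigl _ _ (@delete_connected _ e)).
have cE : #|edge (delete e)| = #|edge G|.-1 by rewrite card_sig cardsC1.
transitivity (\sum_(S : {set edge (delete e)} | conn [set val f | f in S]%SET)
    weight [set val f | f in S]%SET); last first.
  apply: eq_bigr => S _; rewrite /weight (card_imset _ val_inj) cE /state_weight.
  rewrite -mulrA -exprSr; congr (_ * L ^+ _).
  have sn : (#|S| <= #|edge (delete e)|)%N := max_card _.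
  have := edges_gt0; rewrite cE in sn.
  by case: #|edge G| sn => // n /= sn _; rewrite subSn.
rewrite (sum_powerset_sub _ conn weight); apply: eq_bigl => S.
congr (_ && _); apply/idP/fintype.subsetP => [eS f fS|SQ].
  by rewrite unfold_in finset.in_setC1; apply: contraNneq eS => <-.
by apply/negP => /SQ; rewrite unfold_in finset.in_setC1 eqxx.
Qed.

(** Both the number of edges of the subgraph and the number of vertices drop by
    one, so that the terms agree one by one. *)
Lemma state_sum_contract : ~~ is_loop e ->
  \sum_(S : {set edge G} | (e \in S) && conn S) weight S =
  state_sum (Defs.contract e).
Proof.
move=> nl; rewrite /state_sum (eq_bigl _ _ (@contract_connected _ e)).
have cE : #|edge (Defs.contract e)| = #|edge G|.-1.
  by rewrite card_sig -(cardC1 e); apply: eq_card.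
have V0 : (0 < #|vert G|)%N by apply/card_gt0P; exists (hd e).
transitivity (\sum_(S : {set edge (Defs.contract e)} | conn (e |: [set val f | f in S])%SET)
    weight (e |: [set val f | f in S])%SET); last first.
  apply: eq_bigr => S _; rewrite /weight card_contract // cE cardsU1.
  rewrite (card_imset _ val_inj) (_ : e \notin _) /=; last first.
    by apply/imsetP => -[f _ ef]; have := valP f; rewrite /= -ef eqxx.
  by rewrite add1n; have E0 := edges_gt0; case: #|vert G| V0 => // v _; case: #|edge G| E0.
pose Q := [pred f : edge G | f != e].
pose P' (S : {set edge G}) := conn (e |: S)%SET.
pose W' (S : {set edge G}) := weight (e |: S)%SET.
rewrite (sum_powerset_sub Q P' W').
rewrite (reindex_onto (fun S => e |: S)%SET (fun S => S :\ e)%SET) /=; last first.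
  by move=> S /andP[eS _]; rewrite finset.setD1K.
apply: eq_bigl => S; rewrite !inE eqxx /= andbC; congr (_ && _).
apply/eqP/fintype.subsetP => [<- f|SQ]; first by rewrite !inE => /andP[].
by rewrite finset.setU1K //; apply/negP => /SQ; rewrite unfold_in /= eqxx.
Qed.

Lemma loop_conn (S : {set edge G}) : is_loop e -> conn (e |: S)%SET = conn S.
Proof.
move=> /eqP el; apply/idP/idP; last exact/subgraph_connectedS/finset.subsetUr.
move=> /subgraph_connectedP[V0 h]; apply/subgraph_connectedP; split=> // A A0 A1.
have [f] := h A A0 A1; rewrite !inE => /orP[/eqP->|fS fA]; last by exists f.
by rewrite el eqxx.
Qed.

Lemma connected_card (S : {set edge G}) : conn S -> (#|vert G| <= #|S| + 1)%N.
Proof.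
move=> /grown_exists[l Gl lS]; have := grown_size Gl; rewrite cardsT addn1 => ->.
rewrite ltnS -(size_map fst) -(card_uniqP (grown_uniq Gl)).
by apply: subset_leq_card; apply/fintype.subsetP.
Qed.

(** Adding a loop to a connected spanning subgraph increases its first Betti
    number by one. *)
Lemma state_sum_loop : is_loop e ->
  \sum_(S : {set edge G} | (e \in S) && conn S) weight S =
  state_sum (delete e) * (L - 1) ^+ 2.
Proof.
move=> el; rewrite /state_sum big_distrl /=.
rewrite (eq_bigl _ _ (@delete_connected _ e)).
have cE : #|edge (delete e)| = #|edge G|.-1 by rewrite card_sig cardsC1.
transitivity (\sum_(S : {set edge (delete e)} | conn [set val f | f in S]%SET)
    weight (e |: [set val f | f in S])%SET); last first.
  apply: eq_bigr => S /connected_card; rewrite (card_imset _ val_inj) => cS.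
  rewrite /weight cE cardsU1 (card_imset _ val_inj) (_ : e \notin _) /=; last first.
    apply/imsetP => -[f _ ef]; have := valP f; rewrite /= -ef.
    by rewrite finset.in_setC1 eqxx.
  rewrite add1n /state_weight mulrAC -exprD; congr (_ ^+ _ * _ ^+ _).
    by rewrite addSn subSn // mulnS addnC.
  by have := edges_gt0; case: #|edge G|.
pose Q := [pred f : edge G | f \in [set~ e]%SET].
pose W' (S : {set edge G}) := weight (e |: S)%SET.
rewrite (sum_powerset_sub Q conn W').
rewrite (reindex_onto (fun S => e |: S)%SET (fun S => S :\ e)%SET) /=; last first.
  by move=> S /andP[eS _]; rewrite finset.setD1K.
apply: eq_bigl => S; rewrite !inE eqxx /= loop_conn // andbC; congr (_ && _).
apply/eqP/fintype.subsetP => [<- f|SQ].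
  by rewrite finset.in_setD1 => /andP[fe _]; rewrite unfold_in finset.in_setC1.
by rewrite finset.setU1K //; apply/negP => /SQ; rewrite unfold_in finset.in_setC1 eqxx.
Qed.

Lemma state_sum_split : state_sum G =
  \sum_(S : {set edge G} | (e \in S) && conn S) weight S + state_sum (delete e) * L.
Proof.
rewrite -state_sum_delete /state_sum (bigID (fun S : {set edge G} => e \in S)) /=.
by congr (_ + _); apply: eq_bigl => S; rewrite andbC.
Qed.

Lemma bridge_not_loop : gconnected G -> bridge e -> ~~ is_loop e.
Proof.
move=> Gc br; apply: contra br => el; rewrite -[gconnected _]/(conn _) -loop_conn //.
rewrite (_ : e |: _ = [set: edge G])%SET; last by apply/setP => f; rewrite !inE orbN.
apply/subgraph_connectedP; have /gconnectedP[V0 h] := Gc; split=> // A A0 A1.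
by have [f fA] := h A A0 A1; exists f.
Qed.

Lemma state_sum_bridge : bridge e -> state_sum (delete e) = 0.
Proof.
move=> br; rewrite /state_sum big_pred0 // => S; apply/negbTE; apply: contra br.
rewrite delete_connected => Sc; apply: subgraph_connectedS Sc.
by apply/fintype.subsetP => _ /imsetP[f _ ->]; exact: (valP f).
Qed.

End Recursion.

(** * The motivic class of the variety of a graph *)

Lemma mc_Bvar_state_sum (G : graph) (eta : vert G -> Cstar) :
  sum_zero eta -> generic eta -> motivic_class (Bvar eta) = state_sum LL G.
Proof. exact: mc_Bvar_sum. Qed.

Lemma mc_Bloop : motivic_class Bloop = LL ^+ 2 - LL + 1.
Proof.
have conn (S : {set unit}) : gconnected (@subgraph loop_graph S).
  apply/subgraph_connectedP; split=> [|A A0 A1]; first by rewrite card_unit.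
  have /finset.set0Pn[[] vA] := A0; case/negP: A1; apply/eqP/setP => -[].
  by rewrite vA finset.in_setT.
rewrite mc_Bvar_state_sum; first last.
- by move=> a _; exact: conn.
- by rewrite /sum_zero big1.
rewrite /state_sum (eq_bigl xpredT) => [|S]; last exact: conn.
rewrite (bigD1 finset.set0) //= (bigD1 finset.setT) /=; last first.
  by apply/eqP => /setP/(_ tt); rewrite !inE.
rewrite big_pred0 => [|S].
  rewrite /state_weight cards0 cardsT card_unit /= !expr0 !expr1 mul1r mulr1 addr0.
  by ring.
apply/negbTE; rewrite -negb_or negbK; apply/orP.
have [St|St] := boolP (tt \in S); [right|left]; apply/eqP/setP => -[].
  by rewrite St !inE.
by rewrite (negPf St) inE.
Qed.

Section MotivicClass.
Variables (G : graph) (eta : vert G -> Cstar).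
Hypotheses (G_conn : gconnected G) (eta_sum : sum_zero eta).
Hypothesis eta_gen : generic eta.
Let mcE := mc_Bvar_state_sum eta_sum eta_gen.

Lemma mc_delete e : motivic_class (@Bvar (delete e) eta) = state_sum LL (delete e).
Proof. apply: mc_Bvar_state_sum => //; exact: delete_generic. Qed.

Lemma mc_contract e : ~~ is_loop e ->
  motivic_class (Bvar (contract_param eta e)) = state_sum LL (Defs.contract e).
Proof.
move=> nl; apply: mc_Bvar_state_sum; first exact: contract_sum_zero.
exact: contract_generic.
Qed.

Lemma mc_bridge e : bridge e ->
  motivic_class (Bvar eta) = motivic_class (Bvar (contract_param eta e)).
Proof.
move=> br; have nl := bridge_not_loop G_conn br.
rewrite mcE (state_sum_split LL e) state_sum_bridge // mul0r addr0.
by rewrite state_sum_contract // mc_contract.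
Qed.

Lemma mc_loop e : is_loop e -> motivic_class (Bvar eta) =
  motivic_class (@Bvar (delete e) eta) * motivic_class Bloop.
Proof.
move=> el; rewrite mcE (state_sum_split LL e) state_sum_loop // mc_Bloop mc_delete.
by rewrite -mulrDr; congr (_ * _); ring.
Qed.

Lemma mc_recursion e : ~~ is_loop e -> motivic_class (Bvar eta) =
  motivic_class (@Bvar (delete e) eta) * LL +
  motivic_class (Bvar (contract_param eta e)).
Proof.
move=> nl; rewrite mcE (state_sum_split LL e) state_sum_contract //.
by rewrite mc_delete mc_contract // addrC.
Qed.

Lemma mc_spanning_sum : motivic_class (Bvar eta) =
  \sum_(S : {set edge G} | gconnected (subgraph S))
    (LL - 1) ^+ (2 * betti1 (subgraph S)) * LL ^+ (betti1 G - betti1 (subgraph S)).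
Proof.
rewrite mcE; apply: eq_bigr => S Sc; rewrite /state_weight !betti1_connected //.
have cS := connected_card Sc; have SE : (#|S| <= #|edge G|)%N := max_card _.
have -> : #|edge (subgraph S)| = #|S| by rewrite card_sig.
congr (_ * _ ^+ _).
by rewrite -subnDA subnKC // subnDr.
Qed.

End MotivicClass.

(** * The analytic topology *)

Section AnalyticTopology.
Variable X : fspace.
Let TX : topologicalType := analytic X.

Definition analytic_subbase : set (set TX) :=
  [set W | exists (U : set X) (f : X -> CC) (O : set CC),
     [/\ zopen U, regular U f, open (O : set CC^o)
       & W = [set x | U x /\ O (f x)]]].

Lemma analytic_subbase_open W : analytic_subbase W -> open W.
Proof.
move=> sW; exists [set W]; last first.
  by rewrite predeqE => ?; split=> [[_ ->]|] //; exists W.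
move=> _ ->; exists (finmap.fset1 W).
  by move=> ?; rewrite inE inE => /eqP->.
by rewrite predeqE=> ?; split=> [|??]; [apply|]; rewrite /= inE // =>/eqP->.
Qed.

(** A neighbourhood contains a finite intersection of members of the subbase. *)
Lemma cvg_analytic (F : set_system TX) (t : TX) : Filter F ->
  (forall W, analytic_subbase W -> W t -> F W) -> F --> t.
Proof.
move=> FF h A /=; rewrite (@nbhsE TX) => -[_ [[B sB <-] [C BC Ct] sUBA]].
rewrite nbhs_filterE; apply: filterS sUBA _; apply: (@filterS _ _ _ C).
  by move=> ? ?; exists C.
have /sB [D sD IDeC] := BC; rewrite -IDeC; apply: filter_bigI => E DE.
have /sD := DE; rewrite inE => sE; apply: h => //.
by move: Ct; rewrite -IDeC => /(_ _ DE).
Qed.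

(** This and [zopen_analytic] are what the analytic topology is made for. *)
Lemma regular_cts (U : set X) (f : X -> CC) : zopen U -> regular U f ->
  @cts_on TX CC^o U f.
Proof.
move=> oU rf; apply/cts_onP => O oO; exists [set x | U x /\ O (f x)].
  by apply: analytic_subbase_open; exists U, f, O.
by move=> x Ux /=; split=> // -[].
Qed.

(** Continuity into the analytic topology is checked on the subbase, locally. *)
Lemma cts_on_analytic (Z : topologicalType) (A : set Z) (f : Z -> TX) :
  (forall (U : set X) (h : X -> CC) (O : set CC) z, zopen U -> regular U h ->
     open (O : set CC^o) -> A z -> U (f z) -> O (h (f z)) ->
     exists2 O' : set Z, open O' /\ O' z &
       forall z', A z' -> O' z' -> U (f z') /\ O (h (f z'))) ->
  cts_on A f.
Proof.
move=> H z Az; apply: cvg_analytic => W [U [h [O [oU rh oO ->]]]] [Uz Oz].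
have [O' [oO' O'z] O'P] := H _ _ _ _ oU rh oO Az Uz Oz.
apply: (@filterS _ (nbhs z) _ O'); last exact: open_nbhs_nbhs.
by move=> z' /O'P h' /h'.
Qed.

Hypothesis RX : is_ringed X.

Lemma zopen_analytic (U : set X) : zopen U -> open (U : set TX).
Proof.
move=> oU; apply: analytic_subbase_open; exists U, (fun=> 0), setT.
split=> //; [exact: (regular_cst RX)|exact: openT|].
by apply/seteqP; split=> x //= [].
Qed.

End AnalyticTopology.

Lemma cts_on_meval (Y : topologicalType) (K : set Y) n (c : Y -> 'I_n -> CC)
    (p : mpoly n CC) : (forall i, @cts_on Y CC^o K (c^~ i)) ->
  @cts_on Y CC^o K (fun y => meval (c y) p).
Proof.
move=> cc.
have cprod (I : Type) (r : seq I) (F : I -> Y -> CC^o) :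
    (forall i, cts_on K (F i)) -> @cts_on Y CC^o K (fun y => \prod_(i <- r) (F i y : CC)).
  move=> cF; elim: r => [|i r IH].
    by apply: (cts_on_eq _ (@cts_on_cst _ CC^o K 1)) => y _; rewrite big_nil.
  by apply: (cts_on_eq _ (cts_onM (cF i) IH)) => y _; rewrite big_cons.
have csum (I : Type) (r : seq I) (F : I -> Y -> CC^o) :
    (forall i, cts_on K (F i)) -> @cts_on Y CC^o K (fun y => \sum_(i <- r) (F i y : CC)).
  move=> cF; elim: r => [|i r IH].
    by apply: (cts_on_eq _ (@cts_on_cst _ CC^o K 0)) => y _; rewrite big_nil.
  by apply: (cts_on_eq _ (cts_onD (cF i) IH)) => y _; rewrite big_cons.
have cX (f : Y -> CC^o) k : cts_on K f -> @cts_on Y CC^o K (fun y => (f y : CC) ^+ k).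
  move=> cf; elim: k => [|k IH]; first exact: cts_on_cst.
  by apply: (cts_on_eq _ (cts_onM cf IH)) => y _; rewrite exprS.
apply: (cts_on_eq (f := fun y => \sum_(m <- msupp p)
  (mcoeff m p * \prod_(i <- index_enum 'I_n) c y i ^+ m i : CC^o))).
  by move=> y _; rewrite mevalE.
apply: csum => m; apply: cts_onM; first exact: cts_on_cst.
by apply: cprod => i; apply: cX; exact: cc.
Qed.

Lemma cts_on_local (Y Z : topologicalType) (A : set Y) (f : Y -> Z) :
  (forall y, A y -> exists V, [/\ open V, V y & cts_on (A `&` V) f]) -> cts_on A f.
Proof.
move=> H y Ay; have [V [oV Vy cV]] := H y Ay => N fN.
have := cV y (conj Ay Vy) N fN; rewrite /nbhs /= /within /=.
have nV : nbhs y V by exact: open_nbhs_nbhs.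
by apply: filterS2 nV => z Vz h Az; exact: h.
Qed.

Section AnalyticChart.
Variables (X : fspace) (RX : is_ringed X) (U : set X).
Variables (T : Type) (n : nat) (iota : T -> 'I_n -> CC) (t0 : T).
Hypothesis iso : isomorphic (subfspace U) (embedded iota).
Variables (Y : topologicalType) (K : set Y) (u : T -> Y) (v : Y -> T).
Hypotheses (uK : forall t, K (u t)) (vu : cancel u v).
Hypothesis uv : forall y, K y -> u (v y) = y.
Hypothesis v_cts : forall i, @cts_on Y CC^o K (fun y => iota (v y) i).
Hypothesis u_cts : forall (Z : topologicalType) (A : set Z) (h : Z -> T),
  (forall i, @cts_on Z CC^o A (fun z => iota (h z) i)) -> cts_on A (fun z => u (h z)).

(** An algebraic isomorphism with a subset of affine space is a homeomorphism:
    coordinates of the subset are regular functions, hence continuous; and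
    regular functions on the subset are locally quotients of polynomials, hence
    continuous in the coordinates. The subset enters through any space [Y] whose
    topology is determined by these coordinates. *)
Lemma analytic_homeo : homeo (U : set (analytic X)) K.
Proof.
have [f [g [mf mg fg gf]]] := iso.
pose F (x : analytic X) : Y := if pselect (U x) is left h then u (f (exist _ x h)) else u t0.
pose G (y : Y) : analytic X := sval (g (v y)).
have FE (z : subfspace U) : F (sval z) = u (f z).
  rewrite /F; case: pselect => [h|[]]; last exact: (svalP z).
  by congr (u (f _)); apply: eq_sig_hprop => // ? ? ?; exact: Prop_irrelevance.
have [oX _ _ _] := ringed_fspace RX.
exists F, G; split.
- split; last by move=> x Ux; rewrite (FE (exist _ x Ux)).
  pose h (x : analytic X) : T := if pselect (U x) is left h then f (exist _ x h) else t0.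
  apply: (cts_on_eq (f := fun x => u (h x))).
    by move=> x Ux; rewrite /F /h; case: pselect.
  apply: u_cts => i.
  have [_ /(_ _ (@embedded_coord _ _ iota i)) ri] := mf setT (zopenT (embedded_ringed iota)).
  apply: cts_on_local => x Ux.
  have [V [g0 [oV Vx rg0 gE]]] := ri (exist _ x Ux) I.
  exists V; split=> //; first exact: zopen_analytic.
  apply: (@cts_on_eq (analytic X) CC^o (U `&` V) g0); last first.
    by apply: cts_on_subset (regular_cts oV rg0) => y [].
  move=> y [Uy Vy]; rewrite -[RHS]/(iota (h y) i) /h; case: pselect => // Uy'.
  by rewrite -(gE (exist _ y Uy')).
- split; last by move=> y _; exact: (svalP (g (v y))).
  apply: cts_on_analytic => V h O y oV rh oO Ky Vy Oy.
  have mG : @morphism (embedded iota) X (fun t => sval (g t)).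
    exact: (morphism_comp mg (@sval_morphism X U)).
  have [[S VE] rV] := mG V oV; have {}rV := rV h rh.
  have : [set x | exists2 p, S p & meval (iota x) p != 0] (v y) by rewrite -VE.
  move=> [p0 Sp0 p0y]; have [p [q [qy pq]]] := rV (v y) Vy.
  have ct r := @cts_on_meval Y K n (fun y => iota (v y)) r v_cts.
  have op0 : open [set z : CC^o | z != 0] := open_punctured.
  have [O1 oO1 O1E] := (cts_onP _ _).1 (ct p0) _ op0.
  have [O2 oO2 O2E] := (cts_onP _ _).1 (ct q) _ op0.
  pose K1 : set Y := [set y | K y /\ meval (iota (v y)) q != 0].
  have c1 : @cts_on Y CC^o K1 (fun y => meval (iota (v y)) p / meval (iota (v y)) q).
    have sK1 : K1 `<=` K by move=> ? [].
    apply: cts_onM; first exact: cts_on_subset sK1 (ct p).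
    by apply: cts_onV; [exact: cts_on_subset sK1 (ct q)|move=> ? []].
  have [O3 oO3 O3E] := (cts_onP _ _).1 c1 _ oO.
  have VP z : K z -> O1 z -> V (G z).
    move=> Kz Oz; suff : ((fun t => sval (g t)) @^-1` V) (v z) by [].
    by rewrite VE; exists p0 => //; exact/(O1E _ Kz).
  exists (O1 `&` O2 `&` O3).
    split; first by apply: openI => //; exact: openI.
    split; first by split; [apply/O1E|apply/O2E].
    by apply/O3E => //; rewrite -pq.
  move=> z Kz [[O1z O2z] O3z]; have Vz := VP _ Kz O1z; split=> //.
  have qz : meval (iota (v z)) q != 0 by apply/(O2E _ Kz).
  by have := (O3E z (conj Kz qz)).1 O3z; rewrite -(pq (v z)).
- by move=> x Ux; rewrite (FE (exist _ x Ux)) /G vu fg.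
- by move=> y Ky; rewrite /G FE gf uv.
Qed.

End AnalyticChart.

(** * Spanning trees by counting *)

Lemma homeo_sym (T T' : topologicalType) (A : set T) (A' : set T') :
  homeo A A' -> homeo A' A.
Proof. by move=> [f [g [h1 h2 h3 h4]]]; exists g, f; split. Qed.

Section Trees.
Variable G : graph.
Implicit Types (S : {set edge G}) (l : seq (edge G * bool)).

Lemma grown_sub S A l : grown A l -> {subset ledges l <= S} ->
  exists2 l' : seq (edge (subgraph S) * bool), @grown (subgraph S) A l' &
    [seq (val d.1, d.2) | d <- l'] = l.
Proof.
elim=> [v _|{}A {}l d _ IH dA dnA lS]; first by exists [::] => //; exact: grown1.
have [|l' Gl' lE] := IH; first by move=> e el; apply: lS; rewrite inE el orbT.
have dS : d.1 \in S by apply: lS; rewrite inE eqxx.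
exists ((exist _ d.1 dS, d.2) :: l'); last by rewrite /= lE; case: d {dA dnA lS dS}.
exact: (@grownS (subgraph S) A l' (exist _ d.1 dS, d.2)).
Qed.

(** Following the growth, two vertices on different sides of a cut are separated
    by the cut on some edge. *)
Lemma grown_connected l : grown finset.setT l ->
  gconnected (subgraph [set e in ledges l]%SET).
Proof.
move=> Gl; have key (B A : {set vert G}) l' : grown A l' -> forall v w,
    v \in A -> w \in A -> v \in B -> w \notin B ->
    exists2 e, e \in ledges l' & (hd e \in B) != (tl e \in B).
  elim=> [u v w|{}A {}l' d _ IH dA dnA v w].
    by rewrite !inE => /eqP-> /eqP->; move=> ->.
  have dE : (dsrc d \in B) != (dtgt d \in B) -> (hd d.1 \in B) != (tl d.1 \in B).
    by rewrite /dsrc /dtgt; case: d.2; rewrite // eq_sym.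
  have [dB|/dE h] := eqVneq (dsrc d \in B) (dtgt d \in B); last first.
    by exists d.1 => //; rewrite inE eqxx.
  pose r x := if x == dtgt d then dsrc d else x.
  have rA x : x \in (dtgt d |: A)%SET -> r x \in A.
    by rewrite /r !inE; case: eqP.
  have rB x : (r x \in B) = (x \in B) by rewrite /r; case: eqP => [->|].
  move=> /rA vA /rA wA; rewrite -rB -(rB w) => vB wB.
  have [e el eB] := IH _ _ vA wA vB wB.
  by exists e => //; rewrite inE el orbT.
have cT := grown_size Gl; rewrite cardsT in cT.
apply/subgraph_connectedP; split=> [|B B0 B1]; first by rewrite cT.
have /finset.set0Pn[v vB] := B0.
have [w wB] : exists w, w \notin B.
  apply/existsP; apply: contraR B1; rewrite negb_exists => /forallP h.
  by apply/eqP/setP => w; rewrite finset.in_setT; apply/negPn.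
have [e el eB] := key B _ _ Gl v w (finset.in_setT _) (finset.in_setT _) vB wB.
by exists e => //; rewrite inE.
Qed.

Lemma card_ledges l : grown finset.setT l ->
  (#|[set e in ledges l]%SET| + 1)%N = #|vert G|.
Proof.
move=> Gl; have := grown_size Gl; rewrite cardsT => ->.
rewrite addn1 cardsE; congr _.+1.
by rewrite (card_uniqP (grown_uniq Gl)) size_map.
Qed.

Definition spanning_tree S := gconnected (subgraph S) && (#|S| + 1 == #|vert G|)%N.

Lemma spanning_treeE S l : grown finset.setT l -> {subset ledges l <= S} ->
  (#|S| + 1 == #|vert G|)%N = (S == [set e in ledges l]%SET).
Proof.
move=> Gl lS; rewrite -(card_ledges Gl) eqn_add2r [RHS]eq_sym.
have TS : [set e in ledges l]%SET \subset S.
  by apply/fintype.subsetP => e; rewrite inE => /lS.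
by rewrite finset.eqEcard TS /= eqn_leq (subset_leq_card TS) andbT.
Qed.

(** A spanning tree obtained by growth inside [S] is the whole of [S] precisely
    if [S] contains no cycle, and this can be tested by counting. *)
Lemma spanning_treeP S : is_tree (subgraph S) <-> spanning_tree S.
Proof.
rewrite /spanning_tree /is_tree; split=> [[Sc]|/andP[Sc]]; rewrite ?Sc /=;
  have [l Gl lS] := grown_exists Sc; rewrite (spanning_treeE Gl lS);
  have [l' Gl' lE] := grown_sub Gl lS.
- move=> ac; apply/eqP/setP => e; rewrite inE; apply/idP/idP => [eS|/lS//].
  have := acyclic_grown Gl' ac (exist _ e eS); rewrite -lE => /mapP[d dl' de].
  by rewrite /ledges -map_comp; apply/mapP; exists d => //=; rewrite -de.
- move=> /eqP SE; split=> //; apply: (grown_acyclic Gl') => -[e eS].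
  have : e \in ledges l by rewrite SE inE in eS.
  rewrite -lE /ledges -map_comp => /mapP[d dl' /= de].
  by apply/mapP; exists d => //; apply: val_inj.
Qed.

End Trees.

(** * The Euler characteristic of the variety of a graph *)

Section EulerCharacteristic.
Variables (G : graph) (eta : vert G -> Cstar).
Hypotheses (eta_sum : sum_zero eta) (eta_gen : generic eta).
Let X := Bvar eta.
Let TX : topologicalType := analytic X.
Let RX : is_ringed X := Bvar_ringed eta.
Implicit Types (S : {set edge G}) (e : edge G).
Local Notation F := (CC^o * CC^o)%type.

Definition chart_open S : set TX := piece S finset.set0.

Lemma chart_open_open S : open (chart_open S).
Proof. exact: (zopen_analytic RX (piece_open _ _)). Qed.

Lemma chart_openI S S' : chart_open S `&` chart_open S' = chart_open (S :|: S')%SET.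
Proof.
apply/seteqP; split=> A.
  move=> [[h1 _] [h2 _]]; split=> e; rewrite !inE // => /orP[]; [exact: h1|exact: h2].
by move=> [h _]; split; split=> e; rewrite ?inE // => eS; apply: h; rewrite inE eS ?orbT.
Qed.

(** In the product of the factors, one edge of [S] outside the tree is enough to
    make the Euler characteristic vanish. *)
Lemma chi_chart_open S : gconnected (subgraph S) ->
  chi (chart_open S) (if (#|S| + 1 == #|vert G|)%N then 1 else 0).
Proof.
move=> Sc; have [l Gl lS] := grown_exists Sc; rewrite (spanning_treeE Gl lS).
pose T := [set e in ledges l]%SET; rewrite -/T.
have TS : T \subset S by apply/fintype.subsetP => e; rewrite inE => /lS.
have TD e : e \in T -> e \notin (finset.set0 : {set edge G}) by move=> _; rewrite inE.
have iso := chart Gl eta_sum TS TD; rewrite -/T in iso.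
pose M := model T S finset.set0.
have P0 e : edge_factor T S finset.set0 e (if e \in T then (0, 0) else (0, 1)).
  rewrite /edge_factor; case: ifP => // _; split; rewrite /= ?inE // ?mul0r ?addr0.
    exact: oner_neq0.
  by move=> _; exact: oner_neq0.
pose K (i : 'I_#|edge G|) : set F := edge_factor T S finset.set0 (enum_val i).
pose c (i : 'I_#|edge G|) : int := if enum_val i \in S :\: T then 0 else 1.
have Kc i : mul_chi (K i) (c i).
  rewrite /K /c /edge_factor finset.in_setD; case: ifP => eT /=.
    exact: mul_chi_point.
  case: ifP => eS.
    rewrite (_ : [set p | _] = Bopen); first exact: mul_chi_Bopen.
    apply/seteqP; split=> p /=; first by move=> [h1 h2 _]; split=> //; exact: h2.
    by move=> [h1 h2]; split=> //; rewrite inE.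
  rewrite (_ : [set p | _] = Bset); first exact: mul_chi_Bset.
  by apply/seteqP; split=> p /=; [move=> []|move=> h; split=> //; rewrite inE].
have <- : \prod_i c i = (if S == T then 1 else 0).
  have [ST|ST] := eqVneq S T.
    by rewrite big1 // => i _; rewrite /c ST finset.setDv inE.
  have [e eST] : exists e, e \in S :\: T.
    by apply/finset.set0Pn; rewrite finset.setD_eq0; apply: contra ST => ST; rewrite finset.eqEsubset ST.
  by rewrite (bigD1 (enum_rank e)) //= /c enum_rankK eST mul0r.
apply: chi_hequiv (chi_prodset ((0, 0) : F) Kc); apply/homeo_hequiv/homeo_sym.
pose t0 : M := model_of P0.
pose u (t : M) : 'rV[F]_#|edge G| := \row_i mcoord t (enum_val i).
have vP (y : 'rV[F]_#|edge G|) : prodset K y ->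
    forall e, edge_factor T S finset.set0 e (y 0 (enum_rank e)).
  by move=> yK e; have := yK (enum_rank e); rewrite /K enum_rankK.
pose v (y : 'rV[F]_#|edge G|) : M :=
  if pselect (prodset K y) is left h then model_of (vP y h) else t0.
have vE y e : prodset K y -> mcoord (v y) e = y 0 (enum_rank e).
  by move=> yK; rewrite /v; case: pselect => // h; rewrite model_ofE.
have uK t : prodset K (u t) by move=> i; rewrite mxE; exact: mcoordP.
have vu : cancel u v.
  by move=> t; apply: model_ext => e; rewrite vE // mxE enum_rankK.
have uv y : prodset K y -> u (v y) = y.
  by move=> yK; apply/rowP => i; rewrite mxE vE // enum_valK.
apply: (analytic_homeo RX t0 iso uK vu uv) => [i|Z A h hc].
  case E : (enum_val i) => [e b].
  have cy : @cts_on _ F (prodset K) (fun y => y 0 (enum_rank e)).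
    by apply: cts_on_continuous; exact: row_coord_continuous.
  apply: (@cts_on_eq _ CC^o (prodset K) (fun y => if b then (y 0 (enum_rank e)).1
    else (y 0 (enum_rank e)).2)).
    by move=> y yK; rewrite /model_iota E vE.
  case: (b).
    exact: (cts_on_comp cy (@cts_on_fst CC^o CC^o setT)).
  exact: (cts_on_comp cy (@cts_on_snd CC^o CC^o setT)).
apply: cts_on_row => i.
apply: (@cts_on_eq _ F A (fun z => ((mcoord (h z) (enum_val i)).1,
  (mcoord (h z) (enum_val i)).2) : F)).
  by move=> z _; rewrite mxE -surjective_pairing.
apply: cts_on_pair.
  apply: cts_on_eq (hc (enum_rank (enum_val i, true))) => z _.
  by rewrite /model_iota enum_rankK.
apply: cts_on_eq (hc (enum_rank (enum_val i, false))) => z _.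
by rewrite /model_iota enum_rankK.
Qed.

Definition chart_union (s : seq {set edge G}) : set TX :=
  [set A | exists2 S, S \in s & chart_open S A].

Lemma chart_union_nil : chart_union [::] = set0.
Proof. by apply/seteqP; split=> A // -[]. Qed.

Lemma chart_union_cons S s : chart_union (S :: s) = chart_open S `|` chart_union s.
Proof.
apply/seteqP; split=> A.
  by move=> [S']; rewrite inE => /orP[/eqP->|S's] h; [left|right; exists S'].
move=> [h|[S' S's h]]; first by exists S => //; rewrite inE eqxx.
by exists S' => //; rewrite inE S's orbT.
Qed.

Lemma chart_union_open s : open (chart_union s).
Proof.
elim: s => [|S s IH]; first by rewrite chart_union_nil; exact: open0.
by rewrite chart_union_cons; apply: openU => //; exact: chart_open_open.
Qed.

Lemma chart_unionI S s : chart_open S `&` chart_union s =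
  chart_union [seq (S :|: S')%SET | S' <- s].
Proof.
apply/seteqP; split=> A.
  move=> [hS [S' S's hS']]; exists (S :|: S')%SET; first exact: map_f.
  by rewrite -chart_openI.
by move=> [_ /mapP[S' S's ->]]; rewrite -chart_openI => -[hS hS']; split=> //; exists S'.
Qed.

Lemma chi_chart_union S s (a b c : int) : chi (chart_open S) a ->
  chi (chart_union s) b -> chi (chart_union [seq (S :|: S')%SET | S' <- s]) c ->
  chi (chart_union (S :: s)) (a + b - c).
Proof.
move=> ha hb; rewrite -chart_unionI chart_union_cons => hc.
have E1 : (chart_open S `|` chart_union s) `&` chart_open S = chart_open S.
  by rewrite setIC; apply/setIidPl => A; left.
have E2 : (chart_open S `|` chart_union s) `&` chart_union s = chart_union s.
  by rewrite setIC; apply/setIidPl => A; right.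
apply: (chi_union (chart_open_open S) (chart_union_open s)); rewrite ?E1 ?E2 //.
Qed.

Let excess S := gconnected (subgraph S) && (#|vert G| < #|S| + 1)%N.

Lemma excessS S S' : S \subset S' -> excess S -> excess S'.
Proof.
move=> SS' /andP[Sc lt]; rewrite /excess (subgraph_connectedS SS') //=.
by apply: leq_trans lt _; rewrite leq_add2r subset_leq_card.
Qed.

(** A connected set of edges containing a cycle contributes nothing, and such
    sets are stable under union. *)
Lemma chi_excess_union (s : seq {set edge G}) : all excess s ->
  chi (chart_union s) 0.
Proof.
have [n] := ubnP (size s); elim: n s => // n IH [|S s] /= lt.
  by move=> _; rewrite chart_union_nil; exact: chi_set0.
move=> /andP[eS es]; apply: (eq_chi (a := 0 + 0 - 0)); first by rewrite subr0 addr0.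
apply: chi_chart_union.
- have /andP[Sc ltS] := eS; have := chi_chart_open Sc.
  by rewrite gtn_eqF.
- exact: IH.
- apply: IH; first by rewrite size_map.
  rewrite all_map; apply/allP => S' _ /=.
  by apply: excessS eS; exact: finset.subsetUl.
Qed.

(** Two different spanning trees together contain a cycle. *)
Lemma tree_union_excess S S' : spanning_tree S -> spanning_tree S' -> S' != S ->
  excess (S :|: S')%SET.
Proof.
move=> /andP[Sc /eqP cS] /andP[_ /eqP cS'] SS'; apply/andP; split.
  by apply: subgraph_connectedS Sc; exact: finset.subsetUl.
rewrite -cS ltn_add2r proper_card // finset.properEneq finset.subsetUl andbT.
apply: contraNneq SS' => SE; rewrite finset.eqEcard.
rewrite -(leq_add2r 1) cS cS' leqnn andbT SE; exact: finset.subsetUr.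
Qed.

Lemma chi_tree_union (s : seq {set edge G}) : uniq s -> all (@spanning_tree G) s ->
  chi (chart_union s) (size s)%:Z.
Proof.
elim: s => [_ _|S s IH /= /andP[Ss us] /andP[tS ts]].
  by rewrite chart_union_nil; exact: chi_set0.
apply: (eq_chi (a := 1 + (size s)%:Z - 0)); first by rewrite subr0 -PoszD add1n.
apply: chi_chart_union.
- by have /andP[Sc cS] := tS; have := chi_chart_open Sc; rewrite cS.
- exact: IH.
- apply: chi_excess_union; rewrite all_map; apply/allP => S' S's /=.
  apply: tree_union_excess => //; first exact: (allP ts).
  by apply: contraNneq Ss => <-.
Qed.

Theorem Bvar_euler : euler_characteristic (analytic X) (num_spanning_trees G)%:Z.
Proof.
pose trees : {set {set edge G}} := [set S | spanning_tree S]%SET.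
have -> : num_spanning_trees G = size (enum trees).
  rewrite -cardE; apply: eq_card => S; rewrite !inE.
  by apply/asboolP/idP => /spanning_treeP.
apply: euler_characteristicP.
suff <- : chart_union (enum trees) = setT.
  apply: chi_tree_union; first exact: enum_uniq.
  by apply/allP => S; rewrite mem_enum inE.
apply/seteqP; split=> // A _.
have [l Gl lS] := grown_exists (support_connected eta_gen (reprX A)).
exists [set e in ledges l]%SET.
  rewrite mem_enum inE /spanning_tree grown_connected //=.
  by rewrite card_ledges.
by split=> e; rewrite ?inE // => /lS; rewrite inE.
Qed.

End EulerCharacteristic.

Theorem theorem1p0p3 (G : graph) (eta : vert G -> Cstar)
    (G_connected : gconnected G) (eta_sum : sum_zero eta)
    (eta_generic : generic eta) :
  [/\ is_variety (Bvar eta),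
      motivic_class Bloop = LL ^+ 2 - LL + 1,
      forall e : edge G,
        [/\ bridge e ->
              motivic_class (Bvar eta) =
              motivic_class (Bvar (contract_param eta e)),
            is_loop e ->
              motivic_class (Bvar eta) =
              motivic_class (@Bvar (delete e) eta) * motivic_class Bloop
          & ~~ bridge e -> ~~ is_loop e ->
              motivic_class (Bvar eta) =
              motivic_class (@Bvar (delete e) eta) * LL +
              motivic_class (Bvar (contract_param eta e))],
      motivic_class (Bvar eta) =
        \sum_(S : {set edge G} | gconnected (subgraph S))
          (LL - 1) ^+ (2 * betti1 (subgraph S)) *
          LL ^+ (betti1 G - betti1 (subgraph S))
    & euler_characteristic (analytic (Bvar eta)) (num_spanning_trees G)%:Z].
Proof.
split.
- exact: Bvar_variety eta_sum eta_generic.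
- exact: mc_Bloop.
- move=> e; split.
  + exact: mc_bridge.
  + exact: mc_loop.
  + by move=> _; exact: mc_recursion.
- exact: mc_spanning_sum.
- exact: Bvar_euler.
Qed.
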